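(* Let $T\colon M\to M$ be a nonuniformly expanding map (with the data $Y,\alpha,\tau,F,\lambda,\mu,K$ of the context), let $R'>K\lambda/(\lambda-1)$ be fixed, let $v\colon M\to\mathbb{R}^d$ be a bounded observable, $|v|_\infty=\sup_{x\in M}|v(x)|$, and $v_n=\sum_{k=0}^{n-1}v\circ T^k$. Let $\rho_1,\rho_2$ be two forward regular probability measures on $M$ with disintegrations $\rho_j=\int_{E_j}\rho_{j,z}\,d\varkappa_j(z)$ and jump functions $r_j\colon E_j\to\mathbb{N}_0$, $j=1,2$. Let $X_n=(v_n,\rho_1)$ and $Y_n=(v_n,\rho_2)$ be the corresponding random processes. Then the processes $\{X_n,n\ge0\}$ and $\{Y_n,n\ge0\}$ can be redefined on the same probability space $(\Omega,\mathbb{P})$ such that $Z=\sup_{n\ge0}|X_n-Y_n|$ is finite with probability one. Also: (a) (Weak polynomial moments) If $\varkappa_1(r_1\ge n)\le C_\beta n^{-\beta}$, $\varkappa_2(r_2\ge n)\le C_\beta n^{-\beta}$ and $\mu(\tau\ge n)\le C_\beta n^{-\beta}$ for all $n\ge1$ with some constants $C_\beta>0$ and $\beta>1$, then $\mathbb{P}(Z\ge x)\le Cx^{-\beta}$ for all $x>0$, where the constant $C$ depends continuously (only) on $\lambda$, $K$, $R'$, $\beta$, $C_\beta$ and $|v|_\infty$. (b) (Strong polynomial moments) If $\int r_1^\beta\,d\varkappa_1\le C_\beta$, $\int r_2^\beta\,d\varkappa_2\le C_\beta$ and $\int\tau^\beta\,d\mu\le C_\beta$ with some constants $C_\beta>0$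 and $\beta>1$, then $\int Z^\beta\,d\mathbb{P}\le C$, where the constant $C$ depends continuously (only) on $\lambda$, $K$, $R'$, $\beta$, $C_\beta$ and $|v|_\infty$. (c) (Exponential and stretched exponential moments) If $\varkappa_1(r_1\ge n)\le C_{\alpha,\gamma}e^{-\alpha n^\gamma}$, $\varkappa_2(r_2\ge n)\le C_{\alpha,\gamma}e^{-\alpha n^\gamma}$ and $\mu(\tau\ge n)\le C_{\alpha,\gamma}e^{-\alpha n^\gamma}$ for all $n$ with some constants $\alpha>0$, $\gamma\in(0,1]$, $C_{\alpha,\gamma}>0$, then $\mathbb{P}(Z\ge x)\le Ce^{-Ax^\gamma}$ for all $x>0$, where the constants $C>0$ and $A>0$ depend continuously (only) on $\lambda$, $K$, $R'$, $\alpha$, $\gamma$, $C_{\alpha,\gamma}$ and $|v|_\infty$. (In (c), $\alpha$ is a number, not the partition.)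
   Context: Notation: $\mathbb{N}=\{1,2,\ldots\}$, $\mathbb{N}_0=\mathbb{N}\cup\{0\}$. For a measure $\nu$ and map $G$, $G_*\nu$ is the push-forward. Nonuniformly expanding maps. $(M,d)$ is a metric space with a Borel probability measure $m$, and $T\colon M\to M$ is a nonsingular transformation. There exist $Y\subset M$ with $m(Y)>0$, an at most countable partition $\alpha$ of $Y$ (modulo a zero measure set) and $\tau\colon Y\to\mathbb{N}$ (return time) with $\int_Y\tau\,dm<\infty$ such that for every $a\in\alpha$: $m(a)>0$; $\tau$ is constant on $a$ with value $\tau(a)$; $T^{\tau(a)}a\subset Y$. The induced map is $F\colon Y\to Y$, $Fy=T^{\tau(y)}y$. There are constants $\lambda>1$, $\hat K\ge0$ such that for each $a\in\alpha$ and $x,y\in a$: $F$ restricts to a (measure-theoretic) bijection from $a$ onto $Y$; $d(Fx,Fy)\ge\lambda d(x,y)$; the inverse Jacobian $\zeta_m=\frac{dm}{dm\circ F}$ of $F$ satisfies $|\log\zeta_m(x)-\log\zeta_m(y)|\le\hat K d(Fx,Fy)$. Standing normalization: $\operatorname{diam}Y\le1$. There is a unique $F$-invariant probability measure $\mu$ on $Y$ absolutely continuous with respect to $m$ (also viewed as a measure on $M$ supported on $Y$). Put $\zeta=\frac{d\mu}{d\mu\circ F}$. $K$ is a constant depending continuously (only) on $\lambda$ and $\hat K$ such that $K^{-1}\le\frac{d\mu}{dm}\le K$ on $Y$ and $|\log\zeta(x)-\log\zeta(y)|\le K d(Fx,Fy)$ for all $x,y\in a$, $a\in\alpha$ (such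 $K$ exists). For $\phi\colon Y\to(0,\infty)$ put $|\phi|_{d,\ell}=\sup_{x\ne y\in Y}\frac{|\log\phi(x)-\log\phi(y)|}{d(x,y)}$. Regular measure: a probability measure $\rho$ on $M$ supported on $Y$ with $d\rho=\phi\,d\mu$, where $\phi\colon Y\to(0,\infty)$ satisfies $|\phi|_{d,\ell}\le R'$. Forward regular measure: a probability measure $\rho$ on $M$ which allows a disintegration $\rho=\int_E\rho_z\,d\varkappa(z)$, where $(E,\varkappa)$ is a probability space and $\{\rho_z\}$ is a measurable family of probability measures on $M$, such that there is a (measurable) function $r\colon E\to\mathbb{N}_0$, called a jump function, such that $T_*^{r(z)}\rho_z$ is a regular measure for each $z\in E$. For a probability measure $\nu$ on $M$ and a measurable $v\colon M\to\mathbb{R}^d$ with Birkhoff sums $v_n$, $(v_n,\nu)$ denotes the discrete time random process $\{v_n,n\ge0\}$ on the probability space $(M,\nu)$. ''Redefined on the same probability space $(\Omega,\mathbb{P})$'' means: there exist processes $X_n'$, $Y_n'$ on $(\Omega,\mathbb{P})$ such that $\{X_n',n\ge0\}$ equals $\{X_n,n\ge0\}$ in distribution, $\{Y_n',n\ge0\}$ equals $\{Y_n,n\ge0\}$ in distribution, and the stated properties hold for $X_n',Y_n'$ in place of $X_n,Y_n$. *)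

(* Defs.v *)
From HB Require Import structures.
From mathcomp Require Import all_boot all_order all_algebra.
From mathcomp Require Import all_classical all_reals all_analysis.

Set Implicit Arguments.
Unset Strict Implicit.
Unset Printing Implicit Defensive.

Import Order.TTheory GRing.Theory Num.Theory.
Import numFieldNormedType.Exports.

Local Open Scope classical_set_scope.
Local Open Scope ring_scope.

(* A [measurableType] carries a distinguished point, a [metricType] does not.
   A space with a probability measure is nonempty, so pointing it is harmless. *)
#[short(type="pmetricType")]
HB.structure Definition PointedMetric (K : numDomainType) :=
  {M of Metric K M & Pointed M}.

Notation borel X := (g_sigma_algebraType (@open X)).

Section MeasurableMaps.
Context {R : realType} d (X : measurableType d).
Implicit Types (nu : set X -> \bar R) (f : X -> X) (a b : set X).

(* Bijection from a onto b, bimeasurable, after removing null sets from both. *)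
Definition measure_bijection nu f a b : Prop :=
  exists N N' : set X,
    [/\ [/\ measurable N, N `<=` a & nu N = 0%E],
        [/\ measurable N', N' `<=` b & nu N' = 0%E],
        set_bij (a `\` N) (b `\` N') f,
        measurable_fun (a `\` N) f &
        forall A, measurable A -> A `<=` a `\` N -> measurable (f @` A)].

(* zeta is a version of d nu / d (nu o f) on a. The image f @` A may be
   measurable only up to a null set, hence the outer measure nu^*, which is the
   completion of nu on such sets. *)
Definition inverse_jacobian nu f a (zeta : X -> R) : Prop :=
  [/\ measurable_fun a zeta,
      forall x, a x -> 0 < zeta x &
      exists nuf : {measure set X -> \bar R},
        (forall A, measurable A -> A `<=` a -> nuf A = (nu^*)%mu (f @` A)) /\
        (forall A, measurable A -> A `<=` a ->
           nu A = (\int[nuf]_(x in A) (zeta x)%:E)%E)].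

End MeasurableMaps.

Section NonuniformlyExpanding.
Context {R : realType} {M : pmetricType R}.
Implicit Types (m mu : probability (borel M) R) (T : borel M -> borel M)
  (Y : set (borel M)) (alpha : set (set (borel M))) (tau : borel M -> nat).

Local Notation dist := (@mdist R M).

(* tau is only meaningful on Y. *)
Definition induced T tau : borel M -> borel M := fun y => iter (tau y) T y.

Record nonuniformly_expanding m T Y alpha tau (lambda Khat : R) : Prop := {
  nue_T_measurable : measurable_fun setT T ;
  nue_T_nonsingular :
    forall A, measurable A -> m A = 0%E -> m (T @^-1` A) = 0%E ;
  nue_Y_measurable : measurable Y ;
  nue_Y_gt0 : (0 < m Y)%E ;
  nue_diam : forall x y, Y x -> Y y -> dist x y <= 1 ;
  nue_alpha_countable : countable alpha ;
  nue_alpha_sub : forall a, alpha a -> measurable a /\ a `<=` Y ;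
  nue_alpha_trivIset : trivIset alpha id ;
  nue_alpha_cover : m (Y `\` \bigcup_(a in alpha) a) = 0%E ;
  nue_tau_measurable : measurable_fun Y tau ;
  nue_tau_gt0 : forall y, Y y -> (0 < tau y)%N ;
  nue_tau_int : (\int[m]_(y in Y) ((tau y)%:R : R)%:E < +oo)%E ;
  nue_alpha_gt0 : forall a, alpha a -> (0 < m a)%E ;
  nue_tau_const : forall a, alpha a -> forall x y, a x -> a y -> tau x = tau y ;
  nue_return : forall a, alpha a -> forall x, a x -> Y (induced T tau x) ;
  nue_lambda_gt1 : 1 < lambda ;
  nue_Khat_ge0 : 0 <= Khat ;
  nue_bijection :
    forall a, alpha a -> measure_bijection m (induced T tau) a Y ;
  nue_expanding : forall a, alpha a -> forall x y, a x -> a y ->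
    lambda * dist x y <= dist (induced T tau x) (induced T tau y) ;
  nue_distortion : exists zeta : borel M -> R, forall a, alpha a ->
    inverse_jacobian m (induced T tau) a zeta /\
    forall x y, a x -> a y ->
      `|ln (zeta x) - ln (zeta y)| <=
        Khat * dist (induced T tau x) (induced T tau y)
}.

(* K is any constant with the two stated bounds; 0 < K follows from the first. *)
Record induced_acip m T Y alpha tau mu (K : R) : Prop := {
  acip_supp : mu Y = 1%E ;
  acip_invariant : forall A, measurable A ->
    mu (Y `&` induced T tau @^-1` A) = mu A ;
  acip_dominated : mu `<< m ;
  acip_density : exists h : borel M -> R,
    [/\ measurable_fun Y h,
        forall y, Y y -> K^-1 <= h y <= K &
        forall A, measurable A -> mu A = (\int[m]_(y in A `&` Y) (h y)%:E)%E] ;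
  acip_distortion : exists zeta : borel M -> R, forall a, alpha a ->
    inverse_jacobian mu (induced T tau) a zeta /\
    forall x y, a x -> a y ->
      `|ln (zeta x) - ln (zeta y)| <=
        K * dist (induced T tau x) (induced T tau y)
}.

Definition log_lipschitz_seminorm Y (phi : borel M -> R) : \bar R :=
  ereal_sup [set t | exists x y, [/\ Y x, Y y, x <> y &
    t = (`|ln (phi x) - ln (phi y)| / dist x y)%:E]].

Definition regular_measure Y mu (R' : R) (rho : set (borel M) -> \bar R) :=
  rho setT = 1%E /\
  exists phi : borel M -> R,
    [/\ measurable_fun Y phi,
        forall y, Y y -> 0 < phi y,
        (log_lipschitz_seminorm Y phi <= R'%:E)%E &
        forall A, measurable A ->
          rho A = (\int[mu]_(y in A `&` Y) (phi y)%:E)%E].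

(* rho = \int rhoz z d kappa(z) is forward regular with jump function r. *)
Definition forward_regular T Y mu (R' : R) (rho : probability (borel M) R)
    (dE : measure_display) (E : measurableType dE) (kappa : probability E R)
    (rhoz : R.-pker E ~> borel M) (r : E -> nat) : Prop :=
  [/\ forall A, measurable A -> rho A = (\int[kappa]_z rhoz z A)%E,
      measurable_fun setT r &
      forall z, regular_measure Y mu R' (pushforward (rhoz z) (iter (r z) T))].

End NonuniformlyExpanding.

Section Processes.
Context {R : realType} {n : nat}.
Local Notation V := 'rV[R]_n.

Definition enorm (x : V) : R := Num.sqrt (\sum_i x ord0 i ^+ 2).

Definition sup_norm {X : Type} (v : X -> V) : R :=
  sup (range (fun x => enorm (v x))).

Definition birkhoff {X : Type} (T : X -> X) (v : X -> V) (k : nat) (x : X) : V :=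
  \sum_(i < k) v (iter i T x).

(* Product sigma-algebra on R^n-valued sequences: equality in distribution of
   two processes is equality of their laws on path space. *)
Definition path_measurable : set (set (nat -> V)) :=
  <<s \bigcup_k preimage_set_system setT (fun w : nat -> V => w k : borel V)
        measurable >>.

Definition eq_in_distribution (d1 d2 : measure_display)
    (O1 : measurableType d1) (P1 : probability O1 R) (X1 : nat -> O1 -> V)
    (O2 : measurableType d2) (P2 : probability O2 R) (X2 : nat -> O2 -> V) :=
  forall A, path_measurable A ->
    P1 [set w | A (X1^~ w)] = P2 [set w | A (X2^~ w)].

Definition sup_distance {O : Type} (X Y : nat -> O -> V) (w : O) : \bar R :=
  ereal_sup (range (fun k => (enorm (X k w - Y k w))%:E)).

End Processes.

(* Parameter ranges: (lambda, K, R', beta, C_beta, |v|) and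
   (lambda, K, R', alpha, gamma, C_(alpha, gamma), |v|). *)
Definition poly_params (R : realType) : set (R * R * R * R * R * R) :=
  [set p | let: (l, K, R', beta, C, V) := p in
    [/\ 1 < l, 0 < K, K * l / (l - 1) < R', 1 < beta & 0 < C /\ 0 <= V]].

Definition exp_params (R : realType) : set (R * R * R * R * R * R * R) :=
  [set p | let: (l, K, R', al, ga, C, V) := p in
    [/\ 1 < l, 0 < K, K * l / (l - 1) < R', 0 < al &
        [/\ 0 < ga, ga <= 1, 0 < C & 0 <= V]]].

(* Main.v *)
Require Import Defs.
From HB Require Import structures.
From mathcomp Require Import all_boot all_order all_algebra.
From mathcomp Require Import all_classical all_reals all_analysis.
From mathcomp Require Import measurable_realfun ring lra zify.

Set Implicit Arguments.
Unset Strict Implicit.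
Unset Printing Implicit Defensive.

Import Order.TTheory GRing.Theory Num.Theory.
Import numFieldNormedType.Exports.

Local Open Scope classical_set_scope.
Local Open Scope ring_scope.

(** Why the theorem holds.

    Consider a point started from a forward regular measure and look at it at
    its jump time r, when its law is regular.  A density with respect to mu
    whose logarithm is Lipschitz with constant R' on a set of diameter at most 1
    is bounded below by a multiple of its mass, so a fixed fraction xi of the
    mass can be cut off in the form xi mu.  The points of this part are stopped:
    at their recorded time they are distributed exactly according to mu, whatever
    that time is.  The remainder has a worse constant, but the next return F
    divides the constant by lambda and adds the distortion K, and the
    hypothesis R' > K lambda / (lambda - 1) leaves room to choose xi so small
    that the constant is at most R' again.  Hence the operation repeats, and the
    unstopped mass is at most (1 - xi)^n after n returns.  In the end every starting
    point x receives a randomized stopping time N such that T^N x has law mu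
    (regeneration_step, regeneration).  All the estimates avoid densities: the
    property of being log-Lipschitz is written as an inequality linear in the
    measure (log_regular), hence it passes to sums over branches and integrals
    over the disintegration.

    The two measures are coupled by making their stopped points coincide.  The
    coupling space is the product of (M, mu) with two copies of the unit
    interval: draw y of law mu, then, with private randomness, draw the past of
    y under each of the two measures.  The past, that is the path of Birkhoff
    sums together with N, is coded by one real number (family_code), and its
    conditional law given y is sampled by inverting conditional distribution
    functions (outsourcing).  From the times N1 and N2 on, both paths add the
    Birkhoff sums of the same orbit, and therefore they differ by at most
    2 |v| max(N1, N2) at all times (delayed_paths_close).

    It remains to bound the tails of N.  If I_n(f) is the integral of f(time)
    over the mass not stopped after n returns, then f(k + t) <= u(k) + u'(k) w(t)
    implies

      I_(n+1)(f) <= (1 - xi) I_n(u) + e^R' I_n(u') int w(tau) dmu,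

    because densities of regular measures are at most e^R' times their mass.
    Each of the three moment conditions is preserved by this recursion, up to a
    geometric factor, for a suitable choice of f, u, u' and w; summing over n
    gives explicit constants (renewal_poly_tail, renewal_poly_moment,
    renewal_exp_moment), which are visibly continuous in the parameters. *)

(** * Coding countably many real numbers by one *)

Section TernaryCode.
Context {R : realType}.
Implicit Types (b : nat -> bool) (c : R).

(** Base 3 with digits 0 and 1: unlike binary expansions, these determine
    their digits. *)
Definition ternary_sum b (n : nat) : R :=
  \sum_(0 <= j < n) (b j)%:R * 3%:R^-1 ^+ j.+1.

Definition ternary_code b : R := limn (ternary_sum b).

Definition ternary_digit c : bool := 3%:R^-1 <= c.

Definition ternary_shift c : R := 3%:R * c - (ternary_digit c)%:R.

Definition ternary_bit (j : nat) c : bool :=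
  ternary_digit (iter j ternary_shift c).

Lemma ternary_sumS b n :
  ternary_sum b n.+1 = ((b 0%N)%:R + ternary_sum (fun j => b j.+1) n) / 3%:R.
Proof.
rewrite /ternary_sum big_nat_recl//= expr1 mulrDl; congr (_ + _).
rewrite big_distrl/=; apply: eq_bigr => j _.
by rewrite exprSr mulrA.
Qed.

Lemma ternary_sum_ge0 b n : 0 <= ternary_sum b n.
Proof. by apply: sumr_ge0 => j _; rewrite mulr_ge0. Qed.

Lemma ternary_sum_le b n : ternary_sum b n <= 2%:R^-1.
Proof.
elim: n b => [|n IH] b; first by rewrite /ternary_sum big_geq// invr_ge0.
rewrite ternary_sumS; have := IH (fun j => b j.+1).
by case: (b 0%N) => /= ?; lra.
Qed.

Lemma ternary_sum_cvg b : cvgn (ternary_sum b).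
Proof.
apply: nondecreasing_is_cvgn.
  apply/nondecreasing_seqP => n; rewrite /ternary_sum big_nat_recr//=.
  by rewrite lerDl mulr_ge0.
by exists 2%:R^-1 => _ [n _ <-]; exact: ternary_sum_le.
Qed.

Lemma ternary_code_ge0 b : 0 <= ternary_code b.
Proof.
apply: limr_ge; first exact: ternary_sum_cvg.
by apply: nearW => n; exact: ternary_sum_ge0.
Qed.

Lemma ternary_code_le b : ternary_code b <= 2%:R^-1.
Proof.
apply: limr_le; first exact: ternary_sum_cvg.
by apply: nearW => n; exact: ternary_sum_le.
Qed.

Lemma ternary_codeS b :
  ternary_code b = ((b 0%N)%:R + ternary_code (fun j => b j.+1)) / 3%:R.
Proof.
apply/cvg_lim => //; rewrite -cvg_shiftS/=.
under eq_fun do rewrite ternary_sumS.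
apply: cvgMl; apply: cvgD; first exact: cvg_cst.
exact: ternary_sum_cvg.
Qed.

(** A leading digit 1 contributes 1/3, all the other digits together at most
    1/6: hence the first digit can be read off the code. *)
Lemma ternary_digit_code b : ternary_digit (ternary_code b) = b 0%N.
Proof.
rewrite /ternary_digit ternary_codeS.
have := ternary_code_ge0 (fun j => b j.+1).
have := ternary_code_le (fun j => b j.+1).
by case: (b 0%N) => /= ? ?; [apply/idP|apply/negbTE; rewrite -ltNge]; lra.
Qed.

Lemma ternary_bit_code b j : ternary_bit j (ternary_code b) = b j.
Proof.
elim: j b => [|j IH] b; first exact: ternary_digit_code.
rewrite -[RHS](IH (fun j => b j.+1)) /ternary_bit iterSr.
congr (ternary_digit (iter j _ _)).
by rewrite /ternary_shift ternary_digit_code ternary_codeS; lra.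
Qed.

Lemma measurable_ternary_digit : measurable_fun setT ternary_digit.
Proof. exact: measurable_fun_ler. Qed.

Lemma measurable_ternary_bit j : measurable_fun setT (ternary_bit j).
Proof.
have mb d (T : measurableType d) (f : T -> R) : measurable_fun setT f ->
    measurable_fun setT (fun x => (ternary_digit (f x))%:R : R).
  move=> mf; rewrite (_ : (fun _ => _) =
    fun x => if ternary_digit (f x) then 1 else 0); last first.
    by apply/funext => x; case: ternary_digit.
  apply: measurable_fun_ifT => //.
  by apply: (measurableT_comp measurable_ternary_digit).
rewrite /ternary_bit; apply: (measurableT_comp measurable_ternary_digit).
elim: j => [|j IH]; first exact: measurable_id.
rewrite /= /ternary_shift; apply: measurable_funB; last exact: mb.
exact: measurable_funM.
Qed.

Lemma measurable_ternary_code d (T : measurableType d) (b : T -> nat -> bool) :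
  (forall j, measurable_fun setT (b ^~ j)) ->
  measurable_fun setT (fun x => ternary_code (b x)).
Proof.
move=> mb; apply: (@measurable_fun_cvg _ _ _ _
  (fun n x => ternary_sum (b x) n)) => [n|x _]; last exact: ternary_sum_cvg.
rewrite /ternary_sum; apply: measurable_sum => j.
apply: measurable_funM => //.
rewrite (_ : (fun _ => _) = fun x => if b x j then 1 else 0).
  exact: measurable_fun_ifT.
by apply/funext => x; case: (b x j).
Qed.

End TernaryCode.

Section FamilyCode.
Context {R : realType} {I : countType}.

(** The bits of a family of reals are the truth values of x i <= q, over all
    indices i and rationals q. *)
Definition family_bits (x : I -> R) (j : nat) : bool :=
  if unpickle j is Some (i, q) then x i <= ratr (q : rat) else false.

Definition family_code (x : I -> R) : R := ternary_code (family_bits x).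

(** The rational numbers q with x i <= q, as read off the code c; the infimum
    of this sequence recovers x i. *)
Definition family_cut (i : I) (c : R) (j : nat) : \bar R :=
  if unpickle j is Some q then
    if ternary_bit (pickle (i, q : rat)) c then (ratr q)%:E else +oo%E
  else +oo%E.

Definition family_decode (i : I) (c : R) : R := fine (einfs (family_cut i c) 0).

Lemma family_codeK (x : I -> R) i : family_decode i (family_code x) = x i.
Proof.
rewrite /family_decode (_ : einfs _ 0 = (x i)%:E)//=.
rewrite /einfs/=; apply/eqP; rewrite eq_le; apply/andP; split.
  apply/lee_addgt0Pr => e e0.
  have [q] := rat_in_itvoo (ltr_pwDr e0 (lexx (x i))).
  rewrite in_itv/= => /andP[xq qe].
  apply: (@le_trans _ _ (ratr q)%:E); last by rewrite -EFinD lee_fin ltW.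
  apply: ereal_inf_lbound; exists (pickle q) => //=.
  rewrite /family_cut pickleK /family_code ternary_bit_code.
  by rewrite /family_bits pickleK ltW.
apply: le_ereal_inf_tmp => _ [j _ <-].
rewrite /family_cut; case: unpickle => [q|]; last by rewrite leey.
rewrite /family_code ternary_bit_code /family_bits pickleK.
by case: ifPn => // _; rewrite leey.
Qed.

Lemma family_code_itv (x : I -> R) : 0 <= family_code x <= 2%:R^-1.
Proof. by rewrite /family_code ternary_code_ge0 ternary_code_le. Qed.

Lemma measurable_family_decode i : measurable_fun setT (family_decode i).
Proof.
apply: (measurableT_comp (fine_measurable _)) => //.
apply: measurable_fun_einfs => j; rewrite /family_cut.
case: unpickle => [q|]; last exact: measurable_cst.
by apply: measurable_fun_ifT => //; exact: measurable_ternary_bit.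
Qed.

Lemma measurable_family_code d (T : measurableType d) (x : T -> I -> R) :
  (forall i, measurable_fun setT (x ^~ i)) ->
  measurable_fun setT (fun t => family_code (x t)).
Proof.
move=> mx; apply: measurable_ternary_code => j; rewrite /family_bits.
case: unpickle => [[i q]|]; last exact: measurable_cst.
exact: measurable_fun_ler.
Qed.

End FamilyCode.

(** * The Borel sets of row vectors are generated by the coordinates *)

Section BorelRowVectors.
Context {R : realType} {n : nat}.
Local Notation V := 'rV[R]_n.

Definition rat_box (c : 'rV[rat]_n) (k : nat) : set V :=
  [set x | forall i, `|ratr (c ord0 i) - x ord0 i| < k.+1%:R^-1].

(** Rational boxes form a countable base: a radius 1/(k+1) below half the
    radius of a ball, and a rational centre closer than that to its centre. *)
Lemma open_bigcup_rat_box (U : set V) : open U ->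
  U = \bigcup_(p in [set p : 'rV[rat]_n * nat | rat_box p.1 p.2 `<=` U])
        rat_box p.1 p.2.
Proof.
move=> oU; apply/seteqP; split => [x Ux|x [[c k] /= sub cx]]; last exact: sub.
have /nbhs_ballP[e/= e0 xe] : nbhs x U by apply: open_nbhs_nbhs; split.
have [k ke] : exists k : nat, 2 * k.+1%:R^-1 < e.
  have e20 : 0 < e / 2 by rewrite divr_gt0.
  have [k _ /(_ k (leqnn _))/= h] := near_infty_natSinv_lt (PosNum e20).
  exists k; have : k.+1%:R^-1 < e / 2 by [].
  by rewrite ltr_pdivlMr// mulrC.
have k0 : 0 < (k.+1%:R^-1 : R) by rewrite invr_gt0.
have hq (i : 'I_n) : exists q : rat, `|ratr q - x ord0 i| < k.+1%:R^-1.
  have [q] := rat_in_itvoo (ltr_pwDr k0 (lexx (x ord0 i))).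
  rewrite in_itv/= => /andP[q1 q2]; exists q.
  by rewrite gtr0_norm ?subr_gt0// ltrBlDl.
have [q hq'] := choice hq.
exists (\row_i q i, k) => /= [y hy|i]; last by rewrite mxE.
apply: xe; rewrite /ball/= /mx_ball; split=> // i j; rewrite /ball/= ord1.
have := hq' j; have := hy j; rewrite mxE => h1 h2.
rewrite (_ : _ - _ = (x ord0 j - ratr (q j)) + (ratr (q j) - y ord0 j)); last ring.
apply: le_lt_trans (ler_normD _ _) _; apply: lt_trans ke.
by rewrite mulr_natl mulr2n ltrD// distrC.
Qed.

Lemma measurable_coord (i : 'I_n) :
  measurable_fun setT (fun x : borel V => x ord0 i).
Proof.
move=> _; apply: (measurability _ (RGenInftyO.measurableE R)) => //.
move=> _ [_ [t ->] <-]; apply: measurableI => //.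
apply: sub_sigma_algebra; apply: open_comp => [x _|]; last exact: interval_open.
exact: coord_continuous.
Qed.

Lemma measurable_row d (T : measurableType d) (f : T -> borel V) :
  (forall i, measurable_fun setT (fun t => f t ord0 i)) ->
  measurable_fun setT f.
Proof.
move=> mf _; apply: (measurability _ (erefl : @measurable _ (borel V) = <<s @open V>>)) => //.
move=> _ [U oU <-].
rewrite setTI (open_bigcup_rat_box oU) preimage_bigcup bigcup_mkcond.
apply: countable_bigcupT_measurable => [|[c k]]; first exact: countableP.
case: ifPn => _ //.
have -> : f @^-1` rat_box c k = \bigcap_(i in [set: 'I_n])
    ((fun t => f t ord0 i) @^-1` ball (ratr (c ord0 i) : R) k.+1%:R^-1).
  by apply/seteqP; split => [t h i _|t h i]; exact: h.
apply: fin_bigcap_measurable => [|i _]; first exact: finite_finset.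
rewrite -[X in measurable X]setTI.
by apply: mf => //; exact: measurable_ball.
Qed.

End BorelRowVectors.

(** * Constructions of measures and densities *)

Section MeasureTools.
Local Open Scope ereal_scope.
Context {R : realType}.

Lemma exists_measure d (T : measurableType d) (f : set T -> \bar R) :
  f set0 = 0 -> (forall A, 0 <= f A) -> semi_sigma_additive f ->
  exists nu : {measure set T -> \bar R}, nu = f :> (set T -> \bar R).
Proof.
move=> f0 fge0 fs.
pose mf := isMeasure.Build _ _ _ f f0 fge0 fs.
pose nu : {measure set T -> \bar R} := HB.pack f mf.
by exists nu.
Qed.

Lemma exists_finite_measure d (T : measurableType d)
    (nu : {measure set T -> \bar R}) : nu setT < +oo ->
  exists nu' : {finite_measure set T -> \bar R}, nu' = nu :> (set T -> \bar R).
Proof.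
move=> nufin.
have nuf : fin_num_fun nu by exact: lty_fin_num_fun.
pose f : set T -> \bar R := nu.
pose mf := isMeasure.Build _ _ _ f (measure0 nu) (measure_ge0 nu)
  (@measure_semi_sigma_additive _ _ _ nu).
pose f' : {measure set T -> \bar R} := HB.pack f mf.
pose mf' := Measure_isFinite.Build _ _ _ f' nuf.
pose nu' : {finite_measure set T -> \bar R} := HB.pack f mf mf'.
by exists nu'.
Qed.

Lemma exists_probability d (T : measurableType d)
    (nu : {measure set T -> \bar R}) : nu setT = 1 ->
  exists nu' : probability T R, nu' = nu :> (set T -> \bar R).
Proof.
move=> nu1.
pose f : set T -> \bar R := nu.
pose mf := isMeasure.Build _ _ _ f (measure0 nu) (measure_ge0 nu)
  (@measure_semi_sigma_additive _ _ _ nu).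
pose f' : {measure set T -> \bar R} := HB.pack f mf.
pose mf' := Measure_isProbability.Build _ _ _ f' nu1.
pose nu' : probability T R := HB.pack f mf mf'.
by exists nu'.
Qed.

Lemma finite_measureT_lty d (T : measurableType d)
    (m : {finite_measure set T -> \bar R}) : m setT < +oo.
Proof. by apply: fin_num_fun_lty; exact: fin_num_measure. Qed.

Lemma exists_density_measure d (T : measurableType d)
    (nu : {measure set T -> \bar R}) (f : T -> \bar R) :
  measurable_fun setT f -> (forall x, 0 <= f x) ->
  exists nu' : {measure set T -> \bar R},
    forall A, nu' A = \int[nu]_(x in A) f x.
Proof.
move=> mf f0.
have [|A|F mF tF mUF|nu' nu'E] :=
    @exists_measure _ _ (fun A => \int[nu]_(x in A) f x).
- by rewrite integral_set0.
- exact: integral_ge0.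
- apply: cvg_toP.
    apply: ereal_nondecreasing_is_cvgn => m n mn.
    by apply: lee_sum_nneg_natr => // k _ _; exact: integral_ge0.
  by rewrite ge0_integral_bigcup//=; exact: measurable_funTS.
by exists nu' => A; rewrite nu'E.
Qed.

(** The set E where g < f is itself a test set: the integral of f - g over E
    is at most 0 while the integrand is positive there. *)
Lemma ae_le_of_integral d (T : measurableType d)
    (nu : {finite_measure set T -> \bar R}) (f g : T -> R) :
  measurable_fun setT f -> measurable_fun setT g ->
  (forall x, (0 <= f x)%R) -> (forall x, (0 <= g x)%R) ->
  (forall A, measurable A ->
     \int[nu]_(x in A) (f x)%:E <= \int[nu]_(x in A) (g x)%:E) ->
  \int[nu]_x (g x)%:E < +oo ->
  nu [set x | (g x < f x)%R] = 0.
Proof.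
move=> mf mg f0 g0 fg gfin.
set E := [set x | _].
have mE : measurable E.
  rewrite -[E]setTI; apply: (measurable_fun_ltr mg mf) => //.
pose h x := (f x - g x)%R.
have Eh x : E x -> (0 < h x)%R by rewrite /h subr_gt0.
have mh : measurable_fun E (EFin \o h).
  by apply/measurable_EFinP; apply: measurable_funTS; exact: measurable_funB.
have mgE : measurable_fun E (fun x => (g x)%:E).
  by apply/measurable_EFinP; exact: measurable_funTS.
have hE : \int[nu]_(x in E) (f x)%:E =
    \int[nu]_(x in E) (h x)%:E + \int[nu]_(x in E) (g x)%:E.
  rewrite -ge0_integralD//=.
  - by apply: eq_integral => x _; rewrite -EFinD subrK.
  - by move=> x /Eh/ltW; rewrite lee_fin.
  - by move=> x _; rewrite lee_fin.
have gEfin : \int[nu]_(x in E) (g x)%:E \is a fin_num.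
  rewrite ge0_fin_numE; last by apply: integral_ge0 => x _; rewrite lee_fin.
  apply: le_lt_trans gfin; apply: ge0_subset_integral => //.
  - exact/measurable_EFinP.
  - by move=> x _; rewrite lee_fin.
have h0 : \int[nu]_(x in E) (h x)%:E = 0.
  apply/eqP; rewrite eq_le; apply/andP; split; last first.
    by apply: integral_ge0 => x /Eh/ltW; rewrite lee_fin.
  have := fg _ mE; rewrite hE.
  by rewrite -leeBrDr// subee.
have /ae_eq_integral_abs : \int[nu]_(x in E) `|(EFin \o h) x| = 0.
  rewrite -[RHS]h0; apply: eq_integral => x; rewrite inE => /Eh hx.
  by rewrite /= gtr0_norm.
move=> /(_ mE mh) [N [mN N0 sub]].
apply: (subset_measure0 mE mN _ N0) => x Ex; apply: sub => /= /(_ Ex) [hx].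
by have := Eh _ Ex; rewrite hx ltxx.
Qed.

(** The Radon-Nikodym derivative is at most 1 almost everywhere, and truncating
    it makes the bound hold at every point. *)
Lemma density_le1 d (T : measurableType d)
    (Q nu : {finite_measure set T -> \bar R}) :
  (forall A, measurable A -> nu A <= Q A) ->
  exists g : T -> R, [/\ measurable_fun setT g,
    forall x, (0 <= g x <= 1)%R &
    forall A, measurable A -> nu A = \int[Q]_(x in A) (g x)%:E].
Proof.
move=> nuQ.
have dom : nu `<< Q.
  apply/null_content_dominatesP => A mA QA0; apply/eqP.
  by rewrite eq_le measure_ge0 andbT -QA0 nuQ.
have [f [f0 ffin fint fE]] := radon_nikodym_sigma_finite dom.
pose g x := fine (f x).
have fgE x : f x = (g x)%:E by rewrite /g fineK.
have mf : measurable_fun setT f by exact: measurable_int fint.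
have mg : measurable_fun setT g by exact: (measurableT_comp (fine_measurable _)).
have g0 x : (0 <= g x)%R by rewrite /g fine_ge0.
have fE' A : measurable A -> nu A = \int[Q]_(x in A) (g x)%:E.
  by move=> mA; rewrite fE ?inE//; apply: eq_integral => x _.
have N0 : Q [set x | (1 < g x)%R] = 0.
  apply: (@ae_le_of_integral _ _ Q g (cst 1%R)) => //.
    by move=> A mA; rewrite -fE'//= integral_cst// mul1e nuQ.
  by rewrite /= integral_cst// mul1e; apply: fin_num_fun_lty.
exists (fun x => Num.min (g x) 1%R); split.
- exact: measurable_minr.
- by move=> x; rewrite le_min g0 ler01/= ge_min lexx orbT.
move=> A mA; rewrite fE'//; apply: ge0_ae_eq_integral => //.
- by apply/measurable_EFinP; exact: measurable_funTS.
- by apply/measurable_EFinP; apply: measurable_funTS; exact: measurable_minr.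
- by move=> x _; rewrite lee_fin.
- by move=> x _; rewrite lee_fin le_min g0 ler01.
exists [set x | (1 < g x)%R]; split => //.
  by rewrite -[X in measurable X]setTI; apply: (measurable_fun_ltr _ mg).
move=> x /= H; rewrite ltNge; apply/negP => g1; apply: H => _.
by rewrite min_l.
Qed.

End MeasureTools.

Section Pushforwards.
Context {R : realType} d d' (T : measurableType d) (T' : measurableType d').

Lemma exists_pushforward (m : {measure set T -> \bar R}) (f : T -> T') :
  measurable_fun setT f ->
  exists nu : {measure set T' -> \bar R},
    nu = pushforward m f :> (set T' -> \bar R).
Proof.
move=> mf; apply: exists_measure => [|A|F mF tF mUF].
- by rewrite /pushforward preimage_set0 measure0.
- exact: measure_ge0.
- rewrite /pushforward preimage_bigcup; apply: measure_semi_sigma_additive.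
  + by move=> n; rewrite -[X in measurable X]setTI; exact: mf.
  + apply/trivIsetP => /= i j _ _ ij; rewrite -preimage_setI.
    by move/trivIsetP : tF => /(_ _ _ _ _ ij) ->//; rewrite preimage_set0.
  + by rewrite -preimage_bigcup -[X in measurable X]setTI; exact: mf.
Qed.

Lemma exists_finite_pushforward (m : {finite_measure set T -> \bar R})
    (f : T -> T') : measurable_fun setT f ->
  exists nu : {finite_measure set T' -> \bar R},
    nu = pushforward m f :> (set T' -> \bar R).
Proof.
move=> mf; have [nu0 nu0E] := exists_pushforward m mf.
have [|nu nuE] := @exists_finite_measure _ _ _ nu0.
  by rewrite nu0E /pushforward preimage_setT; exact: finite_measureT_lty.
by exists nu; rewrite nuE.
Qed.

End Pushforwards.

Section ProductUniqueness.
Context {R : realType} d (X : measurableType d).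

(** Rays determine a finite measure on the line, rectangles one on a product:
    uniqueness of measures is used first in the second factor with B fixed, then
    on the product. *)
Lemma measure_prod_rays_unique (m1 m2 : {finite_measure set (X * R)%type -> \bar R}) :
  (forall B (t : R), measurable B ->
     m1 (B `*` `]-oo, t[%classic) = m2 (B `*` `]-oo, t[%classic)) ->
  forall D, measurable D -> m1 D = m2 D.
Proof.
move=> m12.
have rect B C : measurable B -> measurable C -> m1 (B `*` C) = m2 (B `*` C).
  move=> mB mC.
  have mBT : measurable (B `*` [set: R]) by exact: measurableX.
  have slice (m : {finite_measure set (X * R)%type -> \bar R}) :
      exists nu : {measure set R -> \bar R},
        forall A, measurable A -> nu A = m (B `*` A).
    have [nu nuE] := exists_pushforward (mrestr m mBT)
      (@measurable_snd _ _ X R).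
    exists nu => A mA; rewrite nuE /pushforward/= /mrestr; congr (m _).
    by apply/seteqP; split => -[x y] /=; tauto.
  have [n1 n1E] := slice m1; have [n2 n2E] := slice m2.
  rewrite -n1E// -n2E//.
  apply: (measure_unique (@RGenInftyO.G R) (fun k => `]-oo, k%:R[%classic)) => //.
  - exact: RGenInftyO.measurableE.
  - move=> _ _ [x ->] [y ->]; exists (Num.min x y).
    by apply/seteqP; split => z /=; rewrite !in_itv/= lt_min => /andP.
  - by move=> k; exists k%:R.
  - apply/seteqP; split => // x _; exists (Num.truncn `|x|).+1 => //=.
    rewrite in_itv/=; apply: le_lt_trans (ler_norm x) _.
    by apply: truncnS_gt.
  - by move=> _ [x ->]; rewrite n1E// n2E// m12.
  - move=> k; rewrite n1E//= -ge0_fin_numE//; apply: fin_num_measure.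
    exact: measurableX.
pose C : set (set (X * R)%type) :=
  [set C | exists A, measurable A /\ exists B, measurable B /\ C = A `*` B].
move=> D mD; apply: (measure_unique C (fun=> setT)) => //.
- rewrite measurable_prod_measurableType //; congr (<<s _ >>).
  rewrite predeqE; split => [[A mA [B mB <-]]|[A [mA [B [mB ->]]]]].
    by exists A; split => //; exists B.
  by exists A => //; exists B.
- move=> _ _ [X1 [mX1 [X2 [mX2 ->]]]] [Y1 [mY1 [Y2 [mY2 ->]]]].
  rewrite -setXI; exists (X1 `&` Y1); split; first exact: measurableI.
  by exists (X2 `&` Y2); split => //; exact: measurableI.
- by move=> _; exists setT; split=> //; exists setT; split => //; rewrite setXTT.
- by rewrite bigcup_const.
- by move=> _ [A [mA [B [mB ->]]]]; exact: rect.
- by move=> _ /=; exact: finite_measureT_lty.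
Qed.

End ProductUniqueness.

(** * Realizing a conditional law by a function of a uniform variable *)

Section Outsourcing.
Local Open Scope ereal_scope.
Context {R : realType}.

Definition uniform01 (A : set R) : \bar R := uniform_prob (@ltr01 R) A.

Let uniform01_0 : uniform01 set0 = 0. Proof. exact: measure0. Qed.

Let uniform01_ge0 A : 0 <= uniform01 A. Proof. exact: measure_ge0. Qed.

Let uniform01_additive : semi_sigma_additive uniform01.
Proof. by move=> F mF tF mUF; exact: measure_semi_sigma_additive. Qed.

HB.instance Definition _ := isMeasure.Build _ _ _ uniform01
  uniform01_0 uniform01_ge0 uniform01_additive.

Let uniform01_setT : uniform01 setT = 1.
Proof. exact: probability_setT. Qed.

HB.instance Definition _ :=
  Measure_isProbability.Build _ _ _ uniform01 uniform01_setT.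

Local Notation U := uniform01.

Lemma uniform_ray (c : R) : (0 <= c <= 1)%R -> U `]-oo, c]%classic = c%:E.
Proof.
move=> /andP[c0 c1]; rewrite /uniform01 /uniform_prob integral_uniform_pdf.
have -> : `]-oo, c]%classic `&` `[0%R, 1%R]%classic = `[0%R, c]%classic :> set R.
  apply/seteqP; split => x /=; rewrite !in_itv/=.
    by move=> [-> /andP[->]].
  by move=> /andP[-> xc]; rewrite xc (le_trans xc).
rewrite (eq_integral (cst 1)) ?integral_cst//= ?mul1e.
  rewrite lebesgue_measure_itv/=; case: ifPn; rewrite ?sube0// lte_fin -leNgt.
  by move=> ?; congr EFin; apply/le_anti/andP.
move=> x; rewrite inE/= in_itv/= => /andP[x0 xc].
by rewrite /uniform_pdf x0 (le_trans xc)//= subr0 invr1.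
Qed.

Lemma measure_subgraph d (X : measurableType d) (mu : probability X R)
    (f : X -> R) (B : set X) :
  measurable_fun setT f -> (forall x, 0 <= f x <= 1)%R -> measurable B ->
  (mu \x U) [set p | B p.1 /\ (p.2 <= f p.1)%R] = \int[mu]_(x in B) (f x)%:E.
Proof.
move=> mf f01 mB; rewrite /product_measure1 [RHS]integral_mkcond.
apply: eq_integral => x _; rewrite /= patchE; case: ifPn => xB.
  rewrite (_ : xsection _ _ = `]-oo, f x]%classic) ?uniform_ray//.
  apply/seteqP; split => y; rewrite /xsection/= in_itv/= inE/=; first by case.
  by move=> yf; split => //; rewrite inE in xB.
rewrite (_ : xsection _ _ = set0) ?measure0//.
apply/seteqP; split => y //; rewrite /xsection/= inE/= => -[Bx].
by rewrite notin_setE in xB.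
Qed.

Lemma product_null_strip d (X : measurableType d) (mu : probability X R)
    (N : set X) : measurable N -> mu N = 0 -> (mu \x U) (N `*` setT) = 0.
Proof. by move=> mN N0; rewrite product_measure1E//= N0 mul0e. Qed.

(** The running maximum, along an enumeration, of the rationals below t. *)
Lemma cofinal_rat (t : R) : (0 < t)%R ->
  exists r : nat -> rat, [/\ {homo r : m n / (m <= n)%N >-> (m <= n)%R},
    forall n, (0 <= r n)%R /\ (ratr (r n) < t)%R &
    forall q, (ratr q < t)%R -> exists n, (q <= r n)%R].
Proof.
move=> t0.
pose step n x := if unpickle n is Some q then
  (if (ratr (q : rat) < t)%R then Num.max x q else x) else x : rat.
pose r := fix r n := if n is n'.+1 then step n' (r n') else 0%R : rat.
exists r; split.
- apply/nondecreasing_seqP => n /=; rewrite /step.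
  by case: unpickle => [q|//]; case: ifP => _ //; rewrite le_max lexx.
- elim=> [|n [r0 rt]] /=; first by rewrite raddf0.
  rewrite /step; case: unpickle => [q|//]; case: ifP => qt //.
  by split; [rewrite le_max r0 | rewrite /Num.max; case: ifP].
- move=> q qt; exists (pickle q).+1; rewrite /= /step pickleK qt.
  by rewrite le_max lexx orbT.
Qed.

(** The conditional distribution functions q |-> f q y of s given G = y are
    inverted: S (y, u) is the u-quantile, the infimum of the q with
    u <= f q y.
    Monotonicity in q only holds almost surely for each pair of rationals,
    whence the null sets in the proof. *)
Lemma outsourcing d (W : measurableType d) (Q : probability W R)
    d' (X : measurableType d') (mu : probability X R) (G : W -> X) (s : W -> R) :
  measurable_fun setT G -> measurable_fun setT s ->
  (forall w, 0 <= s w < 1)%R ->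
  (forall B, measurable B -> Q (G @^-1` B) = mu B) ->
  exists S : X * R -> R, measurable_fun setT S /\
    forall D : set (X * R)%type, measurable D ->
      (mu \x U) [set p | D (p.1, S p)] = Q [set w | D (G w, s w)].
Proof.
move=> mG ms s01 GQ.
have mpre (B : set X) : measurable B -> measurable (G @^-1` B).
  by move=> mB; rewrite -[X in measurable X]setTI; exact: mG.
have mle (q : R) : measurable [set w | (s w <= q)%R].
  by rewrite -[X in measurable X]setTI; apply: (measurable_fun_ler ms).
have Qlt (q : R) : Q [set w | (s w <= q)%R] < +oo.
  by rewrite -ge0_fin_numE// fin_num_measure.
have /choice[f fP] (q : rat) : exists f : X -> R, [/\ measurable_fun setT f,
    forall x, (0 <= f x <= 1)%R & forall B, measurable B ->
      Q (G @^-1` B `&` [set w | (s w <= ratr q)%R]) = \int[mu]_(x in B) (f x)%:E].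
  have [nu nuE] := exists_finite_pushforward (mfrestr (mle (ratr q)) (Qlt (ratr q)))
    mG.
  have [|f [mf f01 fE]] := @density_le1 _ _ _ mu nu.
    move=> A mA; rewrite nuE /pushforward/= /mfrestr /mrestr -GQ//.
    by apply: le_measure; rewrite ?inE//; [apply: measurableI => //; exact: mpre|exact: mpre].
  by exists f; split => // B mB; rewrite -fE// nuE.
have mf q : measurable_fun setT (f q) by have [] := fP q.
have f01 q x : (0 <= f q x <= 1)%R by have [] := fP q.
have fE q B : measurable B ->
    Q (G @^-1` B `&` [set w | (s w <= ratr q)%R]) = \int[mu]_(x in B) (f q x)%:E.
  by have [_ _] := fP q; apply.
have fmono p q : (p <= q)%R -> mu [set x | (f q x < f p x)%R] = 0.
  move=> pq; apply: ae_le_of_integral => // [x|x|A mA|].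
  - by have /andP[] := f01 p x.
  - by have /andP[] := f01 q x.
  - rewrite -!fE//; apply: le_measure; rewrite ?inE//.
    + by apply: measurableI => //; exact: mpre.
    + by apply: measurableI => //; exact: mpre.
    + by apply: setIS => w /= h; apply: (le_trans h); rewrite ler_rat.
  - by rewrite -fE// preimage_setT setTI; exact: Qlt.
(* The candidates for the quantile; the default value 1 is above s. *)
pose h (j : nat) (p : X * R) : R := if unpickle j is Some q then
  (if (0 <= (q : rat))%R && (p.2 <= f q p.1)%R then Num.min (ratr q) 1%R else 1%R)
  else 1%R.
have h01 j p : (0 <= h j p <= 1)%R.
  rewrite /h; case: unpickle => [q|]; last by rewrite ler01 lexx.
  case: ifP => [/andP[q0 _]|]; last by rewrite ler01 lexx.
  by rewrite le_min ler01 ler0q q0 ge_min lexx orbT.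
have mh j : measurable_fun setT (h j).
  rewrite /h; case: unpickle => [q|]; last exact: measurable_cst.
  apply: measurable_fun_ifT => //; apply: measurable_and => //.
  by apply: measurable_fun_ler => //; exact: measurableT_comp.
pose S p := infs (h ^~ p) 0%N.
have hlb p : has_lbound (range (h ^~ p)).
  by exists 0%R => _ [j _ <-]; have /andP[] := h01 j p.
have mS : measurable_fun setT S by exact: measurable_fun_infs.
have Slt p t : (S p < t)%R <-> exists j, (h j p < t)%R.
  have SE : S p = inf (range (h ^~ p)).
    by rewrite /S /infs/= /sdrop; congr inf; apply/seteqP; split => x [j _ <-]; exists j.
  rewrite SE; split => [|[j hj]].
    have ne : range (h ^~ p) !=set0 by exists (h 0%N p), 0%N.
    by move=> /(inf_lt ne)[_ [j _ <-] hj]; exists j.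
  by apply: le_lt_trans hj; apply: ge_inf => //; exists j.
exists S; split => //.
have mid : measurable_fun setT (fun p : X * R => (p.1, S p)).
  exact: measurable_fun_pair.
have mid' : measurable_fun setT (fun w => (G w, s w)).
  exact: measurable_fun_pair.
have [m1 m1E] := exists_finite_pushforward
  (mu \x U : probability (X * R)%type R) mid.
have [m2 m2E] := exists_finite_pushforward Q mid'.
suff m12 D : measurable D -> m1 D = m2 D.
  by move=> D mD; have := m12 D mD; rewrite m1E m2E.
apply: measure_prod_rays_unique => B t mB {D}.
rewrite m1E m2E /pushforward.
(* Rays beyond 1 and below 0 are trivial, the others are exhausted by the
   rational ones through the sequence r. *)
have [t1|t1] := ltP 1%R t.
  transitivity (mu B).
    have -> : mu B = (mu \x U) (B `*` setT).
      by rewrite product_measure1E// [X in _ = _ * X]probability_setT mule1.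
    congr ((_ \x _) _); apply/seteqP; split => -[x u]/=; first tauto.
    move=> [Bx _]; split => //; rewrite in_itv/=; apply/Slt; exists 0%N.
    by apply: le_lt_trans t1; have /andP[] := h01 0%N (x, u).
  rewrite -GQ//; congr (Q _); apply/seteqP; split => w /=; last by case.
  move=> Bw; split => //; rewrite in_itv/=; apply: lt_trans t1.
  by have /andP[] := s01 w.
have [t0|t0] := leP t 0%R.
  have E1 : (fun p : X * R => (p.1, S p)) @^-1` (B `*` `]-oo, t[) = set0.
    apply/seteqP; split => p //= [_]; rewrite in_itv/= => /Slt[j].
    by rewrite ltNge => /negP; apply; apply: (le_trans t0); have /andP[] := h01 j p.
  have E2 : (fun w => (G w, s w)) @^-1` (B `*` `]-oo, t[) = set0.
    apply/seteqP; split => w //= [_]; rewrite in_itv/=.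
    by rewrite ltNge => /negP; apply; apply: (le_trans t0); have /andP[] := s01 w.
  by rewrite E1 E2 !measure0.
have [r [rmono r0t rcof]] := cofinal_rat t0.
pose A q := [set p : X * R | B p.1 /\ (p.2 <= f q p.1)%R].
have mA q : measurable (A q).
  rewrite (_ : A q = (B `*` setT) `&` [set p | (p.2 <= f q p.1)%R]).
    apply: measurableI; first exact: measurableX.
    rewrite -[X in measurable X]setTI.
    by apply: (measurable_fun_ler (measurable_snd) (measurableT_comp (mf q) measurable_fst)).
  by apply/seteqP; split => -[x u] /= => [[]|[[]]].
(* S p < t says that u <= f q y for some rational q < t; up to a null set it
   suffices to test the largest of the q that occur at stage n. *)
pose AA n := \bigcup_(q in [set q | (0 <= q <= r n)%R]) A q.
have mAA n : measurable (AA n).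
  rewrite /AA bigcup_mkcond; apply: bigcupT_measurable_rat => q.
  by case: ifP.
have AAE n : (mu \x U) (AA n) = Q (G @^-1` B `&` [set w | (s w <= ratr (r n))%R]).
  transitivity ((mu \x U) (A (r n))); last first.
    by rewrite fE//; exact: measure_subgraph.
  pose N1 j := if unpickle j is Some q then
    (if ((q : rat) <= r n)%R then [set x | (f (r n) x < f q x)%R] `*` [set: R]
     else set0) else set0.
  pose N := \bigcup_j N1 j.
  have mN1 q : measurable ([set x | (f (r n) x < f q x)%R] `*` [set: R]).
    apply: measurableX => //; rewrite -[X in measurable X]setTI.
    exact: (measurable_fun_ltr (mf _) (mf _)).
  have mN : measurable N.
    apply: bigcupT_measurable => j; rewrite /N1.
    by case: unpickle => [q|//]; case: ifP.
  have N0 : (mu \x U) N = 0.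
    apply/negligibleP => //; apply: negligible_bigcup => j; rewrite /N1.
    case: unpickle => [q|]; last exact: negligible_set0.
    case: ifP => [qr|_]; last exact: negligible_set0.
    apply/negligibleP; first exact: mN1.
    apply: product_null_strip; last exact: fmono.
    rewrite -[X in measurable X]setTI.
    exact: (measurable_fun_ltr (mf _) (mf _)).
  have sub : AA n `<=` A (r n) `|` N.
    move=> [x u] [q qr [/= Bx uq]].
    have [le|lt] := leP (f q x) (f (r n) x).
      by left; split => //=; exact: le_trans le.
    move: qr => /= /andP[_ qr].
    by right; exists (pickle q); [exact: I|rewrite /N1 pickleK qr].
  apply/eqP; rewrite eq_le; apply/andP; split.
    rewrite -[leRHS](measureU0 (mA (r n)) mN N0); apply: le_measure => //.
      by rewrite inE.
    by rewrite inE; exact: measurableU.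
  apply: le_measure; rewrite ?inE// => p Ap.
  by exists (r n) => //=; rewrite lexx andbT; have [] := r0t n.
have ndAA : nondecreasing_seq AA.
  apply/nondecreasing_seqP => n; apply/subsetPset => p [q /= /andP[q0 qr] Aq].
  by exists q => //=; rewrite q0 (le_trans qr)// rmono.
have AAU : \bigcup_n AA n = [set p | B p.1 /\ (S p < t)%R].
  apply/seteqP; split => [p [n _ [q /= /andP[q0 qr] [Bp uq]]]|p [Bp /Slt[j]]].
    split => //; apply/Slt; exists (pickle q); rewrite /h pickleK q0 uq/=.
    rewrite gt_min; apply/orP; left; apply: le_lt_trans (proj2 (r0t n)).
    by rewrite ler_rat.
  rewrite /h; case: unpickle => [q|]; last by rewrite ltNge t1.
  case: ifP => [/andP[q0 uq]|_]; last by rewrite ltNge t1.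
  rewrite gt_min [X in _ || X]ltNge t1 orbF => /rcof[n qr].
  by exists n => //; exists q => //=; rewrite q0.
pose C n := G @^-1` B `&` [set w | (s w <= ratr (r n))%R].
have mC n : measurable (C n) by apply: measurableI => //; exact: mpre.
have ndC : nondecreasing_seq C.
  apply/nondecreasing_seqP => n; apply/subsetPset => w [Bw /= sr].
  by split => //=; apply: (le_trans sr); rewrite ler_rat rmono.
have CU : \bigcup_n C n = G @^-1` B `&` [set w | (s w < t)%R].
  apply/seteqP; split => [w [n _ [Bw /= sr]]|w [Bw /= st]].
    by split => //=; apply: (le_lt_trans sr); have [] := r0t n.
  have [q] := rat_in_itvoo st; rewrite in_itv/= => /andP[sq /rcof[n qr]].
  exists n => //; split => //=; apply: (le_trans (ltW sq)); rewrite ler_rat.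
  exact: qr.
have c1 := nondecreasing_cvg_mu mAA (bigcupT_measurable _ mAA) ndAA (mu := (mu \x U)).
have c2 := nondecreasing_cvg_mu mC (bigcupT_measurable _ mC) ndC (mu := Q).
transitivity ((mu \x U) (\bigcup_n AA n)).
  by rewrite AAU; congr ((_ \x _) _); apply/seteqP; split => p /=; rewrite in_itv.
transitivity (Q (\bigcup_n C n)); last first.
  by rewrite CU; congr (Q _); apply/seteqP; split => p /=; rewrite in_itv.
rewrite -(cvg_lim (@ereal_hausdorff _) c1) -(cvg_lim (@ereal_hausdorff _) c2).
by congr (limn _); apply/funext => n /=; exact: AAE.
Qed.

End Outsourcing.

(** * Measures with log-Lipschitz density *)

Section RealInequalities.
Context {R : realType}.
Implicit Types (k x a b s t u v N D : R).

(** Bernoulli: the convex function y^k lies above its tangent at y = 1; here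
    y = e^x. *)
Lemma expR_bernoulli k x : 1 <= k -> 1 + k * (expR x - 1) <= expR (k * x).
Proof.
move=> k1.
have -> : expR (k * x) = expR x * expR ((k - 1) * x).
  by rewrite -expRD; congr expR; lra.
have h1 : 1 + (k - 1) * x <= expR ((k - 1) * x) by exact: expR_ge1Dx.
have h2 : 1 - x <= expR (- x) by exact: expR_ge1Dx.
have e0 : 0 < expR x by exact: expR_gt0.
have h3 : expR x - 1 <= x * expR x.
  have : expR x * (1 - x) <= expR x * expR (- x) by rewrite ler_wpM2l// ltW.
  by rewrite -expRD subrr expR0; lra.
have : expR x * (1 + (k - 1) * x) <= expR x * expR ((k - 1) * x).
  by rewrite ler_wpM2l// ltW.
apply: le_trans.
have : (k - 1) * (expR x - 1) <= (k - 1) * (x * expR x).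
  by rewrite ler_wpM2l// subr_ge0.
lra.
Qed.

(** Subtracting (1 - 1/k) e^(-c) times the mass N, a fraction 1 - 1/k of the
    least possible density, multiplies the log-Lipschitz constant c by k at most.
    Here s and t are the measures of two sets, and a and b their reference
    measures.  At least 1/k of t remains, so the relative error e^(c D) - 1 grows
    by the factor k, and e^(k c D) - 1 is at least k times as large. *)
Lemma residual_ineq k c s t a b N D : 1 <= k -> 0 <= c * D -> 0 <= t -> 0 <= a ->
  s * b <= expR (c * D) * (t * a) -> N * b <= expR c * t ->
  (s - (1 - k^-1) / expR c * N * a) * b <=
    expR (k * c * D) * ((t - (1 - k^-1) / expR c * N * b) * a).
Proof.
move=> k1 cD0 t0 a0 sb Nb.
have k0 : 0 < k by lra.
have q0 : 0 <= 1 - k^-1 by rewrite subr_ge0 invf_le1.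
have e0 : 0 < expR c by exact: expR_gt0.
set z := (1 - k^-1) / expR c * N * b.
have zt : z <= (1 - k^-1) * t.
  rewrite /z -!mulrA; apply: ler_wpM2l => //.
  by rewrite ler_pdivrMl.
set u := expR (c * D) in sb *.
have bern : 1 + k * (u - 1) <= expR (k * c * D).
  by rewrite -mulrA; exact: expR_bernoulli.
set w := expR _ in bern *.
have ub : u - 1 <= k^-1 * (w - 1) by rewrite ler_pdivlMl//; lra.
apply: (@le_trans _ _ ((u * t - z) * a)).
  have -> : (s - (1 - k^-1) / expR c * N * a) * b = s * b - z * a.
    by rewrite /z; ring.
  by rewrite mulrBl lerB// -mulrA.
rewrite mulrA; apply: ler_wpM2r => //.
have w1 : 0 <= w - 1.
  rewrite subr_ge0 /w -expR0 ler_expR -mulrA mulr_ge0//.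
  by apply: le_trans k1.
have h1 := ler_wpM2l w1 zt.
have h2 : 0 <= t * (k^-1 * (w - 1) - (u - 1)) by rewrite mulr_ge0// subr_ge0.
lra.
Qed.

(** Two comparisons are chained through the pair a', b'; the last hypothesis
    covers the case where this pair vanishes. *)
Lemma ratio_trans s t a b a' b' u v : 0 <= t -> 0 <= a -> 0 <= a' -> 0 <= b ->
  0 <= b' -> 0 <= u -> 0 <= v ->
  s * b' <= u * (t * a') -> a' * b <= v * (b' * a) -> (a' = 0 -> s = 0) ->
  s * b <= u * v * (t * a).
Proof.
move=> t0 a0 a'0 b0 b'0 u0 v0 h1 h2 h3.
have [b'z|b'nz] := eqVneq b' 0.
  have : a' * b <= 0 by apply: le_trans h2 _; rewrite b'z mul0r mulr0.
  have : 0 <= a' * b by rewrite mulr_ge0.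
  move=> p q; have /eqP : a' * b = 0 by apply/eqP; rewrite eq_le p q.
  by rewrite mulf_eq0 => /orP[/eqP/h3 ->|/eqP ->];
    rewrite ?mul0r ?mulr0 !mulr_ge0.
have b'p : 0 < b' by rewrite lt0r b'nz.
rewrite -(ler_pM2r b'p).
apply: (@le_trans _ _ (u * (t * a') * b)).
  by rewrite mulrAC ler_wpM2r.
rewrite (_ : u * (t * a') * b = u * t * (a' * b)); last ring.
rewrite (_ : u * v * (t * a) * b' = u * t * (v * (b' * a))); last ring.
by rewrite ler_wpM2l// mulr_ge0.
Qed.

End RealInequalities.

Section LogRegular.
Context {R : realType} {M : pmetricType R}.
Variables (mu : probability (borel M) R) (Y : set (borel M)).
Implicit Types (s : set (borel M) -> \bar R) (A B : set (borel M)) (c D : R).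
Local Notation dist := (@mdist R M).
Local Open Scope ereal_scope.

(** The density of s with respect to mu is log-Lipschitz with constant c on Y,
    said without densities, as a condition linear in s: it passes to sums and
    integrals of measures. *)
Definition log_regular c s := forall A B D, measurable A -> measurable B ->
  A `<=` Y -> B `<=` Y -> (0 <= D)%R ->
  (forall x y, A x -> B y -> (dist x y <= D)%R) ->
  s A * mu B <= (expR (c * D))%:E * (s B * mu A).

(** The pointwise comparison is integrated in x with y frozen, then in y. *)
Lemma integral_ratio d (T : measurableType d) (nu : {measure set T -> \bar R})
    (A B : set T) (phi : T -> R) (c : R) :
  measurable A -> measurable B ->
  measurable_fun (A `|` B) phi -> (forall x, A x \/ B x -> (0 < phi x)%R) ->
  (0 <= c)%R -> (forall x y, A x -> B y -> (phi x <= c * phi y)%R) ->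
  (\int[nu]_(x in A) (phi x)%:E) * nu B <=
    c%:E * ((\int[nu]_(x in B) (phi x)%:E) * nu A).
Proof.
move=> mA mB mphi phi0 c0 phic.
have mphiA : measurable_fun A (EFin \o phi).
  apply/measurable_EFinP; apply: measurable_funS mphi; first exact: measurableU.
  by move=> x; left.
have mphiB : measurable_fun B (EFin \o phi).
  apply/measurable_EFinP; apply: measurable_funS mphi; first exact: measurableU.
  by move=> x; right.
have h y : B y -> \int[nu]_(x in A) (phi x)%:E <= c%:E * nu A * (phi y)%:E.
  move=> By; have py0 : (0 < phi y)%R by apply: phi0; right.
  apply: (@le_trans _ _ (\int[nu]_(x in A) (c * phi y)%:E)).
    apply: ge0_le_integral => //.
    - by move=> x Ax; rewrite lee_fin ltW// phi0//; left.
    - by move=> x Ax; rewrite lee_fin phic.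
  by rewrite integral_cst// EFinM muleAC.
rewrite -integral_cst//.
rewrite [X in _ <= _ * X]muleC muleA -ge0_integralZl//; last first.
- by rewrite mule_ge0.
- by move=> x Bx; rewrite lee_fin ltW// phi0//; right.
apply: ge0_le_integral => //.
- move=> x Bx; apply: integral_ge0 => z Az.
  by rewrite lee_fin ltW// phi0//; left.
- apply: emeasurable_funM => //; exact: measurable_cst.
Qed.

Lemma regular_measure_log_regular (R' : R) (rho : set (borel M) -> \bar R) :
  (0 <= R')%R -> measurable Y -> regular_measure Y mu R' rho -> log_regular R' rho.
Proof.
move=> R0 mY [_ [phi [mphi phi0 phiL rhoE]]] A B D mA mB AY BY D0 AB.
rewrite !rhoE// (setIidl AY) (setIidl BY).
apply: integral_ratio => //.
- apply: measurable_funS mphi => //; by rewrite subUset.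
- by move=> x [/AY|/BY]; exact: phi0.
move=> x y Ax By.
have px := phi0 _ (AY _ Ax); have py := phi0 _ (BY _ By).
have [<-|xy] := pselect (x = y).
  rewrite ler_peMl ?(ltW px)//; apply: le_trans (expR_ge1Dx _).
  by rewrite lerDl mulr_ge0.
rewrite -ler_ln ?posrE ?mulr_gt0 ?expR_gt0// lnM ?posrE ?expR_gt0// expRK.
rewrite -lerBlDr; apply: le_trans (ler_norm _) _.
have dxy0 : (0 < dist x y)%R by rewrite mdist_gt0; apply/eqP.
have : (`|ln (phi x) - ln (phi y)| / dist x y <= R')%R.
  rewrite -lee_fin; apply: le_trans phiL; apply: ereal_sup_ubound.
  by exists x, y; split => //; [exact: AY|exact: BY].
rewrite ler_pdivrMr// => /le_trans; apply.
by apply: ler_wpM2l => //; exact: AB.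
Qed.

End LogRegular.

(** * The induced map in terms of its invariant measure *)

Section InverseBranches.
Context {R : realType} {M : pmetricType R}.
Local Notation dist := (@mdist R M).
Local Open Scope ereal_scope.

(** A full branch carries the restriction of mu to a onto a measure on Y whose
    density with respect to mu is the inverse Jacobian along the branch, and
    bounded distortion says that this density is log-Lipschitz. *)
Lemma jacobian_branch (m mu : probability (borel M) R) (Y a : set (borel M))
    (F : borel M -> borel M) (zeta : borel M -> R) (K : R) :
  measurable a ->
  (forall C, measurable C -> measurable (a `&` F @^-1` C)) -> mu `<< m ->
  measure_bijection m F a Y -> inverse_jacobian mu F a zeta ->
  (0 <= K)%R ->
  (forall x y, a x -> a y ->
     (`|ln (zeta x) - ln (zeta y)| <= K * dist (F x) (F y))%R) ->
  forall A B D, measurable A -> measurable B -> A `<=` Y -> B `<=` Y ->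
  (forall x y, A x -> B y -> (dist x y <= D)%R) ->
  mu (a `&` F @^-1` A) * mu B <=
    (expR (K * D))%:E * (mu (a `&` F @^-1` B) * mu A).
Proof.
move=> ma mpre dom [N [N' [_ [mN' N'Y mN'0] [_ _ surj] _ _]]].
move=> [mzeta zeta0 [nuf [nufE muE]]] K0 zetaL A B D mA mB AY BY AB.
(* The null set N' missed by the branch is invisible to mu as well. *)
have nuf_pre C : measurable C -> C `<=` Y -> nuf (a `&` F @^-1` C) = mu C.
  move=> mC CY; rewrite nufE//; [|exact: mpre].
  apply/eqP; rewrite eq_le; apply/andP; split.
    rewrite -[leRHS]measurable_mu_extE//; apply: le_mu_ext => _ [x [_ Cx] <-].
    exact: Cx.
  have muN' : mu N' = 0.
    by move/null_content_dominatesP : dom => /(_ _ mN' mN'0).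
  have mCN : measurable (C `\` N') by exact: measurableD.
  have -> : mu C = mu (C `\` N').
    rewrite -[in LHS](setDUK (_ : C `&` N' `<=` C)); last by move=> ? [].
    rewrite setUC measureU0 ?setDIr ?setDv ?setU0//.
    - by rewrite set0U.
    - apply: measurableU => //; rewrite setDv set0U.
    - exact: measurableI.
    apply: (subset_measure0 _ mN' _ muN'); first exact: measurableI.
    by move=> ? [].
  rewrite -[leLHS]measurable_mu_extE//; apply: le_mu_ext => y [Cy N'y].
  have [|x [ax _] Fx] := surj y; first by split => //; exact: CY.
  by exists x => //; split => //=; rewrite Fx.
rewrite -(nuf_pre B)// -(nuf_pre A)// muE; [|exact: mpre|by move=> ? []].
rewrite [mu (a `&` F @^-1` B)]muE; [|exact: mpre|by move=> ? []].
apply: integral_ratio; [exact: mpre|exact: mpre| | | |].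
- apply: measurable_funS mzeta => // x [[]|[]]//.
- by move=> x [[ax _]|[ax _]]; exact: zeta0.
- exact: expR_ge0.
move=> x y [ax Ax] [ay By].
have zx := zeta0 _ ax; have zy := zeta0 _ ay.
rewrite -ler_ln ?posrE ?mulr_gt0 ?expR_gt0// lnM ?posrE ?expR_gt0// expRK.
rewrite -lerBlDr; apply: le_trans (ler_norm _) _.
apply: le_trans (zetaL _ _ ax ay) _.
by apply: ler_wpM2l => //; exact: AB.
Qed.

(** The part of the hypotheses that the regeneration argument uses, with the
    reference measure eliminated.  The branches are a sequence, possibly with
    empty terms; gm_branch says that each of them carries mu to a measure with
    log-Lipschitz density. *)
Record gibbs_markov (T : borel M -> borel M) (mu : probability (borel M) R)
    (Y : set (borel M)) (a : nat -> set (borel M)) (tau : borel M -> nat)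
    (lambda K : R) : Prop := {
  gm_T : measurable_fun setT T ;
  gm_Y : measurable Y ;
  gm_muY : mu Y = 1 ;
  gm_diam : forall x y, Y x -> Y y -> (dist x y <= 1)%R ;
  gm_tau : measurable_fun setT tau ;
  gm_a : forall i, measurable (a i) ;
  gm_aY : forall i, a i `<=` Y ;
  gm_triv : trivIset setT a ;
  gm_cover : mu (Y `\` \bigcup_i a i) = 0 ;
  gm_const : forall i x y, a i x -> a i y -> tau x = tau y ;
  gm_return : forall i x, a i x -> Y (Defs.induced T tau x) ;
  gm_lambda : (1 < lambda)%R ;
  gm_K : (0 < K)%R ;
  gm_expand : forall i x y, a i x -> a i y ->
    (lambda * dist x y <= dist (Defs.induced T tau x) (Defs.induced T tau y))%R ;
  gm_branch : forall i A B D, measurable A -> measurable B ->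
    A `<=` Y -> B `<=` Y -> (forall x y, A x -> B y -> (dist x y <= D)%R) ->
    mu (a i `&` Defs.induced T tau @^-1` A) * mu B <=
      (expR (K * D))%:E * (mu (a i `&` Defs.induced T tau @^-1` B) * mu A)
}.

Lemma measurable_iter_pair (T : borel M -> borel M) : measurable_fun setT T ->
  measurable_fun setT (fun w : borel M * nat => iter w.2 T w.1).
Proof.
move=> mT _ B mB; rewrite setTI.
have mTk k : measurable_fun setT (iter k T).
  elim: k => [|k IH]; first exact: measurable_id.
  exact: (measurableT_comp mT IH).
rewrite (_ : _ @^-1` _ = \bigcup_k ((iter k T @^-1` B) `*` [set k])).
  apply: bigcupT_measurable => k; apply: measurableX => //.
  by rewrite -[X in measurable X]setTI; exact: mTk.
apply/seteqP; split => [[x k] /= Bx|[x k] [j _ [/= Bx ->]]]//.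
by exists k.
Qed.

Lemma measurable_induced (T : borel M -> borel M) (tau : borel M -> nat) :
  measurable_fun setT T -> measurable_fun setT tau ->
  measurable_fun setT (Defs.induced T tau).
Proof.
move=> mT mtau.
apply: (measurableT_comp (measurable_iter_pair mT) (g := fun y => (y, tau y))).
exact: measurable_fun_pair.
Qed.

Lemma countable_seq_disjoint (alpha : set (set (borel M))) :
  countable alpha -> trivIset alpha id ->
  exists a : nat -> set (borel M), [/\ forall i, a i = set0 \/ alpha (a i),
    trivIset setT a & \bigcup_i a i = \bigcup_(b in alpha) b].
Proof.
move=> /countable_injP[f finj] triv.
pose a i := [set x | exists b, [/\ alpha b, f b = i & b x]].
have aE i b : alpha b -> f b = i -> a i = b.
  move=> ab fb; apply/seteqP; split => x.
    move=> [b' [ab' fb' b'x]]; have <- // : b' = b.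
    by apply: finj; rewrite ?inE// fb fb'.
  by move=> bx; exists b.
exists a; split.
- move=> i; have [[b [ab fb]]|nb] := pselect (exists b, alpha b /\ f b = i).
    by right; rewrite (aE i b).
  left; apply/seteqP; split => // x [b [ab fb _]]; exfalso; apply: nb.
  by exists b.
- move=> i j _ _ [x [[b [ab <- bx]] [b' [ab' <- b'x]]]].
  by congr f; apply: triv => //; exists x.
- apply/seteqP; split => x [i].
    by move=> _ [b [ab _ bx]]; exists b.
  by move=> ab ix; exists (f i) => //; exists i.
Qed.

Lemma gibbs_markov_of_nue (m : probability (borel M) R)
    (T : borel M -> borel M) (Y : set (borel M)) (alpha : set (set (borel M)))
    (tau : borel M -> nat) (lambda Khat : R) (mu : probability (borel M) R)
    (K : R) :
  nonuniformly_expanding m T Y alpha tau lambda Khat ->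
  induced_acip m T Y alpha tau mu K ->
  exists a, gibbs_markov T mu Y a (fun y => if y \in Y then tau y else 0%N)
    lambda K.
Proof.
move=> H H'.
(* Off Y the return time is set to 0, to be measurable on the whole space. *)
set tau0 := (fun y : borel M => if y \in Y then tau y else 0%N).
have tauE y : Y y -> tau0 y = tau y by rewrite /tau0; case: ifPn => // /negP + Yy; rewrite inE.
have mY := nue_Y_measurable H.
have [a [a0 atriv aU]] := countable_seq_disjoint (nue_alpha_countable H)
  (nue_alpha_trivIset H).
have aY i : a i `<=` Y.
  by case: (a0 i) => [->//|/(nue_alpha_sub H)[]].
have ma i : measurable (a i).
  by case: (a0 i) => [->//|/(nue_alpha_sub H)[]].
have mtau0 : measurable_fun setT tau0.
  apply: (measurable_fun_if (D := setT)) => //.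
  - apply: (measurable_fun_bool true).
    rewrite setTI (_ : _ @^-1` _ = Y)//; apply/seteqP.
    by split => x /=; [exact: set_mem|exact: mem_set].
  - rewrite setTI (_ : _ @^-1` _ = Y); first exact: nue_tau_measurable H.
    by apply/seteqP; split => x /=; [exact: set_mem|exact: mem_set].
have mT := nue_T_measurable H.
have FE i x : a i x -> Defs.induced T tau0 x = Defs.induced T tau x.
  by move=> /aY Yx; rewrite /Defs.induced tauE.
have dom := acip_dominated H'.
(* A density at most K <= 0 would give mu no mass. *)
have K0 : (0 < K)%R.
  have [h [mh hK muE]] := acip_density H'.
  rewrite ltNge; apply/negP => K0.
  have : mu Y <= 0.
    rewrite muE// setIid.
    rewrite (eq_integral (fun y => - (- h y)%:E)) => [|y _]; last first.
      by rewrite EFinN oppeK.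
    rewrite integral_ge0N => [|y /hK/andP[_ hy]]; last first.
      by rewrite lee_fin oppr_ge0 (le_trans hy).
    rewrite leeNl oppe0; apply: integral_ge0 => y /hK/andP[_ hy].
    by rewrite lee_fin oppr_ge0 (le_trans hy).
  by rewrite (acip_supp H') lee_fin ler10.
exists a; split => //.
- exact: acip_supp H'.
- exact: nue_diam H.
- move/null_content_dominatesP : dom; apply.
    by apply: measurableD => //; exact: bigcupT_measurable.
  rewrite aU; exact: nue_alpha_cover H.
- move=> i x y aix aiy; rewrite !tauE//; [|exact: (aY i)..].
  by case: (a0 i) => ai; [move: aix; rewrite ai|exact: (nue_tau_const H ai)].
- move=> i x aix; rewrite (FE i)//.
  by case: (a0 i) => ai; [move: aix; rewrite ai|exact: (nue_return H ai)].
- exact: nue_lambda_gt1 H.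
- move=> i x y aix aiy; rewrite !(FE i)//.
  by case: (a0 i) => ai; [move: aix; rewrite ai|exact: (nue_expanding H ai)].
move=> i A B D mA mB AY BY AB.
case: (a0 i) => [->|ai]; first by rewrite !set0I measure0 !mul0e mule0.
have [zeta /(_ _ ai)[zJ zL]] := acip_distortion H'.
have preE C : a i `&` Defs.induced T tau0 @^-1` C =
    a i `&` Defs.induced T tau @^-1` C.
  by apply/seteqP; split => x [aix /=]; rewrite (FE i).
rewrite !preE; apply: (@jacobian_branch m mu Y (a i) _ zeta K) => //.
- move=> C mC; rewrite -preE; apply: measurableI => //.
  by rewrite -[X in measurable X]setTI; exact: measurable_induced.
- exact: nue_bijection H _ ai.
- exact: ltW.
Qed.

End InverseBranches.

(** * Splitting a measure along a map *)

Section SplittingAlongAMap.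
Context {R : realType} d (W : measurableType d) d' (X : measurableType d').
Local Open Scope ereal_scope.

(** A submeasure nu of the image of Q under G lifts to a submeasure of Q: take
    the density of nu, composed with G. *)
Lemma lift_submeasure (Q : {finite_measure set W -> \bar R}) (G : W -> X)
    (nu : {finite_measure set X -> \bar R}) :
  measurable_fun setT G ->
  (forall B, measurable B -> nu B <= Q (G @^-1` B)) ->
  exists S L : {finite_measure set W -> \bar R},
    (forall A, measurable A -> S A + L A = Q A) /\
    (forall B, measurable B -> S (G @^-1` B) = nu B).
Proof.
move=> mG nuQ; have [q qE] := exists_finite_pushforward Q mG.
have [|g [mg g01 nuE]] := @density_le1 _ _ _ q nu.
  by move=> B mB; rewrite qE; exact: nuQ.
pose g1 w := (g (G w))%:E; pose g2 w := (1 - g (G w))%:E.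
have mgG : measurable_fun setT (g \o G) by exact: measurableT_comp.
have mg1 : measurable_fun setT g1 by exact/measurable_EFinP.
have mg2 : measurable_fun setT g2.
  by apply/measurable_EFinP; exact: measurable_funB.
have g10 w : 0 <= g1 w by rewrite lee_fin; have /andP[] := g01 (G w).
have g20 w : 0 <= g2 w by rewrite lee_fin subr_ge0; have /andP[] := g01 (G w).
have [S0 S0E] := exists_density_measure Q mg1 g10.
have [L0 L0E] := exists_density_measure Q mg2 g20.
have SL A : measurable A -> S0 A + L0 A = Q A.
  move=> mA; rewrite S0E L0E -ge0_integralD//; last 2 first.
  - exact: measurable_funTS.
  - exact: measurable_funTS.
  rewrite -[RHS]mul1e -integral_cst//; apply: eq_integral => w _.
  by rewrite /g1 /g2 -EFinD addrC subrK.
have Qlt := finite_measureT_lty Q.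
have [|S SE] := @exists_finite_measure _ _ _ S0.
  by apply: le_lt_trans Qlt; rewrite -SL// leeDl.
have [|L LE] := @exists_finite_measure _ _ _ L0.
  by apply: le_lt_trans Qlt; rewrite -SL// leeDr.
exists S, L; split=> [A mA|B mB]; first by rewrite SE LE; exact: SL.
rewrite SE S0E nuE// qE ge0_integral_pushforward//.
- by apply/measurable_EFinP; exact: measurable_funTS.
- by move=> x _; rewrite lee_fin; have /andP[] := g01 x.
Qed.

Lemma measure_levels (m : {measure set (W * nat)%type -> \bar R}) D :
  measurable D -> m D = \sum_(k <oo) m (ysection D k `*` [set k]).
Proof.
move=> mD; rewrite -measure_semi_bigcup//.
- congr (m _); apply/seteqP; split => [[x k] Dxk|[x k] [j _ [/= + ->]]].
    by exists k => //; split => //=; rewrite /ysection/= inE.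
  by rewrite /ysection/= inE.
- by move=> k; apply: measurableX => //; exact: measurable_ysection.
- move=> i j _ _ [[x k] [[_ /= ki] [_ /= kj]]].
  by rewrite -ki -kj.
- apply: bigcupT_measurable => k; apply: measurableX => //.
  exact: measurable_ysection.
Qed.

Lemma le_measure_levels (m1 m2 : {measure set (W * nat)%type -> \bar R}) :
  (forall A k, measurable A -> m1 (A `*` [set k]) <= m2 (A `*` [set k])) ->
  forall D, measurable D -> m1 D <= m2 D.
Proof.
move=> m12 D mD; rewrite (measure_levels m1)// (measure_levels m2)//.
by apply: lee_nneseries => // k _; apply: m12; exact: measurable_ysection.
Qed.

End SplittingAlongAMap.

(** * One regeneration *)

Section StopRate.
Context {R : realType} (lambda K R' : R).
Hypothesis l1 : (1 < lambda)%R.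
Hypothesis K0 : (0 < K)%R.
Hypothesis KR' : (K * lambda / (lambda - 1) < R')%R.

(** Stopping may worsen the constant R' by this factor: the next return divides
    the result by lambda and adds K, and the factor is the one for which this
    gives R' back (distortion_growth_lambda). *)
Definition distortion_growth : R := (lambda * (R' - K) / R')%R.

(** The fraction of the mass that can be stopped at that price. *)
Definition stop_rate : R := ((1 - distortion_growth^-1) / expR R')%R.

Lemma R'_gt0 : (0 < R')%R.
Proof.
apply: le_lt_trans KR'; rewrite divr_ge0//.
  by rewrite mulr_ge0 ?ltW// (lt_trans _ l1).
by rewrite subr_ge0 ltW.
Qed.

Lemma distortion_growth_gt1 : (1 < distortion_growth)%R.
Proof.
rewrite /distortion_growth ltr_pdivlMr ?R'_gt0// mul1r.
have : (K * lambda < R' * (lambda - 1))%R.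
  by rewrite -ltr_pdivrMr// subr_gt0.
lra.
Qed.

Lemma distortion_growth_lambda : (K + distortion_growth * R' / lambda = R')%R.
Proof.
rewrite /distortion_growth; have r0 := lt0r_neq0 R'_gt0.
have l0 : (lambda != 0)%R by rewrite lt0r_neq0// (lt_trans _ l1).
by rewrite divfK// [(lambda * _)%R]mulrC mulfK// addrC subrK.
Qed.

Lemma stop_rate_gt0 : (0 < stop_rate)%R.
Proof.
by rewrite /stop_rate divr_gt0 ?expR_gt0// subr_gt0 invf_lt1 ?distortion_growth_gt1//
  (lt_trans _ distortion_growth_gt1).
Qed.

Lemma stop_rate_exp : (stop_rate * expR R' <= 1)%R.
Proof.
rewrite /stop_rate divfK ?gt_eqF ?expR_gt0// lerBlDr lerDl invr_ge0 ltW//.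
by rewrite (lt_trans _ distortion_growth_gt1).
Qed.

Lemma stop_rate_lt1 : (stop_rate < 1)%R.
Proof.
apply: lt_le_trans stop_rate_exp; rewrite ltr_pMr ?stop_rate_gt0//.
by rewrite expR_gt1 R'_gt0.
Qed.

End StopRate.

Section RegenerationStep.
Context {R : realType} {M : pmetricType R}.
Local Notation dist := (@mdist R M).
Local Notation W := (borel M * nat)%type.
Local Open Scope ereal_scope.

Variables (T : borel M -> borel M) (mu : probability (borel M) R)
  (Y : set (borel M)) (a : nat -> set (borel M)) (tau : borel M -> nat)
  (lambda K R' : R).
Hypothesis gm : gibbs_markov T mu Y a tau lambda K.
Hypothesis KR' : (K * lambda / (lambda - 1) < R')%R.

Let l1 := gm_lambda gm.
Let K0 := gm_K gm.
Let mY := gm_Y gm.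

Let muYC : mu (~` Y) = 0.
Proof. by rewrite probability_setC// (gm_muY gm) subee. Qed.

Local Notation distortion_growth := (distortion_growth lambda K R').
Local Notation stop_rate := (stop_rate lambda K R').

Let R'_gt0 := R'_gt0 l1 K0 KR'.
Let distortion_growth_gt1 := distortion_growth_gt1 l1 K0 KR'.
Let distortion_growth_lambda := distortion_growth_lambda l1 K0 KR'.
Let stop_rate_gt0 := stop_rate_gt0 l1 K0 KR'.
Let stop_rate_exp := stop_rate_exp l1 K0 KR'.
Let stop_rate_lt1 := stop_rate_lt1 l1 K0 KR'.

(** A point is to be stopped when its position at the recorded time is distributed
    by mu, so measures on W are examined through this map. *)
Definition hit (w : W) : W := (iter w.2 T w.1, w.2).

(** The recorded time is moved on by one return; renew does the same for a pair
    that holds the current position instead of the starting point. *)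
Definition advance (w : W) : W := (w.1, (w.2 + tau (iter w.2 T w.1))%N).

Definition renew (w : W) : W := (Defs.induced T tau w.1, (w.2 + tau w.1)%N).

Lemma hit_advance w : hit (advance w) = renew (hit w).
Proof.
by rewrite /hit /advance /renew /Defs.induced/= addnC iterD.
Qed.

Lemma measurable_hit : measurable_fun setT hit.
Proof.
apply: measurable_fun_pair; last exact: measurable_snd.
exact: measurable_iter_pair (gm_T gm).
Qed.

Lemma measurable_advance : measurable_fun setT advance.
Proof.
apply: measurable_fun_pair; first exact: measurable_fst.
apply: measurable_fun_addn; first exact: measurable_snd.
exact: (measurableT_comp (gm_tau gm) (measurable_iter_pair (gm_T gm))).
Qed.

Lemma measurable_renew : measurable_fun setT renew.
Proof.
apply: measurable_fun_pair.
  apply: (measurableT_comp (measurable_induced (gm_T gm) (gm_tau gm))).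
  exact: measurable_fst.
apply: measurable_fun_addn; first exact: measurable_snd.
exact: (measurableT_comp (gm_tau gm) measurable_fst).
Qed.

(** A measure on pairs (starting point, time) all of whose mass is, at the
    recorded time, distributed on Y with regular density. *)
Definition regular_levels (Q : set W -> \bar R) :=
  (forall k, log_regular mu Y R' (fun A => Q (hit @^-1` (A `*` [set k])))) /\
  Q (hit @^-1` (~` Y `*` setT)) = 0.

Section OneStep.
Variables (Q q : {finite_measure set W -> \bar R})
  (c : {finite_measure set nat -> \bar R}).
Hypothesis qE : q = pushforward Q hit :> (set W -> \bar R).
Hypothesis cE : c = pushforward Q snd :> (set nat -> \bar R).
Hypothesis Qreg : regular_levels Q.

Let qreg k : log_regular mu Y R' (fun A => q (A `*` [set k])).
Proof. by rewrite qE; exact: Qreg.1. Qed.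

Let qY : q (~` Y `*` setT) = 0.
Proof. by rewrite qE; exact: Qreg.2. Qed.

Let mX A k : measurable A -> measurable (A `*` [set k] : set W).
Proof. by move=> mA; exact: measurableX. Qed.

Let q_setT k : q (setT `*` [set k]) = c [set k].
Proof.
by rewrite qE cE /pushforward; congr (Q _); apply/seteqP; split => w //= [].
Qed.

Let qIY A k : measurable A -> q ((A `&` Y) `*` [set k]) = q (A `*` [set k]).
Proof.
move=> mA; apply/esym.
have mAY : measurable (A `&` Y) by exact: measurableI.
have mAnY : measurable (A `\` Y) by exact: measurableD.
have -> : A `*` [set k] = ((A `&` Y) `*` [set k]) `|` ((A `\` Y) `*` [set k]).
  apply/seteqP; split => -[x j] /=; have := pselect (Y x); tauto.
rewrite measureU0//; [exact: mX|exact: mX|].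
apply: (subset_measure0 _ _ _ qY); first exact: mX.
  by apply: measurableX => //; exact: measurableC.
by move=> [x j] [[]].
Qed.

Let q_Y k : q (Y `*` [set k]) = c [set k].
Proof. by rewrite -q_setT -[RHS]qIY// setTI. Qed.

Let muIY A : measurable A -> mu (A `&` Y) = mu A.
Proof.
move=> mA; apply/esym; rewrite -[in LHS](setUIDK A Y) measureU0//.
- exact: measurableI.
- exact: measurableD.
- apply: (subset_measure0 _ (measurableC mY) _ muYC); first exact: measurableD.
  by move=> x [].
Qed.

(** Y has diameter at most 1, so the density at each recorded time is at most
    e^R' times the mass of that time. *)
Lemma levels_le D : measurable D -> q D <= (expR R')%:E * (mu \x c) D.
Proof.
have e0 : (0 <= expR R')%R by exact: expR_ge0.
rewrite -[(expR R')%:E * _]/(mscale (NngNum e0) (mu \x c) D).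
apply: le_measure_levels => A k mA.
change (q (A `*` [set k]) <= (expR R')%:E * (mu \x c) (A `*` [set k])).
rewrite product_measure1E//= -qIY// -muIY//.
have := qreg k (measurableI _ _ mA mY) mY (@subIsetr _ _ _) (@subset_refl _ _)
  ler01 (fun x y Ax Yy => gm_diam gm Ax.2 Yy).
rewrite (gm_muY gm) mule1 mulr1 => /le_trans; apply.
by rewrite lee_pmul2l ?lte_fin ?expR_gt0// muleC q_Y.
Qed.

(** Likewise this density is at least e^(-R') times the mass, and stop_rate is at
    most e^(-R'). *)
Lemma levels_ge D : measurable D -> stop_rate%:E * (mu \x c) D <= q D.
Proof.
have e0 : (0 <= stop_rate)%R by rewrite ltW// stop_rate_gt0.
rewrite -[stop_rate%:E * _]/(mscale (NngNum e0) (mu \x c) D).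
apply: le_measure_levels => A k mA.
change (stop_rate%:E * (mu \x c) (A `*` [set k]) <= q (A `*` [set k])).
rewrite product_measure1E//= -qIY// -muIY//.
have := qreg k mY (measurableI _ _ mA mY) (@subset_refl _ _) (@subIsetr _ _ _)
  ler01 (fun x y Yx Ay => gm_diam gm Yx Ay.2).
rewrite (gm_muY gm) mule1 mulr1 q_Y => h.
apply: (@le_trans _ _ (stop_rate%:E * ((expR R')%:E * q ((A `&` Y) `*` [set k])))).
  by rewrite lee_pmul2l ?lte_fin ?stop_rate_gt0// muleC.
by rewrite muleA -EFinM gee_pMl// ?fin_num_measure ?lee_fin ?stop_rate_exp.
Qed.

Variables (L qL : {finite_measure set W -> \bar R}).
Hypothesis qLE : qL = pushforward L hit :> (set W -> \bar R).
Hypothesis qL_q : forall D, measurable D ->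
  qL D + stop_rate%:E * (mu \x c) D = q D.

Let q_fin D : measurable D -> q D \is a fin_num.
Proof. exact: fin_num_measure. Qed.

Let qL_fin D : measurable D -> qL D \is a fin_num.
Proof. exact: fin_num_measure. Qed.

Let c_fin k : c [set k] \is a fin_num.
Proof. exact: fin_num_measure. Qed.

Let mu_fin A : measurable A -> mu A \is a fin_num.
Proof. exact: fin_num_measure. Qed.

Lemma residual_le D : measurable D -> qL D <= q D.
Proof.
move=> mD; rewrite -qL_q// leeDl//.
by rewrite mule_ge0// lee_fin (ltW stop_rate_gt0).
Qed.

Let residualE A k : measurable A ->
  fine (qL (A `*` [set k])) =
    (fine (q (A `*` [set k])) - stop_rate * fine (c [set k]) * fine (mu A))%R.
Proof.
move=> mA; have mAk := mX k mA; apply: EFin_inj.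
rewrite EFinB !EFinM !fineK ?mu_fin ?q_fin ?qL_fin// -qL_q//.
have -> : (mu \x c) (A `*` [set k]) = c [set k] * mu A.
  by rewrite product_measure1E//= muleC.
by rewrite muleA addeK// fin_numM ?mu_fin// fin_numM ?c_fin.
Qed.

(** What is left after stopping satisfies the Lipschitz condition with the larger
    constant, by residual_ineq. *)
Lemma residual_log_regular k :
  log_regular mu Y (distortion_growth * R') (fun A => qL (A `*` [set k])).
Proof.
move=> A B D mA mB AY BY D0 AB.
rewrite -(fineK (qL_fin (mX k mA))) -(fineK (qL_fin (mX k mB))).
rewrite -(fineK (mu_fin mA)) -(fineK (mu_fin mB)) -!EFinM lee_fin.
rewrite !residualE//; apply: residual_ineq.
- by rewrite ltW// distortion_growth_gt1.
- by rewrite mulr_ge0// ltW// R'_gt0.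
- exact: fine_ge0.
- exact: fine_ge0.
- have := qreg k mA mB AY BY D0 AB.
  rewrite -(fineK (q_fin (mX k mA))) -(fineK (q_fin (mX k mB))).
  by rewrite -(fineK (mu_fin mA)) -(fineK (mu_fin mB)) -!EFinM lee_fin.
have := qreg k mY mB (@subset_refl _ _) BY ler01
  (fun x y Yx By => gm_diam gm Yx (BY _ By)).
rewrite (gm_muY gm) mule1 mulr1 q_Y -(fineK (q_fin (mX k mB))).
by rewrite -(fineK (mu_fin mB)) -(fineK (c_fin k)) -!EFinM lee_fin.
Qed.

Let F := Defs.induced T tau.

Let mF : measurable_fun setT F.
Proof. exact: measurable_induced (gm_T gm) (gm_tau gm). Qed.

Let mpre i A : measurable A -> measurable (a i `&` F @^-1` A).
Proof.
move=> mA; apply: measurableI; first exact: (gm_a gm).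
by rewrite -[X in measurable X]setTI; exact: mF.
Qed.

(** A branch contracts distances by lambda backwards and adds its distortion,
    which brings the constant back to R'. *)
Lemma branch_log_regular i k :
  log_regular mu Y R' (fun A => qL ((a i `&` F @^-1` A) `*` [set k])).
Proof.
move=> A B D mA mB AY BY D0 AB.
have l0 : (0 < lambda)%R by exact: lt_trans l1.
have := @residual_log_regular k _ _ (D / lambda)%R (mpre i mA) (mpre i mB).
have piY C : a i `&` F @^-1` C `<=` Y by move=> x [/(gm_aY gm)].
move=> /(_ (piY A) (piY B)); rewrite divr_ge0 ?(ltW l0)// => /(_ isT).
have dAB x y : (a i `&` F @^-1` A) x -> (a i `&` F @^-1` B) y ->
    (dist x y <= D / lambda)%R.
  move=> [ax Ax] [ay By]; rewrite ler_pdivlMr// mulrC.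
  exact: le_trans (gm_expand gm ax ay) (AB _ _ Ax By).
move=> /(_ dAB) h1.
have h2 := @gm_branch _ _ _ _ _ _ _ _ _ gm i A B D mA mB AY BY AB.
have h3 : mu (a i `&` F @^-1` A) = 0 ->
    qL ((a i `&` F @^-1` A) `*` [set k]) = 0.
  move=> mu0; apply/eqP; rewrite eq_le measure_ge0 andbT.
  apply: le_trans (residual_le (mX k (mpre i mA))) _.
  apply: le_trans (levels_le (mX k (mpre i mA))) _.
  have -> : (mu \x c) ((a i `&` F @^-1` A) `*` [set k]) = 0.
    rewrite product_measure1E//=; last exact: mpre.
    by rewrite mu0 mul0e.
  by rewrite mule0.
move: h1 h2 h3; rewrite -/F.
rewrite -(fineK (qL_fin (mX k (mpre i mA)))) -(fineK (qL_fin (mX k (mpre i mB)))).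
rewrite -(fineK (mu_fin mA)) -(fineK (mu_fin mB)).
rewrite -(fineK (mu_fin (mpre i mA))) -(fineK (mu_fin (mpre i mB))).
rewrite -!EFinM !lee_fin => h1 h2 h3.
have {}h3 : fine (mu (a i `&` F @^-1` A)) = 0%R ->
    fine (qL ((a i `&` F @^-1` A) `*` [set k])) = 0%R.
  by move=> h; apply: EFin_inj; apply: h3; rewrite h.
have -> : expR (R' * D) = (expR (distortion_growth * R' * (D / lambda)) * expR (K * D))%R.
  rewrite -expRD; congr expR; rewrite -[in LHS]distortion_growth_lambda.
  by field; rewrite lt0r_neq0.
by apply: (ratio_trans _ _ _ _ _ _ _ h1 h2 h3);
  rewrite ?expR_ge0 ?fine_ge0.
Qed.

Let ma_cover : measurable (~` \bigcup_i a i).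
Proof. by apply: measurableC; apply: bigcupT_measurable; exact: gm_a gm. Qed.

Lemma off_branches : qL (~` (\bigcup_i a i) `*` setT) = 0.
Proof.
have mN : measurable (~` (\bigcup_i a i) `*` setT : set W) by exact: measurableX.
have mu0 : mu (~` \bigcup_i a i) = 0.
  have mD : measurable (Y `\` \bigcup_i a i).
    by apply: measurableD => //; apply: bigcupT_measurable; exact: gm_a gm.
  have mYC : measurable (~` Y) by exact: measurableC.
  apply: (subset_measure0 _ (measurableU _ _ mYC mD)) => //.
    by move=> x nx; have [Yx|] := pselect (Y x); [right|left].
  exact: (etrans (measureU0 (mu := mu) mYC mD (gm_cover gm)) muYC).
apply/eqP; rewrite eq_le measure_ge0 andbT.
apply: le_trans (residual_le mN) _; apply: le_trans (levels_le mN) _.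
have -> : (mu \x c) (~` (\bigcup_i a i) `*` setT) = 0.
  by rewrite product_measure1E//= mu0 mul0e.
by rewrite mule0.
Qed.

(** The return time is constant on each branch, so whole products a i x {k} are
    sent to the time l or not; j codes the pair (i, k). *)
Definition renew_piece l A j : set W :=
  if pickle_inv j is Some (i, k) then
    if `[< exists2 y, a i y & (k + tau y)%N = l >]
    then (a i `&` F @^-1` A) `*` [set k] else set0
  else set0.

Let mrenew_piece l A j : measurable A -> measurable (renew_piece l A j).
Proof.
move=> mA; rewrite /renew_piece; case: pickle_inv => [[i k]|//].
by case: ifP => // _; apply: mX; exact: mpre.
Qed.

Lemma renew_levels_sum l A : measurable A ->
  qL (renew @^-1` (A `*` [set l])) = \sum_(j <oo) qL (renew_piece l A j).
Proof.
move=> mA; have mP j := @mrenew_piece l A j mA.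
have mU : measurable (\bigcup_j renew_piece l A j) by exact: bigcupT_measurable.
have mpreim : measurable (renew @^-1` (A `*` [set l])).
  by rewrite -[X in measurable X]setTI; apply: measurable_renew => //; exact: mX.
have sub : \bigcup_j renew_piece l A j `<=` renew @^-1` (A `*` [set l]).
  move=> [x k'] [j _]; rewrite /renew_piece; case: pickle_inv => [[i k]|//].
  case: ifPn => // /asboolP[y aiy <-] [/= [aix Fx] ->]; split => //=.
  by rewrite (gm_const gm aix aiy).
have mN : measurable (~` (\bigcup_i a i) `*` setT : set W) by exact: measurableX.
rewrite -[in LHS](setDUK sub) measureU0//; last first.
- apply: (subset_measure0 _ mN _ off_branches); first exact: measurableD.
  move=> [x k] [[/= Fx kl] nP]; split => //= -[i _ aix]; apply: nP.
  exists (pickle (i, k)) => //; rewrite /renew_piece pickleK_inv.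
  case: ifPn => [_|/asboolPn]; first by split.
  by case; exists x.
- exact: measurableD.
rewrite measure_semi_bigcup//.
move=> j j' _ _ [[x k0] []]; rewrite /renew_piece.
have := @pickle_invK (nat * nat)%type j.
have := @pickle_invK (nat * nat)%type j'.
case: pickle_inv => [[i' k']|//] /= <-; case: pickle_inv => [[i k]|//] /= <-.
case: ifP => // _ [/= [aix _] ->]; case: ifP => // _ [/= [ai'x _] ->].
by congr (pickle (_, _)); apply: (gm_triv gm) => //; exists x.
Qed.

Lemma renew_log_regular l :
  log_regular mu Y R' (fun A => qL (renew @^-1` (A `*` [set l]))).
Proof.
move=> A B D mA mB AY BY D0 AB; rewrite !renew_levels_sum//.
rewrite -(fineK (mu_fin mB)) muleC -nneseriesZl//.
rewrite -(fineK (mu_fin mA)) [X in _ <= _ * X]muleC -nneseriesZl//.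
rewrite -nneseriesZl//; last by move=> j _; rewrite mule_ge0// lee_fin fine_ge0.
apply: lee_nneseries => [j _ _|j _]; first by rewrite mule_ge0// lee_fin fine_ge0.
rewrite !fineK ?mu_fin// /renew_piece.
case: pickle_inv => [[i k]|]; last by rewrite measure0 !mule0.
case: ifP => _; last by rewrite measure0 !mule0.
by rewrite muleC [X in _ <= _ * X]muleC; exact: branch_log_regular.
Qed.

Let snd_setX (B : set nat) : snd @^-1` B = setT `*` B :> set W.
Proof. by apply/seteqP; split => -[x k] //= []. Qed.

Let residual_time (B : set nat) : qL (snd @^-1` B) = (1 - stop_rate)%:E * c B.
Proof.
have mB : measurable (snd @^-1` B : set W) by rewrite snd_setX; exact: measurableX.
have cB : c B = q (snd @^-1` B) by rewrite cE qE.
have := qL_q mB; rewrite -cB.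
have -> : (mu \x c) (snd @^-1` B) = c B.
  rewrite snd_setX product_measure1E//=.
  by rewrite [X in X * _](_ : _ = 1) ?mul1e//; exact: probability_setT.
have cf : c B \is a fin_num by exact: fin_num_measure.
rewrite -(fineK cf) -(fineK (qL_fin mB)) -!EFinM -EFinD => -[h].
by congr EFin; rewrite mulrBl mul1r -[X in (X - _)%R]h addrK.
Qed.

Lemma integral_time (u : nat -> \bar R) : (forall k, 0 <= u k) ->
  \int[Q]_p u p.2 = \int[c]_k u k.
Proof.
move=> u0; rewrite cE ge0_integral_pushforward//.
Qed.

Lemma residual_integral_time (u : nat -> \bar R) : (forall k, 0 <= u k) ->
  \int[qL]_p u p.2 <= (1 - stop_rate)%:E * \int[Q]_p u p.2.
Proof.
move=> u0; rewrite integral_time//.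
have x0 : (0 <= 1 - stop_rate)%R by rewrite subr_ge0 ltW// stop_rate_lt1.
have [cL cLE] := exists_finite_pushforward qL (@measurable_snd _ _ (borel M) nat).
have -> : \int[qL]_p u p.2 = \int[cL]_k u k.
  by rewrite cLE ge0_integral_pushforward.
rewrite -[leRHS](ge0_integral_mscale c measurableT (NngNum x0))//.
apply: ge0_le_measure_integral => // B _.
change (cL B <= (1 - stop_rate)%:E * c B).
by rewrite cLE /pushforward residual_time.
Qed.

(** Regularity bounds the unstopped measure by a multiple of a product measure,
    under which the recorded time and the next return time are independent. *)
Lemma residual_integral_prod (u w : nat -> \bar R) :
  (forall k, 0 <= u k) -> (forall k, 0 <= w k) ->
  \int[qL]_p (u p.2 * w (tau p.1)) <=
    (expR R')%:E * (\int[Q]_p u p.2 * \int[mu]_(y in Y) w (tau y)).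
Proof.
move=> u0 w0; have e0 : (0 <= expR R')%R by exact: expR_ge0.
have mw : measurable_fun setT (w \o tau) by apply: measurableT_comp (gm_tau gm).
have muw : measurable_fun setT (fun p : W => u p.2 * w (tau p.1)).
  apply: emeasurable_funM; first exact: measurableT_comp.
  exact: (measurableT_comp mw measurable_fst).
have uw0 (p : W) : 0 <= u p.2 * w (tau p.1) by rewrite mule_ge0.
apply: (@le_trans _ _ (\int[mscale (NngNum e0) (mu \x c)]_p (u p.2 * w (tau p.1)))).
  apply: ge0_le_measure_integral => // D mD.
  exact: le_trans (residual_le mD) (levels_le mD).
rewrite ge0_integral_mscale//= lee_pmul2l ?lte_fin ?expR_gt0//.
rewrite fubini_tonelli1// /fubini_F/=.
under eq_integral => x _.
  rewrite ge0_integralZr//; over.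
rewrite ge0_integralZl//; last exact: integral_ge0.
rewrite -integral_time// lee_pmul//; first exact: integral_ge0.
  exact: integral_ge0.
rewrite (ge0_negligible_integral (measurableC mY) measurableT mw) ?muYC//.
  by rewrite setTD setCK.
by move=> y _; exact: w0.
Qed.

End OneStep.

(** The stopped part S lifts the submeasure stop_rate (mu x law of the time) of
    the image of Q, which levels_ge provides; the rest is moved on by one return
    and is regular again.  The last clause is the recursion for the moments of
    the recorded time: the masses are reduced by 1 - stop_rate, and the next
    return time is independent of the recorded one up to the factor e^R'. *)
Lemma regeneration_step (Q : {finite_measure set W -> \bar R}) :
  regular_levels Q ->
  exists S Q' : {finite_measure set W -> \bar R},
  [/\ forall A, measurable A -> S (A `*` setT) + Q' (A `*` setT) = Q (A `*` setT),
      forall D, measurable D -> S D <= Q D,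
      forall B, measurable B ->
        S (hit @^-1` (B `*` setT)) = stop_rate%:E * (mu B * Q setT),
      regular_levels Q' &
      forall f u u' w : nat -> \bar R, (forall k, 0 <= f k) ->
        (forall k, 0 <= u k) -> (forall k, 0 <= u' k) -> (forall k, 0 <= w k) ->
        (forall k t, f (k + t)%N <= u k + u' k * w t) ->
        \int[Q']_p f p.2 <= (1 - stop_rate)%:E * \int[Q]_p u p.2 +
          (expR R')%:E * (\int[Q]_p u' p.2 * \int[mu]_(y in Y) w (tau y))].
Proof.
move=> Qreg.
have [q qE] := exists_finite_pushforward Q measurable_hit.
have [c cE] := exists_finite_pushforward Q (@measurable_snd _ _ (borel M) nat).
have x0 : (0 <= stop_rate)%R by rewrite ltW// stop_rate_gt0.
have qge D : measurable D -> mscale (NngNum x0) (mu \x c) D <= q D.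
  by move=> mD; exact: (levels_ge qE cE Qreg mD).
have cT : c setT = Q setT by rewrite cE.
have prodT B : measurable B -> (mu \x c) (B `*` setT) = mu B * Q setT.
  by move=> mB; rewrite product_measure1E//= cT.
have nu_fin : mscale (NngNum x0) (mu \x c) setT < +oo.
  apply: le_lt_trans (qge _ measurableT) _; exact: finite_measureT_lty.
have [nu nuE] := exists_finite_measure nu_fin.
have nuE' D : nu D = stop_rate%:E * (mu \x c) D by rewrite nuE.
have [|S [L [SL SG]]] := lift_submeasure (nu := nu) measurable_hit (Q := Q).
  by move=> D mD; rewrite nuE' -[Q _]/(pushforward Q hit D) -qE; exact: qge.
have [qL qLE] := exists_finite_pushforward L measurable_hit.
have mpre D : measurable D -> measurable (hit @^-1` D).
  by move=> mD; rewrite -[X in measurable X]setTI; exact: measurable_hit.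
have qL_q D : measurable D -> qL D + stop_rate%:E * (mu \x c) D = q D.
  by move=> mD; rewrite -nuE' -SG// qLE qE /pushforward addeC SL//; exact: mpre.
have [Q' Q'E] := exists_finite_pushforward L measurable_advance.
have Q'q D : Q' (hit @^-1` D) = qL (renew @^-1` D).
  rewrite Q'E qLE /pushforward; congr (L _); apply/funext => w /=.
  by rewrite hit_advance.
exists S, Q'; split.
- move=> A mA; rewrite Q'E /pushforward -SL; last exact: measurableX.
  by congr (_ + L _); apply/seteqP; split => -[x k].
- by move=> D mD; rewrite -SL// leeDl.
- by move=> B mB; rewrite SG; [rewrite nuE' prodT|exact: measurableX].
- split=> [l A B D mA mB AY BY D0 AB|].
    by rewrite !Q'q; exact: (renew_log_regular qE cE Qreg qL_q).
  rewrite Q'q; apply: (subset_measure0 _ _ _ (off_branches qE cE Qreg qL_q)).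
  - rewrite -[X in measurable X]setTI; apply: measurable_renew => //.
    by apply: measurableX => //; exact: measurableC.
  - apply: measurableX => //; apply: measurableC; apply: bigcupT_measurable.
    exact: gm_a gm.
  - by move=> [x k] [/= nY _]; split => //= -[i _ /(gm_return gm)].
move=> f u u' w f0 u0 u'0 w0 fuw.
have mf : measurable_fun setT (fun p : W => f p.2).
  exact: measurableT_comp.
have mw : measurable_fun setT (w \o tau) by apply: measurableT_comp (gm_tau gm).
have mu1 : measurable_fun setT (fun p : W => u p.2) by exact: measurableT_comp.
have mu2 : measurable_fun setT (fun p : W => u' p.2 * w (tau p.1)).
  apply: emeasurable_funM; first exact: measurableT_comp.
  exact: (measurableT_comp mw measurable_fst).
have mf' : measurable_fun setT (fun p : W => f (renew p).2).
  exact: (measurableT_comp mf measurable_renew).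
have -> : \int[Q']_p f p.2 = \int[qL]_p f (renew p).2.
  rewrite Q'E ge0_integral_pushforward//; last exact: measurable_advance.
  by rewrite qLE ge0_integral_pushforward//; exact: measurable_hit.
apply: le_trans; last first.
  apply: leeD; first exact: (residual_integral_time qE cE qL_q u0).
  exact: (residual_integral_prod qE cE Qreg qL_q u'0 w0).
rewrite -ge0_integralD//; last by move=> p _; rewrite mule_ge0.
apply: ge0_le_integral => //.
- exact: emeasurable_funD.
- by move=> p _; exact: fuw.
Qed.

End RegenerationStep.

(** * A randomized time after which the law is the invariant measure *)

Section Regeneration.
Context {R : realType} {M : pmetricType R}.
Local Notation dist := (@mdist R M).
Local Notation W := (borel M * nat)%type.
Local Open Scope ereal_scope.

Variables (T : borel M -> borel M) (mu : probability (borel M) R)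
  (Y : set (borel M)) (a : nat -> set (borel M)) (tau : borel M -> nat)
  (lambda K R' : R).
Hypothesis gm : gibbs_markov T mu Y a tau lambda K.
Hypothesis KR' : (K * lambda / (lambda - 1) < R')%R.

Local Notation xi := (stop_rate lambda K R').

Section InitialMeasure.
Context (rho : probability (borel M) R) dE (E : measurableType dE)
  (kappa : probability E R) (rhoz : R.-pker E ~> borel M) (r : E -> nat).
Hypothesis fr : forward_regular T Y mu R' rho kappa rhoz r.

Let mr : measurable_fun setT r. Proof. by have [_ ? _] := fr. Qed.

Let mlevel k : measurable (r @^-1` [set k]).
Proof. by rewrite -[X in measurable X]setTI; exact: mr. Qed.

Let msection (D : set W) : measurable D ->
  measurable_fun setT (fun z => rhoz z (ysection D (r z))).
Proof.
move=> mD; rewrite (_ : setT = \bigcup_k r @^-1` [set k]); last first.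
  by apply/seteqP; split => // z _; exists (r z).
apply/(measurable_fun_bigcup _ mlevel) => k.
apply: (eq_measurable_fun (fun z => rhoz z (ysection D k))).
  by move=> z; rewrite inE/= => ->.
apply: measurable_funTS; apply: measurable_kernel.
exact: measurable_ysection.
Qed.

(** The joint law of the starting point and its jump time: z is drawn from kappa,
    then x from rhoz z, and (x, r z) is kept. *)
Lemma exists_initial_measure :
  exists Q : {finite_measure set W -> \bar R},
    forall D, measurable D -> Q D = \int[kappa]_z rhoz z (ysection D (r z)).
Proof.
pose f D := if `[< measurable D >] then
  \int[kappa]_z rhoz z (ysection D (r z)) else 0.
have fE D : measurable D -> f D = \int[kappa]_z rhoz z (ysection D (r z)).
  by move=> mD; rewrite /f; case: asboolP.
have f0 : f set0 = 0.
  rewrite fE// (eq_integral (cst 0)) ?integral0// => z _.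
  by rewrite ysection0 measure0.
have fge0 D : 0 <= f D.
  by rewrite /f; case: ifP => // _; apply: integral_ge0.
have fs : semi_sigma_additive f.
  move=> F mF tF mUF; rewrite fE//.
  rewrite (eq_integral (fun z => \sum_(i <oo) rhoz z (ysection (F i) (r z)))).
    rewrite integral_nneseries//; last by move=> n; exact: msection.
    apply: cvg_toP; first exact: is_cvg_nneseries.
    by apply: eq_eseriesr => i _; rewrite fE.
  move=> z _; rewrite ysection_bigcup measure_semi_bigcup//.
  - by move=> i; exact: measurable_ysection.
  - exact: trivIset_ysection.
  - by apply: bigcupT_measurable => i; exact: measurable_ysection.
have [Q0 Q0E] := exists_measure f0 fge0 fs.
have [|Q QE] := @exists_finite_measure _ _ _ Q0.
  rewrite Q0E fE// (eq_integral (cst 1)) => [|z _].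
    by rewrite integral_cst// mul1e; exact: finite_measureT_lty.
  rewrite (_ : ysection setT _ = setT); first exact: prob_kernel.
  by apply/seteqP; split => // x _; rewrite /ysection/= inE.
by exists Q => D mD; rewrite QE Q0E fE.
Qed.

Variable Q : {finite_measure set W -> \bar R}.
Hypothesis QE : forall D, measurable D ->
  Q D = \int[kappa]_z rhoz z (ysection D (r z)).

Lemma initial_marginal A : measurable A -> Q (A `*` setT) = rho A.
Proof.
move=> mA; rewrite QE; last exact: measurableX.
have [-> // _ _] := fr; apply: eq_integral => z _.
by rewrite in_ysectionX// inE.
Qed.

Lemma initial_time (f : nat -> \bar R) : (forall k, 0 <= f k) ->
  \int[Q]_p f p.2 = \int[kappa]_z f (r z).
Proof.
move=> f0.
have [n1 n1E] := exists_finite_pushforward Q (@measurable_snd _ _ (borel M) nat).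
have [n2 n2E] := exists_finite_pushforward kappa mr.
have -> : \int[Q]_p f p.2 = \int[n1]_k f k.
  by rewrite n1E ge0_integral_pushforward.
have -> : \int[kappa]_z f (r z) = \int[n2]_k f k.
  by rewrite n2E ge0_integral_pushforward.
apply: eq_measure_integral => B mB _.
change (n1 B = n2 B); rewrite n1E n2E /pushforward.
have mrB : measurable (r @^-1` B) by rewrite -[X in measurable X]setTI; exact: mr.
rewrite QE; last first.
  by rewrite -[X in measurable X]setTI; exact: measurable_snd.
transitivity (\int[kappa]_z (\1_(r @^-1` B) z)%:E); last first.
  by rewrite integral_indic// setIT.
apply: eq_integral => z _; rewrite indicE.
have [/set_mem/= Bz|/negP nBz] := boolP (z \in _).
  rewrite (_ : ysection _ _ = setT); first exact: prob_kernel.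
  by apply/seteqP; split => // x _; rewrite /ysection/= inE.
rewrite (_ : ysection _ _ = set0) ?measure0//.
apply/seteqP; split => // x; rewrite /ysection/= inE/= => Bz.
Qed.

(** At time k the mass is an integral over r = k of regular measures, and
    log_regular passes to integrals. *)
Lemma initial_regular : (0 <= R')%R -> regular_levels T mu Y R' Q.
Proof.
move=> R'0; have mY := gm_Y gm.
have [_ _ reg] := fr.
have mpre D : measurable D -> measurable (hit T @^-1` D).
  by move=> mD; rewrite -[X in measurable X]setTI; exact: (measurable_hit gm).
pose g A k z := if r z == k then pushforward (rhoz z) (iter (r z) T) A else 0.
have gE A k z : rhoz z (ysection (hit T @^-1` (A `*` [set k])) (r z)) = g A k z.
  rewrite /g; case: eqP => [<-|nk].
    by congr (rhoz z _); apply/seteqP; split => x; rewrite /ysection/= inE//= => -[].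
  rewrite -[RHS](measure0 (rhoz z)); congr (rhoz z _); apply/seteqP.
  by split => // x; rewrite /ysection/= inE => -[_ /nk].
have mhit A k : measurable A -> measurable (hit T @^-1` (A `*` [set k])).
  by move=> mA; apply: mpre; exact: measurableX.
have gQ A k : measurable A -> Q (hit T @^-1` (A `*` [set k])) =
    \int[kappa]_z g A k z.
  by move=> mA; rewrite QE; [apply: eq_integral => z _; exact: gE|exact: mhit].
split=> [k A B D mA mB AY BY D0 AB|].
  rewrite !gQ//.
  have mg C : measurable C -> measurable_fun setT (g C k).
    move=> mC; rewrite (_ : g C k = fun z =>
      rhoz z (ysection (hit T @^-1` (C `*` [set k])) (r z))).
      by apply: msection; exact: mhit.
    by apply/funext => z; rewrite gE.
  have g0 C z : 0 <= g C k z by rewrite -gE measure_ge0.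
  have intZ C c : measurable C -> 0 <= c ->
      (\int[kappa]_z g C k z) * c = \int[kappa]_z (g C k z * c).
    by move=> mC c0; rewrite ge0_integralZr//; exact: mg.
  have e0 : 0 <= mu A * (expR (R' * D))%:E by rewrite mule_ge0// lee_fin expR_ge0.
  rewrite [leRHS]muleC -muleA.
  rewrite !intZ//; apply: ge0_le_integral => //.
  - by move=> z _; rewrite mule_ge0.
  - by apply: emeasurable_funM => //; exact: mg.
  - by apply: emeasurable_funM => //; exact: mg.
  move=> z _; rewrite /g; case: ifP => _; last by rewrite !mul0e.
  rewrite muleA [leRHS]muleC.
  exact: (regular_measure_log_regular R'0 mY (reg z)).
rewrite QE; last by apply: mpre; apply: measurableX => //; exact: measurableC.
rewrite (eq_integral (cst 0)) ?integral0// => z _.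
have [_ [phi [_ _ _ rE]]] := reg z.
have := rE _ (measurableC mY); rewrite setICl integral_set0 => <-.
by congr (rhoz z _); apply/seteqP; split => x; rewrite /ysection/= inE//= => -[].
Qed.

End InitialMeasure.

(** P is the joint law of the starting point and its stopping time, Q n the
    measure not stopped before the n-th return.  The mass of Q n decays
    geometrically, so the parts stopped at the successive returns add up to rho;
    each of them is carried to a multiple of mu, hence so is their sum. *)
Lemma regeneration (rho : probability (borel M) R) dE (E : measurableType dE)
    (kappa : probability E R) (rhoz : R.-pker E ~> borel M) (r : E -> nat) :
  forward_regular T Y mu R' rho kappa rhoz r ->
  exists (P : probability W R) (Q : nat -> {finite_measure set W -> \bar R}),
  [/\ forall A, measurable A -> P (A `*` setT) = rho A,
      forall B, measurable B -> P ((fun w : W => iter w.2 T w.1) @^-1` B) = mu B,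
      forall f : nat -> \bar R, (forall k, 0 <= f k) ->
        \int[P]_p f p.2 <= \sum_(n <oo) \int[Q n]_p f p.2 /\
        \int[Q 0%N]_p f p.2 = \int[kappa]_z f (r z),
      forall n, Q n setT <= ((1 - xi) ^+ n)%:E &
      forall n (f u u' w : nat -> \bar R), (forall k, 0 <= f k) ->
        (forall k, 0 <= u k) -> (forall k, 0 <= u' k) -> (forall k, 0 <= w k) ->
        (forall k t, f (k + t)%N <= u k + u' k * w t) ->
        \int[Q n.+1]_p f p.2 <= (1 - xi)%:E * \int[Q n]_p u p.2 +
          (expR R')%:E * (\int[Q n]_p u' p.2 * \int[mu]_(y in Y) w (tau y))].
Proof.
move=> fr.
have R0 := R'_gt0 (gm_lambda gm) (gm_K gm) KR'.
have xi0 := stop_rate_gt0 (gm_lambda gm) (gm_K gm) KR'.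
have xi1 := stop_rate_lt1 (gm_lambda gm) (gm_K gm) KR'.
have [Q0 Q0E] := exists_initial_measure fr.
have Q0reg := initial_regular fr Q0E (ltW R0).
pose st := {Q : {finite_measure set W -> \bar R} | regular_levels T mu Y R' Q}.
have next (Q : st) : exists SQ : {finite_measure set W -> \bar R} * st,
    [/\ forall A, measurable A ->
          SQ.1 (A `*` setT) + (sval SQ.2) (A `*` setT) = (sval Q) (A `*` setT),
      forall D, measurable D -> SQ.1 D <= (sval Q) D,
      forall B, measurable B ->
        SQ.1 (hit T @^-1` (B `*` setT)) = xi%:E * (mu B * (sval Q) setT) &
      forall f u u' w : nat -> \bar R, (forall k, 0 <= f k) ->
        (forall k, 0 <= u k) -> (forall k, 0 <= u' k) -> (forall k, 0 <= w k) ->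
        (forall k t, f (k + t)%N <= u k + u' k * w t) ->
        \int[sval SQ.2]_p f p.2 <= (1 - xi)%:E * \int[sval Q]_p u p.2 +
          (expR R')%:E * (\int[sval Q]_p u' p.2 * \int[mu]_(y in Y) w (tau y))].
  have [S [Q' [h1 h2 h3 h4 h5]]] := regeneration_step gm KR' (svalP Q).
  by exists (S, exist _ Q' h4).
have [nx nxP] := choice next.
pose q n := iter n (fun Q => (nx Q).2) (exist _ Q0 Q0reg : st).
pose Q n := sval (q n); pose S n := (nx (q n)).1.
have Qmarg n A : measurable A -> S n (A `*` setT) + Q n.+1 (A `*` setT) = Q n (A `*` setT).
  by have [h _ _ _] := nxP (q n); exact: h.
have SQ n D : measurable D -> S n D <= Q n D.
  by have [_ h _ _] := nxP (q n); exact: h.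
have Shit n B : measurable B ->
    S n (hit T @^-1` (B `*` setT)) = xi%:E * (mu B * Q n setT).
  by have [_ _ h _] := nxP (q n); exact: h.
have Qstep n := let: And4 _ _ _ h := nxP (q n) in h.
have Qmass n : Q n setT <= ((1 - xi) ^+ n)%:E.
  elim: n => [|n IH].
    by rewrite expr0 -setXTT (initial_marginal fr Q0E)// probability_setT.
  have mass (m : {finite_measure set W -> \bar R}) : m setT = \int[m]_p (cst 1 p.2 : \bar R).
    by rewrite integral_cst// mul1e.
  rewrite mass; have := Qstep n (cst 1) (cst 1) (cst 0) (cst 0).
  move=> /(_ (fun=> lee01) (fun=> lee01) (fun=> lexx _) (fun=> lexx _)) h.
  apply: le_trans (h _) _; first by move=> k t; rewrite /= mul0e adde0.
  rewrite -mass /= integral0 mul0e mule0 adde0 exprS EFinM.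
  by apply: lee_wpmul2l => //; rewrite lee_fin subr_ge0 ltW.
pose P0 := mseries S 0.
have P0E D : P0 D = \sum_(n <oo) S n D by [].
have P0marg A : measurable A -> P0 (A `*` setT) = rho A.
  move=> mA; have mAT : measurable (A `*` setT : set W) by exact: measurableX.
  have tel N : \sum_(0 <= n < N) S n (A `*` setT) = rho A - Q N (A `*` setT).
    have QN : Q N (A `*` setT) \is a fin_num by exact: fin_num_measure.
    suff <- : \sum_(0 <= n < N) S n (A `*` setT) + Q N (A `*` setT) = rho A.
      by rewrite addeK.
    rewrite -(initial_marginal fr Q0E)//.
    elim: N {QN} => [|N IH]; first by rewrite big_geq// add0e.
    by rewrite big_nat_recr//= -addeA Qmarg.
  rewrite P0E; apply/cvg_lim => //.
  rewrite (_ : (fun _ => _) = fun N => rho A - Q N (A `*` setT)); last first.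
    by apply/funext => N; exact: tel.
  suff h : rho A - Q N (A `*` setT) @[N --> \oo] --> rho A - 0.
    by rewrite sube0 in h.
  apply: cvgeB => //.
  - by rewrite fin_num_adde_defl.
  - exact: cvg_cst.
  apply: (@squeeze_cvge _ _ _ _ (cst 0) _ (fun n => ((1 - xi) ^+ n)%:E)).
  - apply: nearW => n; rewrite measure_ge0/=; apply: le_trans (Qmass n).
    by apply: le_measure; rewrite ?inE.
  - exact: cvg_cst.
  - apply: cvg_EFin; first exact: nearW.
    apply: cvg_expr; rewrite ger0_norm ?subr_ge0 ?ltW//.
    by rewrite ltrBlDr ltrDl.
have [|P PE] := @exists_probability _ _ _ P0.
  change (P0 setT = 1).
  by rewrite -setXTT P0marg// probability_setT.
have PE' D : P D = P0 D by rewrite PE.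
have Phit B : measurable B -> P0 (hit T @^-1` (B `*` setT)) =
    mu B * \sum_(n <oo) (xi%:E * Q n setT).
  move=> mB; have muB : mu B \is a fin_num by exact: fin_num_measure.
  rewrite P0E -(fineK muB) -nneseriesZl//; last first.
    by move=> n _; rewrite mule_ge0// lee_fin ltW.
  by apply: eq_eseriesr => n _; rewrite Shit// fineK// muleCA.
exists P, Q; split.
- by move=> A mA; rewrite PE' P0marg.
- move=> B mB; rewrite PE'.
  rewrite (_ : _ @^-1` B = hit T @^-1` (B `*` setT)); last first.
    by apply/seteqP; split => w //= [].
  rewrite Phit// [X in _ * X](_ : _ = 1) ?mule1//.
  have := Phit _ measurableT; rewrite probability_setT mul1e => <-.
  by rewrite setXTT preimage_setT -setXTT P0marg// probability_setT.
- move=> f f0; split; last exact: (initial_time fr Q0E).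
  have mf : measurable_fun setT (fun p : W => f p.2) by exact: measurableT_comp.
  rewrite PE ge0_integral_measure_series//.
  apply: lee_nneseries => [n _ _|n _]; first exact: integral_ge0.
  apply: ge0_le_measure_integral => // D mD.
  by change (S n D <= Q n D); exact: SQ.
- exact: Qmass.
- exact: Qstep.
Qed.

End Regeneration.

(** * Geometric recursions and power inequalities *)

Section GeometricSums.
Context {R : realType}.
Local Open Scope ereal_scope.

(** The bound S solves S = A + (1 - xi/2) S + B/xi, which is what summing the
    recursion gives; the partial sums stay below it by induction. *)
Lemma geometric_recursion_sum (v : nat -> \bar R) (A B xi : R) :
  (0 < xi < 1)%R -> (0 <= B)%R -> (forall n, 0 <= v n) -> v 0%N <= A%:E ->
  (forall n, v n.+1 <= (1 - xi / 2)%:E * v n + (B * (1 - xi) ^+ n)%:E) ->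
  \sum_(n <oo) v n <= ((A + B / xi) / (xi / 2))%:E.
Proof.
move=> /andP[x0 x1] B0 v0 vA vS.
pose S := ((A + B / xi) / (xi / 2))%R.
have geo N : (B * \sum_(0 <= n < N) (1 - xi) ^+ n <= B / xi)%R.
  apply: ler_wpM2l => //.
  rewrite -(ler_pM2l x0) mulfV ?gt_eqF//.
  have -> : (xi * \sum_(0 <= n < N) (1 - xi) ^+ n = 1 - (1 - xi) ^+ N)%R.
    elim: N => [|N IH]; first by rewrite big_geq// mulr0 expr0 subrr.
    by rewrite big_nat_recr//= mulrDr IH exprS; ring.
  by rewrite lerBlDr lerDl exprn_ge0// subr_ge0 ltW.
have S0 : (0 <= S)%R.
  have A0 : (0 <= A)%R by rewrite -lee_fin (le_trans (v0 0%N)).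
  have Bx : (0 <= B / xi)%R by rewrite divr_ge0// ltW.
  by rewrite /S divr_ge0 ?addr_ge0//; lra.
apply: lime_le; first exact: is_cvg_nneseries.
apply: nearW => N.
elim: N => [|N IH]; first by rewrite big_geq// lee_fin.
rewrite big_nat_recl//=.
apply: (@le_trans _ _ (A%:E +
    ((1 - xi / 2)%:E * \sum_(0 <= n < N) v n +
     (B * \sum_(0 <= n < N) (1 - xi) ^+ n)%:E))).
  apply: leeD => //.
  rewrite ge0_sume_distrr// big_distrr/= -sumEFin -big_split/=.
  by apply: lee_sum => n _; exact: vS.
apply: (@le_trans _ _ (A%:E + ((1 - xi / 2)%:E * S%:E + (B / xi)%:E))).
  apply: leeD2l; apply: leeD; last by rewrite lee_fin.
  by apply: lee_wpmul2l => //; rewrite lee_fin; lra.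
rewrite -EFinM -!EFinD lee_fin.
have -> : (A + ((1 - xi / 2) * S + B / xi) = S - ((xi / 2) * S - (A + B / xi)))%R by ring.
by rewrite /S mulrCA divff ?mulr1 ?subrr ?subr0// gt_eqF// divr_gt0.
Qed.

Lemma inverse_squares_sum :
  \sum_(k <oo) ((k.+1%:R ^- 2 : R))%:E <= 2%:E.
Proof.
apply: lime_le; first by apply: is_cvg_nneseries => k _ _; rewrite lee_fin.
apply: nearW => -[|N]; first by rewrite big_geq// lee_fin.
rewrite sumEFin lee_fin.
have h : (\sum_(0 <= k < N.+1) (k.+1%:R ^- 2 : R) <= 2 - N.+1%:R^-1)%R.
  elim: N => [|N IH]; first by rewrite big_nat1 expr1n invr1; lra.
  rewrite big_nat_recr//=; apply: le_trans (lerD IH (lexx _)) _.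
  have n0 : (0 < N.+1%:R :> R)%R by rewrite ltr0n.
  have -> : (N.+2%:R = N.+1%:R + 1 :> R)%R by rewrite -natr1.
  move: n0; set t : R := N.+1%:R => t0.
  have t1 : (0 < t + 1)%R by rewrite addr_gt0.
  have E : (t^-1 - (t + 1)^-1 = (t * (t + 1))^-1)%R.
    by field; rewrite !gt_eqF.
  have : ((t + 1) ^- 2 <= (t * (t + 1))^-1)%R.
    rewrite lef_pV2 ?posrE ?exprn_gt0 ?mulr_gt0// expr2 ler_wpM2r//.
      exact: ltW.
    by rewrite lerDl.
  rewrite -E => h1.
  apply: (@le_trans _ _ (2 - t^-1 + (t^-1 - (t + 1)^-1))%R).
    by rewrite lerD2l.
  by rewrite addrA subrK.
by apply: le_trans h _; rewrite lerBlDr lerDl invr_ge0.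
Qed.

End GeometricSums.

Section PowerInequalities.
Context {R : realType}.
Implicit Types (x y p b th g : R).

(** The maximum of x^p e^(-x) is at x = p; it is bounded through 1 + ln y <= y. *)
Lemma expRN_le_powR p x : 0 < p -> 0 < x -> expR (- x) <= p `^ p * x `^ (- p).
Proof.
move=> p0 x0.
rewrite /powR !gt_eqF// -expRD ler_expR.
have : 1 + ln (x / p) <= x / p.
  by rewrite -[leRHS]lnK ?posrE ?divr_gt0// expR_ge1Dx.
rewrite ln_div ?posrE// => h.
have := ler_wpM2l (ltW p0) h; rewrite mulrCA divff ?gt_eqF// mulr1.
lra.
Qed.

Lemma powR_subadditive g x y : 0 < g <= 1 -> 0 <= x -> 0 <= y ->
  (x + y) `^ g <= x `^ g + y `^ g.
Proof.
move=> /andP[g0 g1]; rewrite le_eqVlt => /predU1P[<-|x0] y0.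
  by rewrite add0r lerDr powR_ge0.
move: y0; rewrite le_eqVlt => /predU1P[<-|y0]; first by rewrite addr0 lerDl powR_ge0.
have s0 : 0 < x + y by rewrite addr_gt0.
have part z : 0 < z -> z <= x + y -> z / (x + y) * (x + y) `^ g <= z `^ g.
  move=> z0 zs.
  have -> : z `^ g = (z / (x + y)) `^ g * (x + y) `^ g.
    by rewrite -powRM ?divr_ge0 ?(ltW s0) ?(ltW z0)// divfK ?lt0r_neq0.
  apply: ler_wpM2r; first exact: powR_ge0.
  by apply: ger1_powR => //; rewrite divr_gt0//= ler_pdivrMr// mul1r.
have xs : x <= x + y by rewrite lerDl ltW.
have ys : y <= x + y by rewrite lerDr ltW.
apply: le_trans (lerD (part x x0 xs) (part y y0 ys)).
by rewrite -mulrDl -mulrDl divff ?mul1r// gt_eqF.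
Qed.

(** Convexity in the crude form: x + y is at most the larger one of
    x / (1 - th) and y / th. *)
Lemma powRD_split b th x y : 0 < b -> 0 < th < 1 -> 0 <= x -> 0 <= y ->
  (x + y) `^ b <= (1 - th) `^ (- b) * x `^ b + th `^ (- b) * y `^ b.
Proof.
move=> b0 /andP[th0 th1] x0 y0.
have th1' : 0 < 1 - th by rewrite subr_gt0.
have powV z (t : R) : 0 < t -> 0 <= z -> t `^ (- b) * z `^ b = (z / t) `^ b.
  move=> t0 z0; rewrite powRM ?invr_ge0 ?(ltW t0)// mulrC; congr (_ * _).
  by rewrite -[in RHS]powR_inv1 ?(ltW t0)// -powRrM mulN1r.
rewrite !powV//.
have le_pow z1 z2 : 0 <= z1 -> z1 <= z2 -> z1 `^ b <= z2 `^ b.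
  move=> z10 z12; apply: ge0_ler_powR; rewrite ?nnegrE ?(ltW b0)//.
  exact: le_trans z12.
have [h|/ltW h] := leP (y / th) (x / (1 - th)).
  apply: (@le_trans _ _ ((x / (1 - th)) `^ b)); last by rewrite lerDl powR_ge0.
  apply: le_pow; first by rewrite addr_ge0.
  rewrite ler_pdivlMr//; move: h; rewrite ler_pdivrMr// mulrAC ler_pdivlMr//.
  by move=> h; lra.
apply: (@le_trans _ _ ((y / th) `^ b)); last by rewrite lerDr powR_ge0.
apply: le_pow; first by rewrite addr_ge0.
rewrite ler_pdivlMr//; move: h; rewrite ler_pdivrMr// mulrAC ler_pdivlMr//.
by move=> h; lra.
Qed.

End PowerInequalities.

(** * Moments of integer times from their tails *)

Section RandomTimes.
Context {R : realType} d (E : measurableType d) (m : {measure set E -> \bar R})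
  (D : set E) (X : E -> nat).
Hypothesis mD : measurable D.
Hypothesis mX : measurable_fun D X.
Local Open Scope ereal_scope.

Definition step_from (x : R) (k : nat) : \bar R := ((x <= k%:R)%R%:R)%:E.

Lemma step_from_ge0 x k : 0 <= step_from x k.
Proof. by rewrite lee_fin. Qed.

Let mtail k : measurable (D `&` [set z | (k <= X z)%N]).
Proof.
rewrite (_ : [set z | _] = X @^-1` [set j | (k <= j)%N])//; exact: mX.
Qed.

Let integral_tail k : \int[m]_(z in D) ((k <= X z)%N%:R)%:E =
  m (D `&` [set z | (k <= X z)%N]).
Proof.
rewrite (eq_integral (fun z => (\1_(D `&` [set z | (k <= X z)%N]) z)%:E)).
  by rewrite integral_indic// setIC setIA setIid.
move=> z zD; rewrite indicE; congr (_%:R%:E); apply/esym.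
by rewrite in_setI zD/= mem_setE.
Qed.

(** Times are integers, so the threshold x acts as its round-up. *)
Lemma tail_real (b C : R) : (0 <= b)%R -> (0 <= C)%R ->
  (forall k, (0 < k)%N ->
     m (D `&` [set z | (k <= X z)%N]) <= (C * k%:R `^ (- b))%:E) ->
  forall x : R, (0 < x)%R ->
    \int[m]_(z in D) step_from x (X z) <= (C * x `^ (- b))%:E.
Proof.
move=> b0 C0 tail x x0.
have ex : exists k : nat, (x <= k%:R)%R.
  by exists (Num.truncn x).+1; apply/ltW/truncnS_gt.
case: (ex_minnP ex) => k0 xk0 kmin.
have k00 : (0 < k0)%N by rewrite -(ltr_nat R) (lt_le_trans x0).
have E0 k : (x <= k%:R)%R = (k0 <= k)%N.
  apply/idP/idP; first exact: kmin.
  by move=> kk; apply: (le_trans xk0); rewrite ler_nat.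
rewrite (eq_integral (fun z => ((k0 <= X z)%N%:R)%:E)); last first.
  by move=> z _; rewrite /step_from E0.
rewrite integral_tail.
apply: le_trans (tail _ k00) _; rewrite lee_fin; apply: ler_wpM2l => //.
rewrite !powRN lef_pV2 ?posrE ?powR_gt0 ?ltr0n//.
by apply: ge0_ler_powR; rewrite ?nnegrE ?(ltW x0).
Qed.

(** The factor 2 bounds the sum of the inverse squares, the rest bounds
    k^2 e^(-al/2 k^g) by e^(-u) <= p^p u^(-p) with p = 2/g. *)
Definition stretched_const (al g : R) : R :=
  (2 * ((2 / g) `^ (2 / g) * (al / 2) `^ (- (2 / g))))%R.

(** Half of the exponential rate is given up: e^(al/2 X^g) is at most 1 plus the
    sum of e^(al/2 k^g) over 1 <= k <= X, and with the tail bound the k-th term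
    is of order e^(-al/2 k^g), hence of order 1/k^2. *)
Lemma stretched_moment (al g C : R) : (0 < al)%R -> (0 < g)%R -> (0 <= C)%R ->
  m D <= 1 ->
  (forall k, (0 < k)%N ->
     m (D `&` [set z | (k <= X z)%N]) <= (C * expR (- al * k%:R `^ g))%:E) ->
  \int[m]_(z in D) (expR (al / 2 * (X z)%:R `^ g))%:E <=
    (1 + C * stretched_const al g)%:E.
Proof.
move=> al0 g0 C0 mD1 tail.
pose F k z : \bar R := (expR (al / 2 * k.+1%:R `^ g))%:E *
  ((k.+1 <= X z)%N%:R)%:E.
have F0 k z : 0 <= F k z by rewrite mule_ge0 ?lee_fin ?expR_ge0.
have mS k : measurable_fun D (fun z => ((k.+1 <= X z)%N%:R)%:E : \bar R).
  by apply/measurable_EFinP; apply: (measurableT_comp (f := fun j => (k.+1 <= j)%N%:R : R)).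
have mF k : measurable_fun D (F k).
  by apply: emeasurable_funM => //; exact: measurable_cst.
apply: (@le_trans _ _ (\int[m]_(z in D) (1 + \sum_(k <oo) F k z))).
  apply: ge0_le_integral => //.
  - apply/measurable_EFinP.
    exact: (measurableT_comp (f := fun j => expR (al / 2 * j%:R `^ g))).
  - apply: emeasurable_funD; first exact: measurable_cst.
    by apply: ge0_emeasurable_sum.
  move=> z _; case Xz : (X z) => [|j].
    rewrite powR0 ?gt_eqF// mulr0 expR0 leeDl//.
    by apply: nneseries_ge0.
  apply: le_trans (leeDr _ _) => //.
  have : F j z = (expR (al / 2 * j.+1%:R `^ g))%:E.
    by rewrite /F Xz leqnn mule1.
  move=> <-; apply: le_trans (nneseries_lim_ge j.+1 _) => [|k _]//.
  by rewrite big_nat_recr//= leeDr// sume_ge0.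
pose p : R := (2 / g)%R; have p0 : (0 < p)%R by rewrite divr_gt0.
pose c : R := (p `^ p * (al / 2) `^ (- p))%R.
have c0 : (0 <= c)%R by rewrite mulr_ge0// powR_ge0.
have Fle k : \int[m]_(z in D) F k z <= (C * c)%:E * (k.+1%:R ^- 2)%:E.
  rewrite ge0_integralZl// integral_tail.
  apply: le_trans (lee_wpmul2l _ (tail _ _)) _ => //.
  rewrite -!EFinM lee_fin mulrCA -expRD -[leRHS]mulrA; apply: ler_wpM2l => //.
  set x : R := k.+1%:R; have x0 : (0 < x)%R by rewrite ltr0n.
  have u0 : (0 < al / 2 * x `^ g)%R by rewrite mulr_gt0 ?divr_gt0// powR_gt0.
  have -> : (al / 2 * x `^ g + - al * x `^ g = - (al / 2 * x `^ g))%R by field.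
  apply: le_trans (expRN_le_powR p0 u0) _.
  rewrite powRM ?powR_ge0 ?divr_ge0 ?(ltW al0)// -powRrM.
  have -> : (g * - p = 1 *- 2)%R by rewrite /p; field; rewrite gt_eqF.
  by rewrite powR_invn ?(ltW x0)// mulrA.
rewrite ge0_integralD//; last by apply: ge0_emeasurable_sum.
  rewrite integral_cst// mul1e integral_nneseries// EFinD; apply: leeD => //.
  apply: (@le_trans _ _ (\sum_(k <oo) ((C * c)%:E * (k.+1%:R ^- 2)%:E))).
    by apply: lee_nneseries => [k _ _|k _]; [exact: integral_ge0|exact: Fle].
  rewrite nneseriesZl; last by move=> k _; rewrite lee_fin.
  apply: le_trans (lee_wpmul2l _ inverse_squares_sum) _.
    by rewrite lee_fin mulr_ge0.
  by rewrite -EFinM lee_fin -mulrA [(c * 2)%R]mulrC.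
by move=> z _; apply: nneseries_ge0.
Qed.

End RandomTimes.

(** * The renewal recursion for the stopping time *)

Section Constants.
Context {R : realType}.
Implicit Types xi b C al g : R.

(** The time k + t at the next return exceeds x only if k exceeds (1 - th) x or t
    exceeds th x.  This th spends half of the decay rate xi on the first case
    (split_ratio_contract). *)
Definition split_ratio xi b : R := 1 - ((1 - xi) / (1 - xi / 2)) `^ b^-1.

Definition poly_const xi (R' : R) b C : R :=
  (C + expR R' * C * split_ratio xi b `^ (- b) / xi) / (xi / 2).

Definition exp_base al g C : R := 1 + C * stretched_const al g.

(** Chosen so that e^R' exp_slope exp_base = xi/2: the expected growth of the
    exponential moment over one return eats up half of the decay rate xi. *)
Definition exp_slope xi (R' : R) al g C : R := xi / 2 / (expR R' * exp_base al g C).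

Definition exp_rate xi (R' : R) al g C : R := exp_slope xi R' al g C * (al / 2).

Definition exp_const xi al g C : R := exp_base al g C / (xi / 2).

Lemma split_ratio_itv xi b : 0 < xi < 1 -> 0 < b -> 0 < split_ratio xi b < 1.
Proof.
move=> /andP[x0 x1] b0; rewrite /split_ratio.
set q := _ / _.
have q0 : 0 < q by rewrite divr_gt0//; lra.
have q1 : q < 1 by rewrite ltr_pdivrMr//; lra.
apply/andP; split; last by rewrite ltrBlDr ltrDl powR_gt0.
rewrite subr_gt0 /powR gt_eqF// -expR0 ltr_expR.
by rewrite pmulr_rlt0 ?invr_gt0// ln_lt0// q0.
Qed.

Lemma split_ratio_contract xi b : 0 < xi < 1 -> 0 < b ->
  (1 - xi) * (1 - split_ratio xi b) `^ (- b) = 1 - xi / 2.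
Proof.
move=> /andP[x0 x1] b0; rewrite /split_ratio subKr.
have x1' : 0 < 1 - xi by rewrite subr_gt0.
have x2' : 0 < 1 - xi / 2 by lra.
rewrite -powRrM mulrN mulVf ?gt_eqF// powR_inv1 ?divr_ge0 ?ltW//.
by rewrite invf_div mulrCA divff ?mulr1 ?gt_eqF.
Qed.

Lemma stretched_const_ge0 al g : 0 <= stretched_const al g.
Proof. by rewrite /stretched_const !mulr_ge0// powR_ge0. Qed.

Lemma exp_base_ge1 al g C : 0 <= C -> 1 <= exp_base al g C.
Proof. by move=> C0; rewrite lerDl mulr_ge0// stretched_const_ge0. Qed.

Lemma exp_slope_itv xi (R' : R) al g C : 0 < xi < 1 -> 0 <= R' -> 0 <= C ->
  0 < exp_slope xi R' al g C <= 1.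
Proof.
move=> /andP[x0 x1] R0 C0; have h1 := exp_base_ge1 al g C0.
have e1 : 1 <= expR R' by apply: le_trans (expR_ge1Dx _); rewrite lerDl.
have h2 : 1 <= expR R' * exp_base al g C by rewrite -[leLHS]mulr1 ler_pM.
rewrite /exp_slope; apply/andP; split.
  by rewrite !divr_gt0// (lt_le_trans ltr01).
rewrite ler_pdivrMr ?(lt_le_trans ltr01)// mul1r; apply: le_trans h2; lra.
Qed.

End Constants.

Section RenewalTails.
Context {R : realType} d (X : measurableType d)
  (P : probability (X * nat)%type R)
  (Q : nat -> {finite_measure set (X * nat)%type -> \bar R})
  dE (E : measurableType dE) (kappa : probability E R) (r : E -> nat)
  dB (B : measurableType dB) (mu : probability B R) (Y : set B)
  (tau : B -> nat) (xi R' : R).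
Local Open Scope ereal_scope.
Hypothesis mr : measurable_fun setT r.
Hypothesis mY : measurable Y.
Hypothesis mtau : measurable_fun Y tau.
Hypothesis xi01 : (0 < xi < 1)%R.
Hypothesis R0 : (0 <= R')%R.
Hypothesis Psum : forall f : nat -> \bar R, (forall k, 0 <= f k) ->
  \int[P]_p f p.2 <= \sum_(n <oo) \int[Q n]_p f p.2 /\
  \int[Q 0%N]_p f p.2 = \int[kappa]_z f (r z).
Hypothesis Qmass : forall n, Q n setT <= ((1 - xi) ^+ n)%:E.
Hypothesis Qstep : forall n (f u u' w : nat -> \bar R), (forall k, 0 <= f k) ->
  (forall k, 0 <= u k) -> (forall k, 0 <= u' k) -> (forall k, 0 <= w k) ->
  (forall k t, f (k + t)%N <= u k + u' k * w t) ->
  \int[Q n.+1]_p f p.2 <= (1 - xi)%:E * \int[Q n]_p u p.2 +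
    (expR R')%:E * (\int[Q n]_p u' p.2 * \int[mu]_(y in Y) w (tau y)).

Let mtime (f : nat -> \bar R) :
  measurable_fun setT (fun p : (X * nat)%type => f p.2).
Proof. exact: measurableT_comp. Qed.

Let QZ n (f : nat -> \bar R) (c : R) : (0 <= c)%R -> (forall k, 0 <= f k) ->
  \int[Q n]_p (c%:E * f p.2) = c%:E * \int[Q n]_p f p.2.
Proof. by move=> c0 f0; rewrite ge0_integralZl. Qed.

Let Qone n : \int[Q n]_p (cst 1 p.2 : \bar R) <= ((1 - xi) ^+ n)%:E.
Proof. by rewrite integral_cst// mul1e; exact: Qmass. Qed.

Let Q_ge0 n (f : nat -> \bar R) : (forall k, 0 <= f k) -> 0 <= \int[Q n]_p f p.2.
Proof. by move=> f0; exact: integral_ge0. Qed.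

Let x0 : (0 < xi)%R. Proof. by case/andP : xi01. Qed.
Let x1 : (0 < 1 - xi)%R. Proof. by rewrite subr_gt0; case/andP : xi01. Qed.

(** The tails of the times recorded in Q n are at most w n x^(-b), where w solves the
    recursion obtained by splitting x at the ratio th. *)
Lemma renewal_poly_tail (b C : R) : (0 < b)%R -> (0 < C)%R ->
  (forall k, (0 < k)%N ->
     kappa [set z | (k <= r z)%N] <= (C * k%:R `^ (- b))%:E) ->
  (forall k, (0 < k)%N ->
     mu (Y `&` [set y | (k <= tau y)%N]) <= (C * k%:R `^ (- b))%:E) ->
  forall x : R, (0 < x)%R ->
    \int[P]_p step_from x p.2 <= (poly_const xi R' b C * x `^ (- b))%:E.
Proof.
move=> b0 C0 tr tt x xx0; have x0' := x0; have x1' := x1.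
have /andP[th0 th1] := split_ratio_itv xi01 b0.
have thC := split_ratio_contract xi01 b0.
set th := split_ratio xi b in th0 th1 thC.
have Jr : forall x : R, (0 < x)%R -> \int[kappa]_z step_from x (r z) <=
    (C * x `^ (- b))%:E.
  apply: tail_real => //; [exact: ltW|exact: ltW|].
  by move=> k k0; rewrite setTI; exact: tr.
have Jt : forall x : R, (0 < x)%R -> \int[mu]_(y in Y) step_from x (tau y) <=
    (C * x `^ (- b))%:E.
  by apply: tail_real => //; exact: ltW.
pose D := (expR R' * C * th `^ (- b))%R.
pose w := fix w n : R := if n is n'.+1 then
  ((1 - xi / 2) * w n' + D * (1 - xi) ^+ n')%R else C.
have D0 : (0 <= D)%R by rewrite !mulr_ge0 ?expR_ge0 ?powR_ge0// ltW.
have w0 n : (0 <= w n)%R.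
  elim: n => [|n IH] /=; first exact: ltW.
  by rewrite addr_ge0// mulr_ge0// ?exprn_ge0 ?ltW//; lra.
have wP n : forall x : R, (0 < x)%R ->
    \int[Q n]_p step_from x p.2 <= (w n * x `^ (- b))%:E.
  elim: n => [|n IH] y y0.
    by rewrite (Psum (step_from_ge0 y)).2; exact: Jr.
  have th1' : (0 < 1 - th)%R by rewrite subr_gt0.
  have := @Qstep n (step_from y) (step_from ((1 - th) * y)) (cst 1)
    (step_from (th * y)) (step_from_ge0 _) (step_from_ge0 _) (fun=> lee01)
    (step_from_ge0 _).
  move=> h; apply: le_trans (h _) _ => {h}.
    move=> k t; rewrite /cst mul1e /step_from.
    rewrite -EFinD lee_fin.
    have : (y <= (k + t)%:R)%R ->
        ((1 - th) * y <= k%:R)%R || (th * y <= t%:R)%R.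
      rewrite natrD => h.
      have [//|/= h1] := leP ((1 - th) * y)%R k%:R.
      by have [//|/= h2] := leP (th * y)%R t%:R; lra.
    set b1 := (y <= _)%R; set b2 := (_ <= k%:R)%R; set b3 := (_ <= t%:R)%R.
    case: b1 => [/(_ isT)|_]; last by rewrite addr_ge0.
    by case: b2 => /=; [rewrite lerDl|move=> ->; rewrite add0r].
  apply: (@le_trans _ _ ((1 - xi)%:E * (w n * ((1 - th) * y) `^ (- b))%:E +
      (expR R')%:E * (((1 - xi) ^+ n)%:E * (C * (th * y) `^ (- b))%:E))).
    apply: leeD.
      by apply: lee_wpmul2l; [rewrite lee_fin ltW|apply: IH; rewrite mulr_gt0].
    apply: lee_wpmul2l; first by rewrite lee_fin expR_ge0.
    apply: lee_pmul => //.
    - exact: (Q_ge0 _ (fun=> lee01)).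
    - by apply: integral_ge0 => z _; exact: step_from_ge0.
    - by apply: Jt; rewrite mulr_gt0.
  rewrite -!EFinM -EFinD lee_fin !powRM ?(ltW th0) ?(ltW th1') ?(ltW y0)//=.
  rewrite -thC /D le_eqVlt; apply/orP; left; apply/eqP; ring.
apply: le_trans (Psum (step_from_ge0 x)).1 _.
apply: le_trans (lee_nneseries _ (fun n _ => wP n x xx0)) _.
  by move=> n _ _; exact: (Q_ge0 _ (step_from_ge0 x)).
have px : (0 <= x `^ (- b))%R by exact: powR_ge0.
have := @geometric_recursion_sum R (fun n => (w n)%:E) C D xi xi01 D0.
have w0' n : 0 <= (w n)%:E by rewrite lee_fin.
move=> /(_ w0' (lexx _)) h.
under eq_eseriesr do rewrite mulrC EFinM.
rewrite nneseriesZl// mulrC EFinM; apply: lee_wpmul2l => //.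
apply: h => n; by rewrite -EFinM -EFinD.
Qed.

(** The recursion of the tails holds for the moments themselves, by powRD_split. *)
Lemma renewal_poly_moment (b C : R) : (0 < b)%R -> (0 < C)%R ->
  \int[kappa]_z ((r z)%:R `^ b)%:E <= C%:E ->
  \int[mu]_(y in Y) ((tau y)%:R `^ b)%:E <= C%:E ->
  \int[P]_p (p.2%:R `^ b)%:E <= (poly_const xi R' b C)%:E.
Proof.
move=> b0 C0 mom_r mom_t.
have thI := split_ratio_itv xi01 b0; have /andP[th0 th1] := thI.
have thC := split_ratio_contract xi01 b0.
set th := split_ratio xi b in th0 th1 thC thI.
pose f (k : nat) : \bar R := (k%:R `^ b)%:E.
have f0 k : 0 <= f k by rewrite lee_fin powR_ge0.
have pt : (0 <= th `^ (- b))%R by exact: powR_ge0.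
have pt' : (0 <= (1 - th) `^ (- b))%R by exact: powR_ge0.
apply: le_trans (Psum f0).1 _.
apply: geometric_recursion_sum => //.
- by rewrite !mulr_ge0 ?expR_ge0 ?powR_ge0// ltW.
- by move=> n; exact: (Q_ge0 _ f0).
- by rewrite (Psum f0).2.
move=> n.
have := @Qstep n f (fun k => ((1 - th) `^ (- b))%:E * f k) (cst 1)
  (fun k => (th `^ (- b))%:E * f k) f0.
move=> h; apply: le_trans (h _ _ _ _) _ => {h}.
- by move=> k; rewrite mule_ge0.
- by move=> k; exact: lee01.
- by move=> k; rewrite mule_ge0.
- move=> k t; rewrite /cst mul1e /f -!EFinM -EFinD lee_fin natrD.
  exact: powRD_split.
rewrite QZ// muleA -EFinM thC; apply: leeD2l.
have -> : \int[mu]_(y in Y) ((th `^ (- b))%:E * f (tau y)) =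
    (th `^ (- b))%:E * \int[mu]_(y in Y) f (tau y).
  rewrite ge0_integralZl//.
  exact: (measurableT_comp (f := f)).
apply: (@le_trans _ _ ((expR R')%:E * (((1 - xi) ^+ n)%:E * ((th `^ (- b))%:E * C%:E)))).
  apply: lee_wpmul2l; first by rewrite lee_fin expR_ge0.
  apply: lee_pmul => //.
  - exact: (Q_ge0 _ (fun=> lee01)).
  - by rewrite mule_ge0//; apply: integral_ge0 => y _; exact: f0.
  - by apply: lee_wpmul2l.
rewrite -!EFinM lee_fin le_eqVlt; apply/orP; left; apply/eqP; rewrite -/th; ring.
Qed.

(** Since k^g is subadditive, f(k + t) <= f(k) e^(s u) with u = (al/2) t^g, and
    by convexity e^(s u) <= 1 + s e^u: only the small multiple s of the
    exponential moment of tau enters the recursion. *)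
Lemma renewal_exp_moment (al g C : R) : (0 < al)%R -> (0 < g <= 1)%R ->
  (0 < C)%R ->
  (forall k, (0 < k)%N ->
     kappa [set z | (k <= r z)%N] <= (C * expR (- al * k%:R `^ g))%:E) ->
  (forall k, (0 < k)%N ->
     mu (Y `&` [set y | (k <= tau y)%N]) <= (C * expR (- al * k%:R `^ g))%:E) ->
  \int[P]_p (expR (exp_rate xi R' al g C * p.2%:R `^ g))%:E <=
    (exp_const xi al g C)%:E.
Proof.
move=> al0 /andP[g0 g1] C0 tr tt.
have /andP[s0 s1] := exp_slope_itv al g xi01 R0 (ltW C0).
have D1 := exp_base_ge1 al g (ltW C0).
pose s := exp_slope xi R' al g C; pose D0 := exp_base al g C.
pose f (k : nat) : \bar R := (expR (s * (al / 2) * k%:R `^ g))%:E.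
pose w (k : nat) : \bar R := (expR (al / 2 * k%:R `^ g))%:E.
have f0 k : 0 <= f k by rewrite lee_fin expR_ge0.
have w0 k : 0 <= w k by rewrite lee_fin expR_ge0.
have Jr : \int[kappa]_z w (r z) <= D0%:E.
  apply: (stretched_moment _ _ al0 g0 (ltW C0)) => //.
    exact: probability_le1.
  by move=> k k0; rewrite setTI; exact: tr.
have Jt : \int[mu]_(y in Y) w (tau y) <= D0%:E.
  apply: (stretched_moment _ _ al0 g0 (ltW C0)) => //.
  exact: probability_le1.
have convex u : (0 <= u)%R -> (expR (s * u) <= 1 + s * expR u)%R.
  move=> u0.
  have s1' : (1 <= s^-1)%R by rewrite invf_ge1.
  have := expR_bernoulli (s * u) s1'; rewrite mulKf ?gt_eqF// => h.
  have := ler_wpM2l (ltW s0) h; rewrite mulrDr mulrA divff ?gt_eqF// mulr1 mul1r.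
  move=> h2; rewrite -lerBlDl; apply: le_trans h2.
  by rewrite lerDr ltW.
apply: le_trans (Psum f0).1 _.
have -> : exp_const xi al g C = ((D0 + 0 / xi) / (xi / 2))%R.
  by rewrite mul0r addr0.
apply: geometric_recursion_sum => //.
- by move=> n; exact: (Q_ge0 _ f0).
- rewrite (Psum f0).2; apply: le_trans Jr; apply: ge0_le_integral => //.
  + exact: (measurableT_comp (f := f)).
  + exact: (measurableT_comp (f := w)).
  move=> z _; rewrite lee_fin ler_expR -mulrA; apply: ler_piMl => //.
  by rewrite mulr_ge0 ?powR_ge0// divr_ge0// ltW.
move=> n; rewrite mul0r adde0.
have := @Qstep n f f (fun k => s%:E * f k) w f0 f0.
move=> h; apply: le_trans (h _ _ _) _ => {h}.
- by move=> k; rewrite mule_ge0// lee_fin ltW.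
- exact: w0.
- move=> k t; rewrite /f /w -!EFinM -EFinD lee_fin.
  apply: (@le_trans _ _ (expR (s * (al / 2) * k%:R `^ g) *
      expR (s * (al / 2 * t%:R `^ g)))%R).
    rewrite -expRD ler_expR [(s * (al / 2 * _))%R]mulrA -mulrDr natrD.
    apply: ler_wpM2l.
      by rewrite mulr_ge0 ?(ltW s0)// divr_ge0// ltW.
    by apply: powR_subadditive => //; rewrite g0.
  apply: (@le_trans _ _ (expR (s * (al / 2) * k%:R `^ g) *
      (1 + s * expR (al / 2 * t%:R `^ g)))%R); last first.
    by rewrite le_eqVlt; apply/orP; left; apply/eqP; ring.
  apply: ler_wpM2l; first exact: expR_ge0.
  by apply: convex; rewrite mulr_ge0 ?powR_ge0// divr_ge0// ltW.
rewrite QZ//; last exact: ltW.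
apply: (@le_trans _ _ ((1 - xi)%:E * \int[Q n]_p f p.2 +
    (xi / 2)%:E * \int[Q n]_p f p.2)).
  apply: leeD2l.
  apply: (@le_trans _ _ ((expR R')%:E * (s%:E * \int[Q n]_p f p.2 * D0%:E))).
    apply: lee_wpmul2l; first by rewrite lee_fin expR_ge0.
    apply: lee_wpmul2l => //; rewrite mule_ge0//; first by rewrite lee_fin ltW.
    exact: (Q_ge0 _ f0).
  rewrite muleAC -EFinM muleA -EFinM.
  have -> : (expR R' * (s * D0) = xi / 2)%R.
    have e0 : (expR R' != 0)%R by rewrite gt_eqF// expR_gt0.
    have d0 : (D0 != 0)%R by rewrite gt_eqF// (lt_le_trans ltr01).
    rewrite /s /exp_slope -/D0 invfM.
    by rewrite mulrCA [(xi / 2 * _)%R]mulrC !mulrA -[(_ * D0)%R]mulrA; field; rewrite e0 d0.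
  by [].
rewrite -ge0_muleDl; last 2 first.
- by rewrite lee_fin ltW.
- by rewrite lee_fin divr_ge0// ltW.
by rewrite -EFinD (_ : (1 - xi + xi / 2 = 1 - xi / 2)%R)//; field.
Qed.

End RenewalTails.

(** * Paths of Birkhoff sums *)

Section EuclideanNorm.
Context {R : realType} {n : nat}.
Local Notation V := 'rV[R]_n.
Implicit Types x y z : V.

Lemma cauchy_schwarz (a b : 'I_n -> R) :
  (\sum_i a i * b i) ^+ 2 <= (\sum_i a i ^+ 2) * (\sum_i b i ^+ 2).
Proof.
have : 0 <= \sum_i \sum_j (a i * b j - a j * b i) ^+ 2.
  by apply: sumr_ge0 => i _; apply: sumr_ge0 => j _; exact: sqr_ge0.
have -> : \sum_i \sum_j (a i * b j - a j * b i) ^+ 2 =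
    2 * ((\sum_i a i ^+ 2) * (\sum_i b i ^+ 2)) - 2 * (\sum_i a i * b i) ^+ 2.
  have E1 : (\sum_i a i ^+ 2) * (\sum_i b i ^+ 2) =
      \sum_i \sum_j a i ^+ 2 * b j ^+ 2.
    by rewrite big_distrl/=; apply: eq_bigr => i _; rewrite big_distrr.
  have E2 : (\sum_i a i ^+ 2) * (\sum_i b i ^+ 2) =
      \sum_i \sum_j a j ^+ 2 * b i ^+ 2.
    by rewrite E1 exchange_big.
  have E3 : (\sum_i a i * b i) ^+ 2 =
      \sum_i \sum_j (a i * b i) * (a j * b j).
    by rewrite expr2 big_distrl/=; apply: eq_bigr => i _; rewrite big_distrr.
  rewrite mulr_natl mulr2n [X in _ = X + _ - _]E1 [X in _ = _ + X - _]E2 E3.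
  rewrite mulr_sumr -big_split/= -sumrB; apply: eq_bigr => i _.
  rewrite mulr_sumr -big_split/= -sumrB; apply: eq_bigr => j _.
  by ring.
by rewrite subr_ge0 ler_pM2l.
Qed.

Lemma enorm_ge0 x : 0 <= enorm x.
Proof. exact: sqrtr_ge0. Qed.

Lemma enormN x : enorm (- x) = enorm x.
Proof. by congr Num.sqrt; apply: eq_bigr => i _; rewrite mxE sqrrN. Qed.

Lemma enorm0 : enorm (0 : V) = 0.
Proof.
rewrite /enorm big1 ?sqrtr0// => i _; by rewrite mxE expr0n.
Qed.

Lemma enormD x y : enorm (x + y) <= enorm x + enorm y.
Proof.
have sq z : 0 <= \sum_i z ord0 i ^+ 2 by apply: sumr_ge0 => i _; exact: sqr_ge0.
rewrite -[leRHS]ger0_norm ?addr_ge0 ?enorm_ge0// -sqrtr_sqr ler_wsqrtr//.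
rewrite sqrrD !sqr_sqrtr//.
have -> : \sum_i (x + y) ord0 i ^+ 2 = \sum_i x ord0 i ^+ 2 +
    (\sum_i x ord0 i * y ord0 i) *+ 2 + \sum_i y ord0 i ^+ 2.
  rewrite -sumrMnl -!big_split/=; apply: eq_bigr => i _.
  by rewrite mxE sqrrD.
apply: lerD => //; apply: lerD => //; rewrite lerMn2r/=.
apply: le_trans (ler_norm _) _; rewrite -sqrtr_sqr -sqrtrM//.
by apply: ler_wsqrtr; exact: cauchy_schwarz.
Qed.

Lemma enormB x y : enorm (x - y) <= enorm x + enorm y.
Proof. by rewrite -(enormN y); exact: enormD. Qed.

Lemma measurable_enormB d (T : measurableType d) (f g : T -> V) :
  measurable_fun setT (f : T -> borel V) -> measurable_fun setT (g : T -> borel V) ->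
  measurable_fun setT (fun t => enorm (f t - g t)).
Proof.
move=> mf mg; rewrite /enorm.
have mc (h : T -> V) i : measurable_fun setT (h : T -> borel V) ->
    measurable_fun setT (fun t => h t ord0 i).
  by move=> mh; exact: (measurableT_comp (@measurable_coord R n i) mh).
apply: (measurableT_comp (f := @Num.sqrt R)).
  by apply: continuous_measurable_fun; exact: sqrt_continuous.
apply: measurable_sum => i; apply: measurable_funX.
rewrite (_ : (fun _ => _) = (fun t => f t ord0 i - g t ord0 i)); last first.
  by apply/funext => t; rewrite !mxE.
by apply: measurable_funB; exact: mc.
Qed.

Lemma measurable_path d (T : measurableType d) (X : nat -> T -> V) :
  (forall k, measurable_fun setT (X k : T -> borel V)) ->
  forall A, path_measurable A -> measurable [set t | A (X^~ t)].
Proof.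
move=> mX.
pose G : set (set (nat -> V)) := [set A | measurable [set t | A (X^~ t)]].
suff : path_measurable `<=` G by [].
apply: smallest_sub.
  split.
  - by rewrite /G/= (_ : [set _ | _] = set0).
  - move=> A GA; rewrite /G/= (_ : [set _ | _] = ~` [set t | A (X^~ t)]).
      exact: measurableC.
    by apply/seteqP; split => t /=; [case|].
  - move=> F GF; rewrite /G/= (_ : [set _ | _] =
      \bigcup_k [set t | F k (X^~ t)]); first exact: bigcupT_measurable.
    by apply/seteqP; split => t [k _ Fk]; exists k.
move=> A [k _ [B mB <-]]; rewrite /G/= (_ : [set _ | _] = X k @^-1` B).
  by rewrite -[X in measurable X]setTI; exact: mX.
by apply/seteqP; split => t /=; [case|].
Qed.

End EuclideanNorm.

Section BirkhoffSums.
Context {R : realType} {n : nat} {X : Type}.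
Variables (T : X -> X) (v : X -> 'rV[R]_n).
Hypothesis bv : has_ubound (range (fun x => enorm (v x))).

Lemma birkhoffD k j x :
  birkhoff T v (k + j) x = birkhoff T v k x + birkhoff T v j (iter k T x).
Proof.
rewrite /birkhoff big_split_ord/=; congr (_ + _).
by apply: eq_bigr => i _; rewrite /= addnC iterD.
Qed.

Lemma enorm_le_sup x : enorm (v x) <= sup_norm v.
Proof. by apply: ub_le_sup => //; exists x. Qed.

Lemma enorm_birkhoff k x : enorm (birkhoff T v k x) <= k%:R * sup_norm v.
Proof.
elim: k => [|k IH]; first by rewrite /birkhoff big_ord0 enorm0 mul0r.
rewrite /birkhoff big_ord_recr/= -natr1 mulrDl mul1r.
by apply: le_trans (enormD _ _) _; apply: lerD => //; exact: enorm_le_sup.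
Qed.

(** Until the later of the two times both paths are of norm at most |v| times
    that time.  Afterwards both add the same Birkhoff sums of y, up to a stretch
    of length N2 - N1. *)
Lemma delayed_paths_close (y : X) (p1 p2 : nat -> 'rV[R]_n) (N1 N2 k : nat) :
  (forall j, p1 (N1 + j)%N = p1 N1 + birkhoff T v j y) ->
  (forall j, p2 (N2 + j)%N = p2 N2 + birkhoff T v j y) ->
  (forall j, enorm (p1 j) <= j%:R * sup_norm v) ->
  (forall j, enorm (p2 j) <= j%:R * sup_norm v) ->
  enorm (p1 k - p2 k) <= 2 * sup_norm v * (maxn N1 N2)%:R.
Proof.
wlog N12 : p1 p2 N1 N2 / (N1 <= N2)%N => [hw|h1 h2 b1 b2].
  move=> h1 h2 b1 b2; case/orP : (leq_total N1 N2) => N12; first exact: hw.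
  by rewrite -opprB enormN maxnC; exact: hw.
have V0 : 0 <= sup_norm v by apply: le_trans (enorm_le_sup y); exact: enorm_ge0.
rewrite (maxn_idPr N12).
have [kN|/ltnW Nk] := leqP k N2.
  apply: le_trans (enormB _ _) _; apply: le_trans (lerD (b1 k) (b2 k)) _.
  have : k%:R * sup_norm v <= N2%:R * sup_norm v.
    by apply: ler_wpM2r => //; rewrite ler_nat.
  lra.
have e1 : k = (N1 + ((N2 - N1) + (k - N2)))%N by lia.
have e2 : k = (N2 + (k - N2))%N by lia.
have e3 : ((N2 - N1) + (k - N2) = (k - N2) + (N2 - N1))%N by lia.
rewrite [in p1 k]e1 [in p2 k]e2 h1 h2 e3 birkhoffD.
set c := birkhoff T v (k - N2) y; set b := birkhoff T v (N2 - N1) _.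
have -> : p1 N1 + (c + b) - (p2 N2 + c) = (p1 N1 - p2 N2) + b.
  by rewrite (addrC c b) addrA opprD addrACA subrr addr0 addrAC.
apply: le_trans (enormD _ _) _.
apply: le_trans (lerD (enormB _ _) (enorm_birkhoff _ _)) _.
apply: le_trans (lerD (lerD (b1 _) (b2 _)) (lexx _)) _.
rewrite natrB//; lra.
Qed.

End BirkhoffSums.

(** * Drawing the past of a point distributed by the invariant measure *)

Lemma measurable_truncn (R : realType) : measurable_fun setT (@Num.truncn R).
Proof.
have mlt (y : R) : measurable [set x : R | x < y].
  by rewrite (_ : [set x | _] = `]-oo, y[%classic)//; apply/seteqP;
    split => x /=; rewrite in_itv.
have meq k : measurable [set x : R | Num.truncn x = k].
  case: k => [|k].
    rewrite (_ : [set x | _] = [set x : R | x < 1])//.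
    apply/seteqP; split => x /=; rewrite -(truncn_le_nat x 0) leqn0.
      by move=> ->.
    by move/eqP.
  rewrite (_ : [set x | _] = [set x : R | x < k.+2%:R] `\` [set x | x < k.+1%:R]).
    exact: measurableD.
  apply/seteqP; split => x /=; rewrite -!truncn_le_nat.
    by move=> ->; rewrite leqnn ltnn.
  by move=> [h1 /negP]; rewrite -ltnNge => h2; apply/eqP; rewrite eqn_leq h1 h2.
move=> _ B _; rewrite setTI (_ : _ @^-1` B =
    \bigcup_(k in B) [set x : R | Num.truncn x = k]).
  rewrite bigcup_mkcond; apply: bigcupT_measurable => k.
  by case: ifP => // _; exact: meq.
apply/seteqP; split => [x Bx|x [k Bk /= xk]]; last by rewrite /= xk.
by exists (Num.truncn x).
Qed.

Section Realization.
Context {R : realType} {M : pmetricType R} {n : nat}.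
Local Notation V := 'rV[R]_n.
Local Notation W := (borel M * nat)%type.
Variables (T : borel M -> borel M) (v : borel M -> V).
Hypothesis mT : measurable_fun setT T.
Hypothesis mv : measurable_fun setT (v : borel M -> borel V).
Hypothesis bv : has_ubound (range (fun x => enorm (v x))).
Local Open Scope ereal_scope.
Local Notation U := (@uniform01 R).
Local Notation b := (birkhoff T v).

Let miter k : measurable_fun setT (iter k T).
Proof.
elim: k => [|k IH]; first exact: measurable_id.
exact: (measurableT_comp mT IH).
Qed.

Lemma measurable_birkhoff_coord k i : measurable_fun setT (fun x => b k x ord0 i).
Proof.
rewrite (_ : (fun _ => _) = fun x => (\sum_(j < k) v (iter j T x) ord0 i)%R).
  apply: measurable_sum => j.
  exact: (measurableT_comp (@measurable_coord R n i) (measurableT_comp mv (miter j))).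
by apply/funext => x; rewrite /birkhoff summxE.
Qed.

Lemma measurable_birkhoff k : measurable_fun setT (b k : borel M -> borel V).
Proof. by apply: measurable_row => i; exact: measurable_birkhoff_coord. Qed.

(** The past of a point is remembered through one real number coding the time k
    and all the Birkhoff sums of x: a real code can be drawn from its conditional
    law, whereas points of the metric space M need not be codable. *)
Definition record_values (w : W) (j : option (nat * 'I_n)) : R :=
  if j is Some (l, i) then b l w.1 ord0 i else w.2%:R.

Definition path_of (c : R) (l : nat) : V :=
  (\row_i family_decode (Some (l, i) : option (nat * 'I_n)) c)%R.

Definition time_of (c : R) : nat :=
  Num.truncn (family_decode (None : option (nat * 'I_n)) c).

Definition record_code (w : W) : R := family_code (record_values w).

Lemma path_of_code w l : path_of (record_code w) l = b l w.1.
Proof. by apply/rowP => i; rewrite mxE family_codeK. Qed.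

Lemma time_of_code w : time_of (record_code w) = w.2.
Proof. by rewrite /time_of family_codeK/= natrK. Qed.

Lemma measurable_record_code : measurable_fun setT record_code.
Proof.
apply: measurable_family_code => -[[l i]|] /=.
  exact: (measurableT_comp (measurable_birkhoff_coord l i) measurable_fst).
exact: (measurableT_comp (f := fun k => k%:R : R)).
Qed.

Lemma measurable_path_of l : measurable_fun setT (path_of ^~ l : R -> borel V).
Proof.
apply: measurable_row => i; rewrite (_ : (fun _ => _) =
  family_decode (Some (l, i) : option (nat * 'I_n))).
  exact: measurable_family_decode.
by apply/funext => c; rewrite mxE.
Qed.

Lemma measurable_time_of : measurable_fun setT time_of.
Proof.
apply: (measurableT_comp (f := @Num.truncn R)); first exact: measurable_truncn.
exact: measurable_family_decode.
Qed.

(** The relation between a point and a code drawn for its past; two codes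
    related to the same point have close paths. *)
Definition follows (p : borel M * R) : Prop :=
  (forall j, path_of p.2 (time_of p.2 + j) =
     (path_of p.2 (time_of p.2) + b j p.1)%R) /\
  (forall j, enorm (path_of p.2 j) <= j%:R * sup_norm v)%R.

Lemma measurable_follows : measurable (follows : set (borel M * R)).
Proof.
have mpath N i : measurable_fun setT (fun p : borel M * R => path_of p.2 N ord0 i).
  exact: (measurableT_comp (@measurable_coord R n i)
    (measurableT_comp (measurable_path_of N) measurable_snd)).
pose A N j i := [set p : borel M * R |
  path_of p.2 (N + j) ord0 i == (path_of p.2 N ord0 i + b j p.1 ord0 i)%R].
have mA N j i : measurable (A N j i).
  rewrite -[A _ _ _]setTI; apply: (measurable_fun_eqr _ _) => //.
  apply: measurable_funD => //.
  exact: (measurableT_comp (measurable_birkhoff_coord j i) measurable_fst).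
pose C N := [set p : borel M * R | time_of p.2 = N].
have mC N : measurable (C N).
  have mt : measurable_fun setT (fun p : borel M * R => time_of p.2).
    exact: (measurableT_comp measurable_time_of measurable_snd).
  by rewrite -[C N]setTI; exact: (mt measurableT [set N]).
pose D j := [set p : borel M * R | (enorm (path_of p.2 j) <= j%:R * sup_norm v)%R].
have mD j : measurable (D j).
  rewrite -[D j]setTI; apply: (measurable_fun_ler _ _) => //.
  rewrite (_ : (fun _ => _) = fun p : borel M * R => enorm (path_of p.2 j - 0)%R).
    apply: measurable_enormB; last exact: measurable_cst.
    exact: (measurableT_comp (measurable_path_of j) measurable_snd).
  by apply/funext => p; rewrite subr0.
rewrite (_ : follows = (\bigcup_N (C N `&` \bigcap_j \bigcap_(i in [set: 'I_n]) A N j i))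
    `&` \bigcap_j D j).
  apply: measurableI; last exact: bigcapT_measurable.
  apply: bigcupT_measurable => N; apply: measurableI => //.
  apply: bigcapT_measurable => j; apply: fin_bigcap_measurable => // i _.
apply/seteqP; split => p.
  move=> [h1 h2]; split=> [|j _]; last exact: h2.
  by exists (time_of p.2) => //; split => // j _ i _; rewrite /A/= h1 [X in X == _]mxE.
move=> [[N _ [<- h1]] h2]; split => j; last exact: h2.
by apply/rowP => i; rewrite [RHS]mxE; apply/eqP; exact: (h1 j I i I).
Qed.

Lemma follows_code w : follows (iter w.2 T w.1, record_code w).
Proof.
split=> [j|j] /=; rewrite ?time_of_code !path_of_code.
  exact: birkhoffD.
exact: enorm_birkhoff.
Qed.

(** The code of (x, k) is drawn, by outsourcing, from its conditional law given the
    point T^k x.  The joint law of this point and the code is thereby preserved,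
    and each clause of the conclusion is about this joint law. *)
Lemma realization (mu rho : probability (borel M) R) (P : probability W R) :
  (forall A, measurable A -> P (A `*` setT) = rho A) ->
  (forall B, measurable B -> P ((fun w : W => iter w.2 T w.1) @^-1` B) = mu B) ->
  exists c : borel M * R -> R, [/\ measurable_fun setT c,
    (mu \x U) [set p | ~ follows (p.1, c p)] = 0,
    forall A, path_measurable A ->
      (mu \x U) [set p | A (path_of (c p))] = rho [set x | A (b^~ x)] &
    forall f : nat -> \bar R, (forall k, 0 <= f k) ->
      \int[mu \x U]_p f (time_of (c p)) = \int[P]_w f w.2].
Proof.
move=> Pmarg Phit.
have mG := measurable_iter_pair mT.
have s01 w : (0 <= record_code w < 1)%R.
  by rewrite /record_code; have /andP[-> /=] := family_code_itv (record_values w); lra.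
have [c [mc cP]] := outsourcing mG measurable_record_code s01 Phit.
exists c; split => //.
- have := cP _ (measurableC measurable_follows) => /= ->.
  rewrite (_ : [set w | _] = set0) ?measure0//.
  by apply/seteqP; split => // w /= /(_ (follows_code w)).
- move=> A mA.
  have mD : measurable ([set p | A (path_of p.2)] : set (borel M * R)).
    rewrite (_ : [set p | _] = snd @^-1` [set c0 | A (path_of c0)])//.
    rewrite -[X in measurable X]setTI; apply: measurable_snd => //.
    exact: (measurable_path (X := fun l c0 => path_of c0 l) measurable_path_of).
  have := cP _ mD => /= ->.
  have mbA := measurable_path measurable_birkhoff mA.
  rewrite -Pmarg//; congr (P _); apply/seteqP; split => -[x k] /=.
    by rewrite (_ : path_of _ = b ^~ x)//; apply/funext => l; rewrite path_of_code.
  by rewrite (_ : path_of _ = b ^~ x)//; [case|apply/funext => l; rewrite path_of_code].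
move=> f f0.
have [n1 n1E] := exists_finite_pushforward (mu \x U : probability (borel M * R)%type R)
  (measurableT_comp measurable_time_of mc).
have [n2 n2E] := exists_finite_pushforward P (@measurable_snd _ _ (borel M) nat).
transitivity (\int[n1]_k f k).
  rewrite n1E ge0_integral_pushforward//.
  exact: (measurableT_comp measurable_time_of mc).
transitivity (\int[n2]_k f k); last by rewrite n2E ge0_integral_pushforward.
apply: eq_measure_integral => B mB _; change (n1 B = n2 B).
rewrite n1E n2E /pushforward.
have mD : measurable ([set p | B (time_of p.2)] : set (borel M * R)).
  rewrite (_ : [set p | _] = snd @^-1` (time_of @^-1` B))//.
  rewrite -[X in measurable X]setTI; apply: measurable_snd => //.
  by rewrite -[X in measurable X]setTI; exact: measurable_time_of.
have := cP _ mD => /= ->; congr (P _); apply/seteqP.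
by split => w /=; rewrite time_of_code.
Qed.

End Realization.

Section OneMeasure.
Context {R : realType} {M : pmetricType R} {n : nat}.
Local Notation V := 'rV[R]_n.
Local Open Scope ereal_scope.
Local Notation U := (@uniform01 R).

(** Everything that the coupling needs to know about one of the two measures: on
    the product of mu with the unit interval there is a copy of its path that
    ends up following the orbit of the first coordinate, after a time with the
    stated moments. *)
Lemma forward_regular_realization (m : probability (borel M) R)
    (T : borel M -> borel M) (Y : set (borel M)) (alpha : set (set (borel M)))
    (tau : borel M -> nat) (lambda Khat : R) (mu : probability (borel M) R)
    (K R' : R) (v : borel M -> V) (rho : probability (borel M) R)
    dE (E : measurableType dE) (kappa : probability E R)
    (rhoz : R.-pker E ~> borel M) (r : E -> nat) :
  nonuniformly_expanding m T Y alpha tau lambda Khat ->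
  induced_acip m T Y alpha tau mu K ->
  (K * lambda / (lambda - 1) < R')%R ->
  measurable_fun setT (v : borel M -> borel V) ->
  has_ubound (range (fun x => enorm (v x))) ->
  forward_regular T Y mu R' rho kappa rhoz r ->
  exists c : borel M * R -> R, [/\ measurable_fun setT c,
    (mu \x U) [set p | ~ follows T v (p.1, c p)] = 0,
    forall A, path_measurable A ->
      (mu \x U) [set p | A (path_of (n := n) (c p))] =
      rho [set x | A ((birkhoff T v)^~ x)] &
    [/\ forall b C : R, (0 < b)%R -> (0 < C)%R ->
          (forall k, (0 < k)%N ->
            kappa [set z | (k <= r z)%N] <= (C * k%:R `^ (- b))%:E) ->
          (forall k, (0 < k)%N ->
            mu (Y `&` [set y | (k <= tau y)%N]) <= (C * k%:R `^ (- b))%:E) ->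
          forall x : R, (0 < x)%R ->
            \int[mu \x U]_p step_from x (time_of (n := n) (c p)) <=
            (poly_const (stop_rate lambda K R') R' b C * x `^ (- b))%:E,
        forall b C : R, (0 < b)%R -> (0 < C)%R ->
          \int[kappa]_z ((r z)%:R `^ b)%:E <= C%:E ->
          \int[mu]_(y in Y) ((tau y)%:R `^ b)%:E <= C%:E ->
          \int[mu \x U]_p ((time_of (n := n) (c p))%:R `^ b)%:E <=
            (poly_const (stop_rate lambda K R') R' b C)%:E &
        forall al g C : R, (0 < al)%R -> (0 < g <= 1)%R -> (0 < C)%R ->
          (forall k, (0 < k)%N ->
            kappa [set z | (k <= r z)%N] <= (C * expR (- al * k%:R `^ g))%:E) ->
          (forall k, (0 < k)%N ->
            mu (Y `&` [set y | (k <= tau y)%N]) <=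
              (C * expR (- al * k%:R `^ g))%:E) ->
          \int[mu \x U]_p (expR (exp_rate (stop_rate lambda K R') R' al g C *
              (time_of (n := n) (c p))%:R `^ g))%:E <=
            (exp_const (stop_rate lambda K R') al g C)%:E]].
Proof.
move=> H H' KR' mv bv fr.
have [a gm] := gibbs_markov_of_nue H H'.
have [P [Q [Pmarg Phit Psum Qmass Qstep0]]] := regeneration gm KR' fr.
have mT := gm_T gm; have mY := gm_Y gm.
have [c [mc c_follows c_law c_int]] := realization mT mv bv Pmarg Phit.
have xi01 : (0 < stop_rate lambda K R' < 1)%R.
  by rewrite (stop_rate_gt0 (gm_lambda gm) (gm_K gm) KR') (stop_rate_lt1 (gm_lambda gm) (gm_K gm) KR').
have R0 := ltW (R'_gt0 (gm_lambda gm) (gm_K gm) KR').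
have mr : measurable_fun setT r by have [_ ? _] := fr.
have mtau := nue_tau_measurable H.
have Qstep k (f u u' w : nat -> \bar R) : (forall k, 0 <= f k) ->
    (forall k, 0 <= u k) -> (forall k, 0 <= u' k) -> (forall k, 0 <= w k) ->
    (forall k t, f (k + t)%N <= u k + u' k * w t) ->
    \int[Q k.+1]_p f p.2 <= (1 - stop_rate lambda K R')%:E * \int[Q k]_p u p.2 +
      (expR R')%:E * (\int[Q k]_p u' p.2 * \int[mu]_(y in Y) w (tau y)).
  move=> f0 u0 u'0 w0 fuw; have := Qstep0 k f u u' w f0 u0 u'0 w0 fuw.
  rewrite [X in _ * (_ * X)](_ : _ = \int[mu]_(y in Y) w (tau y))//.
  by apply: eq_integral => y yY; rewrite yY.
exists c; split => //; split.
- move=> b C b0 C0 h1 h2 x x0; rewrite c_int; last exact: step_from_ge0.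
  exact: (renewal_poly_tail mr mY mtau xi01 Psum Qmass Qstep b0 C0 h1 h2).
- move=> b C b0 C0 h1 h2.
  rewrite (c_int (fun k => (k%:R `^ b)%:E)); last first.
    by move=> k; rewrite lee_fin powR_ge0.
  exact: (renewal_poly_moment mY mtau xi01 Psum Qmass Qstep b0 C0 h1 h2).
- move=> al g C al0 g01 C0 h1 h2.
  rewrite (c_int (fun k => (expR (exp_rate _ _ al g C * k%:R `^ g))%:E)); last first.
    by move=> k; rewrite lee_fin expR_ge0.
  exact: (renewal_exp_moment mr mY mtau xi01 R0 Psum Qstep al0 g01 C0 h1 h2).
Qed.

End OneMeasure.

(** * The coupling *)

Section CouplingSpace.
Context {R : realType} d (X : measurableType d) (mu : probability X R).
Local Open Scope ereal_scope.
Local Notation U := (@uniform01 R).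
Local Notation Omega := (X * R * R)%type.
(** The first coordinate is the point shared by the two processes, the others
    are their private randomness. *)
Definition coupling_prob : probability Omega R := (mu \x U) \x U.

Definition coord1 (w : Omega) : X * R := w.1.
Definition coord2 (w : Omega) : X * R := (w.1.1, w.2).

Lemma measurable_coord1 : measurable_fun setT coord1.
Proof. exact: measurable_fst. Qed.

Lemma measurable_coord2 : measurable_fun setT coord2.
Proof.
apply: measurable_fun_pair; last exact: measurable_snd.
exact: (measurableT_comp measurable_fst measurable_fst).
Qed.

Lemma coord1_law D : measurable D -> coupling_prob (coord1 @^-1` D) = (mu \x U) D.
Proof.
move=> mD; rewrite (_ : coord1 @^-1` D = D `*` setT); last first.
  by apply/seteqP; split => w //= [].
transitivity ((mu \x U) D * U setT).
  exact: (product_measure1E (mu \x U) U mD measurableT).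
by rewrite [X in _ * X]probability_setT mule1.
Qed.

Lemma coord2_law D : measurable D -> coupling_prob (coord2 @^-1` D) = (mu \x U) D.
Proof.
move=> mD.
have [nu nuE] := exists_pushforward coupling_prob measurable_coord2.
transitivity (nu D); first by rewrite nuE.
apply/esym; apply: product_measure_unique => // A B mA mB.
rewrite nuE /pushforward (_ : coord2 @^-1` _ = (A `*` setT) `*` B); last first.
  by apply/seteqP; split => -[[x u] t] /=; tauto.
transitivity ((mu \x U) (A `*` setT) * U B).
  by apply: (product_measure1E (mu \x U) U) => //; exact: measurableX.
congr (_ * _); transitivity (mu A * U setT); first exact: product_measure1E.
by rewrite [X in _ * X]probability_setT mule1.
Qed.

Lemma integral_law (c : Omega -> X * R) (g : X * R -> \bar R) :
  measurable_fun setT c ->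
  (forall D, measurable D -> coupling_prob (c @^-1` D) = (mu \x U) D) ->
  measurable_fun setT g -> (forall p, 0 <= g p) ->
  \int[coupling_prob]_w g (c w) = \int[mu \x U]_p g p.
Proof.
move=> mc law mg g0.
have [nu nuE] := exists_pushforward coupling_prob mc.
transitivity (\int[nu]_p g p); first by rewrite nuE ge0_integral_pushforward.
apply: eq_measure_integral => D mD _.
by change (nu D = (mu \x U) D); rewrite nuE; exact: law.
Qed.

End CouplingSpace.

Section DominatedByTimes.
Context {R : realType} d (Omega : measurableType d) (P : probability Omega R)
  (Z : Omega -> \bar R) (N1 N2 : Omega -> nat) (V : R).
Local Open Scope ereal_scope.
Hypothesis mZ : measurable_fun setT Z.
Hypothesis mN1 : measurable_fun setT N1.
Hypothesis mN2 : measurable_fun setT N2.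
Hypothesis V0 : (0 < V)%R.
Hypothesis Z0 : forall w, 0 <= Z w.
Hypothesis ZN : {ae P, forall w, Z w <= (V * (maxn (N1 w) (N2 w))%:R)%:E}.

Let mtime (f : nat -> \bar R) (N : Omega -> nat) : measurable_fun setT N ->
  measurable_fun setT (fun w => f (N w)).
Proof. by move=> mN; exact: (measurableT_comp (f := f)). Qed.

(** A time N with V N >= x is a time N >= x / V, and the maximum of two times
    exceeds a threshold only if one of them does. *)
Lemma dominated_tail (x : R) : (0 < x)%R ->
  P [set w | x%:E <= Z w] <=
    \int[P]_w step_from (x / V) (N1 w) + \int[P]_w step_from (x / V) (N2 w).
Proof.
move=> x0.
have mA : measurable [set w | x%:E <= Z w].
  by rewrite -[X in measurable X]setTI; exact: emeasurable_fun_c_infty.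
have s0 := @step_from_ge0 R (x / V).
rewrite -[X in P X]setIT -integral_indic// -ge0_integralD//; last 2 first.
- exact: (mtime (step_from (x / V)) mN1).
- exact: (mtime (step_from (x / V)) mN2).
apply: ae_ge0_le_integral => //.
- by apply/measurable_EFinP; exact: measurable_indic.
- by move=> w _; rewrite adde_ge0.
- by apply: emeasurable_funD; exact: (mtime (step_from (x / V))).
apply: filterS ZN => w Zw _; rewrite indicE.
have [/set_mem/= xZ|_] := boolP (w \in _); last by rewrite adde_ge0.
have := le_trans xZ Zw; rewrite lee_fin mulrC -ler_pdivrMr//.
rewrite /step_from -EFinD lee_fin.
rewrite /maxn; case: ifP => _ h; rewrite h ?lerDr ?lerDl//.
Qed.

Lemma dominated_moment (b : R) : (0 < b)%R ->
  \int[P]_w (Z w `^ b) <= (V `^ b)%:E *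
    (\int[P]_w ((N1 w)%:R `^ b)%:E + \int[P]_w ((N2 w)%:R `^ b)%:E).
Proof.
move=> b0.
have pN (k : nat) : 0 <= (k%:R `^ b : R)%:E by rewrite lee_fin powR_ge0.
have m1 := mtime (fun k => (k%:R `^ b : R)%:E) mN1.
have m2 := mtime (fun k => (k%:R `^ b : R)%:E) mN2.
rewrite -ge0_integralD// -ge0_integralZl//; last 3 first.
- exact: emeasurable_funD.
- by move=> w _; rewrite adde_ge0.
- by rewrite lee_fin powR_ge0.
apply: ae_ge0_le_integral => //.
- by move=> w _; rewrite poweR_ge0.
- exact: (measurableT_comp (measurable_poweR b) mZ).
- by move=> w _; rewrite mule_ge0 ?adde_ge0// lee_fin powR_ge0.
- by apply: emeasurable_funM => //; exact: emeasurable_funD.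
apply: filterS ZN => w Zw _.
apply: (@le_trans _ _ ((V * (maxn (N1 w) (N2 w))%:R)%:E `^ b)).
  apply: gt0_ler_poweR => //; rewrite ?ltW// in_itv/= ?Z0 ?leey// lee_fin.
  by rewrite mulr_ge0// ltW.
rewrite poweR_EFin -EFinD -EFinM lee_fin powRM ?(ltW V0)//.
apply: ler_wpM2l; first exact: powR_ge0.
by rewrite /maxn; case: ifP => _; rewrite ?lerDr ?lerDl powR_ge0.
Qed.

(** Markov's inequality for the exponential moments of the two times. *)
Lemma dominated_exp_tail (A g D1 D2 x : R) : (0 <= A)%R -> (0 <= g)%R -> (0 < x)%R ->
  \int[P]_w (expR (A * (N1 w)%:R `^ g))%:E <= D1%:E ->
  \int[P]_w (expR (A * (N2 w)%:R `^ g))%:E <= D2%:E ->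
  P [set w | x%:E <= Z w] <=
    ((D1 + D2) * expR (- (A * V `^ (- g)) * x `^ g))%:E.
Proof.
move=> A0 g0 x0 h1 h2; apply: le_trans (dominated_tail x0) _.
have [e eE] : exists e : R, e = expR (- (A * V `^ (- g)) * x `^ g).
  by exists (expR (- (A * V `^ (- g)) * x `^ g)).
have e0 : (0 <= e)%R by rewrite eE expR_ge0.
rewrite -eE.
have markov (N : Omega -> nat) D : measurable_fun setT N ->
    \int[P]_w (expR (A * (N w)%:R `^ g))%:E <= D%:E ->
    \int[P]_w step_from (x / V) (N w) <= (e * D)%:E.
  move=> mN hD; rewrite EFinM; apply: le_trans (lee_wpmul2l _ hD); last by rewrite lee_fin.
  have mf := mtime (fun k => (expR (A * k%:R `^ g))%:E) mN.
  rewrite -ge0_integralZl//.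
  apply: ge0_le_integral => //.
  - by move=> w _; exact: step_from_ge0.
  - exact: (mtime (step_from (x / V)) mN).
  - by apply: emeasurable_funM.
  move=> w _; rewrite /step_from -EFinM lee_fin.
  case: (leP (x / V)%R) => /= h; last by rewrite mulr_ge0// expR_ge0.
  rewrite eE -expRD -[leLHS]expR0 ler_expR.
  have : ((x / V) `^ g <= (N w)%:R `^ g)%R.
    by apply: ge0_ler_powR; rewrite ?nnegrE// divr_ge0// ltW.
  have -> : ((x / V) `^ g = V `^ (- g) * x `^ g)%R.
    rewrite powRM ?invr_ge0 ?(ltW x0) ?(ltW V0)// mulrC; congr (_ * _)%R.
    by rewrite -[in LHS]powR_inv1 ?(ltW V0)// -powRrM mulN1r.
  by move=> /(ler_wpM2l A0); lra.
apply: le_trans (leeD (markov _ _ mN1 h1) (markov _ _ mN2 h2)) _.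
by rewrite -EFinD -mulrDr mulrC.
Qed.

End DominatedByTimes.

Section SupDistance.
Context {R : realType} {n : nat} d (O : measurableType d).
Local Notation V := 'rV[R]_n.
Local Open Scope ereal_scope.
Variables X1 X2 : nat -> O -> V.

Lemma sup_distance_ge0 w : 0 <= sup_distance X1 X2 w.
Proof.
apply: (@le_trans _ _ (enorm (X1 0%N w - X2 0%N w)%R)%:E).
  by rewrite lee_fin enorm_ge0.
by apply: ereal_sup_ubound; exists 0%N.
Qed.

Lemma measurable_sup_distance :
  (forall k, measurable_fun setT (X1 k : O -> borel V)) ->
  (forall k, measurable_fun setT (X2 k : O -> borel V)) ->
  measurable_fun setT (sup_distance X1 X2).
Proof.
move=> m1 m2.
rewrite (_ : sup_distance X1 X2 =
    fun w => esups (fun k => (enorm (X1 k w - X2 k w)%R)%:E) 0%N).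
  apply: measurable_fun_esups => k; apply/measurable_EFinP.
  exact: measurable_enormB.
by apply/funext => w; congr ereal_sup; apply/seteqP; split => _ [k _ <-]; exists k.
Qed.

End SupDistance.

Section Coupling.
Context {R : realType} {M : pmetricType R} {n : nat}.
Local Notation V := 'rV[R]_n.
Variables (T : borel M -> borel M) (v : borel M -> V)
  (mu : probability (borel M) R) (c1 c2 : borel M * R -> R).
Local Open Scope ereal_scope.
Local Notation U := (@uniform01 R).
Hypothesis bv : has_ubound (range (fun x => enorm (v x))).
Hypothesis mc1 : measurable_fun setT c1.
Hypothesis mc2 : measurable_fun setT c2.
Hypothesis c1_follows : (mu \x U) [set p | ~ follows T v (p.1, c1 p)] = 0.
Hypothesis c2_follows : (mu \x U) [set p | ~ follows T v (p.1, c2 p)] = 0.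
Hypothesis mT : measurable_fun setT T.
Hypothesis mv : measurable_fun setT (v : borel M -> borel V).

Definition path1 k (w : borel M * R * R) : V := path_of (c1 (coord1 w)) k.
Definition path2 k (w : borel M * R * R) : V := path_of (c2 (coord2 w)) k.
Definition time1 (w : borel M * R * R) : nat := time_of (n := n) (c1 (coord1 w)).
Definition time2 (w : borel M * R * R) : nat := time_of (n := n) (c2 (coord2 w)).

Lemma measurable_path1 k : measurable_fun setT (path1 k : _ -> borel V).
Proof.
exact: (measurableT_comp (measurable_path_of k)
  (measurableT_comp mc1 (@measurable_coord1 R _ (borel M)))).
Qed.

Lemma measurable_path2 k : measurable_fun setT (path2 k : _ -> borel V).
Proof.
exact: (measurableT_comp (measurable_path_of k)
  (measurableT_comp mc2 (@measurable_coord2 R _ (borel M)))).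
Qed.

Lemma measurable_time1 : measurable_fun setT time1.
Proof.
exact: (measurableT_comp (@measurable_time_of R n)
  (measurableT_comp mc1 (@measurable_coord1 R _ (borel M)))).
Qed.

Lemma measurable_time2 : measurable_fun setT time2.
Proof.
exact: (measurableT_comp (@measurable_time_of R n)
  (measurableT_comp mc2 (@measurable_coord2 R _ (borel M)))).
Qed.

Let measurable_follows_at c : measurable_fun setT c ->
  measurable [set p : borel M * R | ~ follows T v (p.1, c p)].
Proof.
move=> mc.
have mg : measurable_fun setT (fun p : borel M * R => (p.1, c p)).
  by apply: measurable_fun_pair => //; exact: measurable_fst.
rewrite -[X in measurable X]setTI.
apply: (mg measurableT (~` (follows T v : set (borel M * R)))).
by apply: measurableC; exact: measurable_follows.
Qed.

(** Both codes follow the orbit of the same first coordinate, almost surely. *)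
Lemma paths_close : {ae coupling_prob mu, forall w,
  sup_distance path1 path2 w <=
    ((2 * sup_norm v + 1) * (maxn (time1 w) (time2 w))%:R)%:E}.
Proof.
have f1 : {ae coupling_prob mu, forall w : borel M * R * R,
    follows T v (w.1.1, c1 (coord1 w))}.
  exists (@coord1 R _ (borel M) @^-1` [set p | ~ follows T v (p.1, c1 p)]); split => //.
    rewrite -[X in measurable X]setTI.
    by apply: measurable_coord1 => //; exact: measurable_follows_at.
  exact: (etrans (coord1_law mu (measurable_follows_at mc1)) c1_follows).
have f2 : {ae coupling_prob mu, forall w : borel M * R * R,
    follows T v (w.1.1, c2 (coord2 w))}.
  exists (@coord2 R _ (borel M) @^-1` [set p | ~ follows T v (p.1, c2 p)]); split => //.
    rewrite -[X in measurable X]setTI.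
    by apply: measurable_coord2 => //; exact: measurable_follows_at.
  exact: (etrans (coord2_law mu (measurable_follows_at mc2)) c2_follows).
apply: filterS2 f1 f2 => w [h1 b1] [h2 b2].
apply: ge_ereal_sup => _ [k _ <-]; rewrite lee_fin.
apply: le_trans (delayed_paths_close bv k h1 h2 b1 b2) _.
by rewrite ler_wpM2r// lerDl.
Qed.

Lemma eq_in_distribution1 (rho : probability (borel M) R) :
  (forall A, path_measurable A ->
    (mu \x U) [set p | A (path_of (c1 p))] = rho [set x | A ((birkhoff T v)^~ x)]) ->
  eq_in_distribution (coupling_prob mu) path1 rho (birkhoff T v).
Proof.
move=> law A mA; rewrite -law//.
have mD : measurable [set p | A (path_of (c1 p))].
  apply: (measurable_path (X := fun k p => path_of (c1 p) k)) => // k.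
  exact: (measurableT_comp (measurable_path_of k) mc1).
exact: (coord1_law mu mD).
Qed.

Lemma eq_in_distribution2 (rho : probability (borel M) R) :
  (forall A, path_measurable A ->
    (mu \x U) [set p | A (path_of (c2 p))] = rho [set x | A ((birkhoff T v)^~ x)]) ->
  eq_in_distribution (coupling_prob mu) path2 rho (birkhoff T v).
Proof.
move=> law A mA; rewrite -law//.
have mD : measurable [set p | A (path_of (c2 p))].
  apply: (measurable_path (X := fun k p => path_of (c2 p) k)) => // k.
  exact: (measurableT_comp (measurable_path_of k) mc2).
exact: (coord2_law mu mD).
Qed.

Lemma integral_time1 (f : nat -> \bar R) : (forall k, 0 <= f k) ->
  \int[coupling_prob mu]_w f (time1 w) =
  \int[mu \x U]_p f (time_of (n := n) (c1 p)).
Proof.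
move=> f0; apply: (integral_law (c := @coord1 R _ (borel M))
    (g := fun p => f (time_of (n := n) (c1 p)))) => //.
- exact: measurable_coord1.
- exact: coord1_law.
- apply: (measurableT_comp (f := f)) => //.
  exact: (measurableT_comp (@measurable_time_of R n) mc1).
Qed.

Lemma integral_time2 (f : nat -> \bar R) : (forall k, 0 <= f k) ->
  \int[coupling_prob mu]_w f (time2 w) =
  \int[mu \x U]_p f (time_of (n := n) (c2 p)).
Proof.
move=> f0; apply: (integral_law (c := @coord2 R _ (borel M))
    (g := fun p => f (time_of (n := n) (c2 p)))) => //.
- exact: measurable_coord2.
- exact: coord2_law.
- apply: (measurableT_comp (f := f)) => //.
  exact: (measurableT_comp (@measurable_time_of R n) mc2).
Qed.

End Coupling.

(** * The constants and their continuity *)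

Section ContinuityAtAPoint.
Context {R : realType} {X : topologicalType} (p : X).
Implicit Types f g : X -> R.

Let at_p f : Prop := f x @[x --> p] --> f p.

Lemma cvg_at_expR f : at_p f -> at_p (fun x => expR (f x)).
Proof.
move=> cf; apply: (continuous_cvg (h := expR) _ _ cf); exact: continuous_expR.
Qed.

Lemma cvg_at_div f g : g p != 0 -> at_p f -> at_p g -> at_p (fun x => f x / g x).
Proof. by move=> g0 cf cg; apply: cvgM => //; exact: cvgV. Qed.

Lemma cvg_at_powR f g : 0 < f p -> at_p f -> at_p g ->
  at_p (fun x => f x `^ g x).
Proof.
move=> f0 cf cg; rewrite /at_p.
have fpos : \forall x \near p, 0 < f x.
  by apply: (cvgr_gt (f p)).
have -> : f p `^ g p = expR (g p * ln (f p)) by rewrite /powR gt_eqF.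
apply: (@cvg_trans _ ((fun x => expR (g x * ln (f x))) x @[x --> p])).
  apply: near_eq_cvg; near=> x; rewrite /powR gt_eqF//.
  by near: x.
apply: cvg_at_expR; apply: cvgM => //.
by apply: (continuous_cvg (h := @ln R) _ _ cf); exact: continuous_ln.
Unshelve. all: by end_near. Qed.

Lemma cvg_at_stop_rate l K R' : 1 < l p -> 0 < K p ->
  K p * l p / (l p - 1) < R' p -> at_p l -> at_p K -> at_p R' ->
  at_p (fun x => stop_rate (l x) (K x) (R' x)).
Proof.
move=> l1 K0 KR cl cK cR.
have R0 := R'_gt0 l1 K0 KR; have g1 := distortion_growth_gt1 l1 K0 KR.
have g0 : 0 < distortion_growth (l p) (K p) (R' p) by exact: lt_trans g1.
apply: cvg_at_div; first by rewrite gt_eqF// expR_gt0.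
  apply: cvgB; first exact: cvg_cst.
  apply: cvgV; first by rewrite gt_eqF.
  apply: cvg_at_div; first by rewrite gt_eqF.
    by apply: cvgM => //; exact: cvgB.
  exact: cR.
exact: cvg_at_expR.
Qed.

Lemma cvg_at_poly_const xi R' b C : 0 < xi p < 1 -> 0 < b p ->
  at_p xi -> at_p R' -> at_p b -> at_p C ->
  at_p (fun x => poly_const (xi x) (R' x) (b x) (C x)).
Proof.
move=> xi01 b0 cxi cR cb cC; have /andP[x0 x1] := xi01.
have /andP[th0 _] := split_ratio_itv xi01 b0.
have xi2 : at_p (fun x => xi x / 2) by apply: cvgM => //; exact: cvg_cst.
have cth : at_p (fun x => split_ratio (xi x) (b x)).
  apply: cvgB; first exact: cvg_cst.
  apply: cvg_at_powR.
  - by rewrite divr_gt0 ?subr_gt0//; lra.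
  - apply: cvg_at_div; first by rewrite gt_eqF//; lra.
      by apply: cvgB => //; exact: cvg_cst.
    by apply: cvgB => //; exact: cvg_cst.
  - by apply: cvgV; rewrite ?gt_eqF.
apply: cvg_at_div => //; first by rewrite gt_eqF// divr_gt0.
apply: cvgD => //; apply: cvg_at_div => //; first by rewrite gt_eqF.
apply: cvgM; first by apply: cvgM => //; exact: cvg_at_expR.
by apply: cvg_at_powR => //; exact: cvgN.
Qed.

Lemma cvg_at_exp_base al g C : 0 < al p -> 0 < g p ->
  at_p al -> at_p g -> at_p C ->
  at_p (fun x => exp_base (al x) (g x) (C x)).
Proof.
move=> al0 g0 cal cg cC.
have c2g : at_p (fun x => 2 / g x).
  by apply: cvg_at_div; [rewrite gt_eqF|exact: cvg_cst|].
have cal2 : at_p (fun x => al x / 2) by apply: cvgM => //; exact: cvg_cst.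
apply: cvgD; first exact: cvg_cst.
apply: cvgM => //; apply: cvgM; first exact: cvg_cst.
apply: cvgM; apply: cvg_at_powR => //; [by rewrite divr_gt0|by rewrite divr_gt0|].
exact: cvgN.
Qed.

Lemma cvg_at_exp_const xi al g C : 0 < xi p -> 0 < al p -> 0 < g p ->
  at_p xi -> at_p al -> at_p g -> at_p C ->
  at_p (fun x => exp_const (xi x) (al x) (g x) (C x)).
Proof.
move=> x0 al0 g0 cxi cal cg cC.
apply: cvg_at_div; first by rewrite gt_eqF// divr_gt0.
  exact: cvg_at_exp_base.
by apply: cvgM => //; exact: cvg_cst.
Qed.

Lemma cvg_at_exp_rate xi R' al g C : 0 < al p -> 0 < g p -> 0 < C p ->
  at_p xi -> at_p R' -> at_p al -> at_p g -> at_p C ->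
  at_p (fun x => exp_rate (xi x) (R' x) (al x) (g x) (C x)).
Proof.
move=> al0 g0 C0 cxi cR cal cg cC.
apply: cvgM; last by apply: cvgM => //; exact: cvg_cst.
apply: cvg_at_div.
- rewrite gt_eqF// mulr_gt0 ?expR_gt0// (lt_le_trans ltr01)//.
  by apply: exp_base_ge1; exact: ltW.
- by apply: cvgM => //; exact: cvg_cst.
- apply: cvgM; first exact: cvg_at_expR.
  exact: cvg_at_exp_base.
Qed.

End ContinuityAtAPoint.

Section ContinuityOfProjections.
Context {X A B : topologicalType} (p : X).

Lemma cvg_at_fst (f : X -> A * B) : f x @[x --> p] --> f p ->
  (f x).1 @[x --> p] --> (f p).1.
Proof. by move=> cf; apply: (cvg_comp _ _ cf); exact: cvg_fst. Qed.

Lemma cvg_at_snd (f : X -> A * B) : f x @[x --> p] --> f p ->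
  (f x).2 @[x --> p] --> (f p).2.
Proof. by move=> cf; apply: (cvg_comp _ _ cf); exact: cvg_snd. Qed.

End ContinuityOfProjections.

Section CouplingConstants.
Context {R : realType}.
Local Notation P6 := (R * R * R * R * R * R)%type.
Local Notation P7 := (R * R * R * R * R * R * R)%type.

(** The factor 2 counts the two processes.  One unit of time costs at most 2 |v|;
    the slightly larger 2 |v| + 1 stays positive when v vanishes. *)
Definition poly_bound (p : P6) : R :=
  2 * poly_const (stop_rate p.1.1.1.1.1 p.1.1.1.1.2 p.1.1.1.2) p.1.1.1.2
    p.1.1.2 p.1.2 * (2 * p.2 + 1) `^ p.1.1.2.

Definition exp_bound (p : P7) : R :=
  2 * exp_const (stop_rate p.1.1.1.1.1.1 p.1.1.1.1.1.2 p.1.1.1.1.2)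
    p.1.1.1.2 p.1.1.2 p.1.2.

(** Rescaling Z from units of time by 2 |v| + 1 divides the rate by the power g of
    this number. *)
Definition exp_bound_rate (p : P7) : R :=
  exp_rate (stop_rate p.1.1.1.1.1.1 p.1.1.1.1.1.2 p.1.1.1.1.2) p.1.1.1.1.2
    p.1.1.1.2 p.1.1.2 p.1.2 * (2 * p.2 + 1) `^ (- p.1.1.2).

Lemma continuous_poly_bound : {within @poly_params R, continuous poly_bound}.
Proof.
apply: continuous_in_subspaceT => p; rewrite inE.
case: p => -[[[[l K] R'] b] C] V /= [l1 K0 KR b1 [C0 V0]].
pose p : P6 := (l, K, R', b, C, V).
have x0 := stop_rate_gt0 l1 K0 KR; have x1 := stop_rate_lt1 l1 K0 KR.
have b0 : 0 < b by exact: lt_trans b1.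
have cp : q @[q --> p] --> p by exact: cvg_id.
change (poly_bound q @[q --> p] --> poly_bound p).
have cl : (q.1.1.1.1.1 : R) @[q --> p] --> p.1.1.1.1.1 by do 5 apply: cvg_at_fst.
have cK : (q.1.1.1.1.2 : R) @[q --> p] --> p.1.1.1.1.2.
  by apply: cvg_at_snd; do 4 apply: cvg_at_fst.
have cR : (q.1.1.1.2 : R) @[q --> p] --> p.1.1.1.2.
  by apply: cvg_at_snd; do 3 apply: cvg_at_fst.
have cb : (q.1.1.2 : R) @[q --> p] --> p.1.1.2.
  by apply: cvg_at_snd; do 2 apply: cvg_at_fst.
have cC : (q.1.2 : R) @[q --> p] --> p.1.2.
  by apply: cvg_at_snd; apply: cvg_at_fst.
have cV : (q.2 : R) @[q --> p] --> p.2 by apply: cvg_at_snd.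
apply: cvgM.
  apply: cvgM; first exact: cvg_cst.
  apply: (cvg_at_poly_const (p := p)
    (xi := fun q => stop_rate q.1.1.1.1.1 q.1.1.1.1.2 q.1.1.1.2)
    (R' := fun q => q.1.1.1.2)) => //; first by rewrite x0.
  exact: (cvg_at_stop_rate (p := p) l1 K0 KR cl cK cR).
apply: (cvg_at_powR (p := p) (f := fun q => 2 * q.2 + 1)) => //.
  by rewrite /=; lra.
apply: cvgD; last exact: cvg_cst.
by apply: cvgM => //; exact: cvg_cst.
Qed.

Let exp_cvg (p : P7) : exp_params p ->
  [/\ stop_rate q.1.1.1.1.1.1 q.1.1.1.1.1.2 q.1.1.1.1.2 @[q --> p] -->
        stop_rate p.1.1.1.1.1.1 p.1.1.1.1.1.2 p.1.1.1.1.2,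
      (q.1.1.1.1.2 : R) @[q --> p] --> p.1.1.1.1.2,
      (q.1.1.1.2 : R) @[q --> p] --> p.1.1.1.2 &
   [/\ (q.1.1.2 : R) @[q --> p] --> p.1.1.2,
      (q.1.2 : R) @[q --> p] --> p.1.2 & (q.2 : R) @[q --> p] --> p.2]].
Proof.
case: p => -[[[[[l K] R'] al] g] C] V /= [l1 K0 KR al0 [g0 g1 C0 V0]].
set p : P7 := (l, K, R', al, g, C, V).
have cp : q @[q --> p] --> p by exact: cvg_id.
have cl : (q.1.1.1.1.1.1 : R) @[q --> p] --> p.1.1.1.1.1.1 by do 6 apply: cvg_at_fst.
have cK : (q.1.1.1.1.1.2 : R) @[q --> p] --> p.1.1.1.1.1.2.
  by apply: cvg_at_snd; do 5 apply: cvg_at_fst.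
have cR : (q.1.1.1.1.2 : R) @[q --> p] --> p.1.1.1.1.2.
  by apply: cvg_at_snd; do 4 apply: cvg_at_fst.
split => //.
- exact: (cvg_at_stop_rate (p := p) l1 K0 KR cl cK cR).
- by apply: (cvg_at_snd (p := p) (f := fun q => q.1.1.1)); do 3 apply: cvg_at_fst.
split.
- by apply: (cvg_at_snd (p := p) (f := fun q => q.1.1)); do 2 apply: cvg_at_fst.
- by apply: (cvg_at_snd (p := p) (f := fun q => q.1)); apply: cvg_at_fst.
- by apply: (cvg_at_snd (p := p) (f := fun q => q)).
Qed.

Lemma continuous_exp_bound : {within @exp_params R, continuous exp_bound}.
Proof.
apply: continuous_in_subspaceT => p; rewrite inE => hp.
have [cxi cR cal [cg cC cV]] := exp_cvg hp.
case: p hp cxi cR cal cg cC cV => -[[[[[l K] R'] al] g] C] V.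
move=> /= [l1 K0 KR al0 [g0 g1 C0 V0]] cxi cR cal cg cC cV.
set p : P7 := (l, K, R', al, g, C, V) in cxi cR cal cg cC cV *.
apply: cvgM; first exact: cvg_cst.
apply: (cvg_at_exp_const (p := p)
  (xi := fun q => stop_rate q.1.1.1.1.1.1 q.1.1.1.1.1.2 q.1.1.1.1.2)) => //.
exact: stop_rate_gt0.
Qed.

Lemma continuous_exp_bound_rate :
  {within @exp_params R, continuous exp_bound_rate}.
Proof.
apply: continuous_in_subspaceT => p; rewrite inE => hp.
have [cxi cR cal [cg cC cV]] := exp_cvg hp.
case: p hp cxi cR cal cg cC cV => -[[[[[l K] R'] al] g] C] V.
move=> /= [l1 K0 KR al0 [g0 g1 C0 V0]] cxi cR cal cg cC cV.
set p : P7 := (l, K, R', al, g, C, V) in cxi cR cal cg cC cV *.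
apply: cvgM.
  exact: (cvg_at_exp_rate (p := p)
    (xi := fun q => stop_rate q.1.1.1.1.1.1 q.1.1.1.1.1.2 q.1.1.1.1.2)
    (R' := fun q => q.1.1.1.1.2)).
apply: (cvg_at_powR (p := p) (f := fun q => 2 * q.2 + 1)).
- by rewrite /=; lra.
- apply: cvgD; last exact: cvg_cst.
  by apply: cvgM => //; exact: cvg_cst.
- exact: cvgN.
Qed.

Lemma exp_bound_gt0 (p : P7) : exp_params p -> 0 < exp_bound p /\ 0 < exp_bound_rate p.
Proof.
case: p => -[[[[[l K] R'] al] g] C] V /= [l1 K0 KR al0 [g0 g1 C0 V0]].
have x0 := stop_rate_gt0 l1 K0 KR; have x1 := stop_rate_lt1 l1 K0 KR.
have xi01 : 0 < stop_rate l K R' < 1 by rewrite x0.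
have D0 : 0 < exp_base al g C by rewrite (lt_le_trans ltr01)// exp_base_ge1// ltW.
split.
  by rewrite /exp_bound/= mulr_gt0// /exp_const divr_gt0// divr_gt0.
have /andP[s0 _] := exp_slope_itv al g xi01 (ltW (R'_gt0 l1 K0 KR)) (ltW C0).
have r0 : 0 < exp_rate (stop_rate l K R') R' al g C.
  by rewrite /exp_rate; apply: mulr_gt0 => //; exact: divr_gt0.
by rewrite /exp_bound_rate/=; apply: mulr_gt0 => //; apply: powR_gt0; lra.
Qed.

End CouplingConstants.

Theorem theorem2p5 (R : realType) :
  exists (Ca Cb : R * R * R * R * R * R -> R)
         (Cc Ac : R * R * R * R * R * R * R -> R),
  [/\ {within @poly_params R, continuous Ca},
      {within @poly_params R, continuous Cb},
      {within @exp_params R, continuous Cc},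
      {within @exp_params R, continuous Ac} &
      forall p, @exp_params R p -> 0 < Cc p /\ 0 < Ac p] /\
  forall (M : pmetricType R) (m : probability (borel M) R)
    (T : borel M -> borel M) (Y : set (borel M))
    (alpha : set (set (borel M))) (tau : borel M -> nat) (lambda Khat : R),
  nonuniformly_expanding m T Y alpha tau lambda Khat ->
  forall (mu : probability (borel M) R) (K : R),
  induced_acip m T Y alpha tau mu K ->
  forall R' : R, K * lambda / (lambda - 1) < R' ->
  forall (n : nat) (v : borel M -> 'rV[R]_n),
  measurable_fun setT (v : borel M -> borel 'rV[R]_n) ->
  has_ubound (range (fun x => enorm (v x))) ->
  forall (rho1 rho2 : probability (borel M) R)
    (d1 d2 : measure_display) (E1 : measurableType d1) (E2 : measurableType d2)
    (kappa1 : probability E1 R) (kappa2 : probability E2 R)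
    (rhoz1 : R.-pker E1 ~> borel M) (rhoz2 : R.-pker E2 ~> borel M)
    (r1 : E1 -> nat) (r2 : E2 -> nat),
  forward_regular T Y mu R' rho1 kappa1 rhoz1 r1 ->
  forward_regular T Y mu R' rho2 kappa2 rhoz2 r2 ->
  exists (dO : measure_display) (Omega : measurableType dO)
    (P : probability Omega R) (X1 X2 : nat -> Omega -> 'rV[R]_n),
  let Z := sup_distance X1 X2 in
  [/\ forall k, measurable_fun setT (X1 k : Omega -> borel 'rV[R]_n) /\
                measurable_fun setT (X2 k : Omega -> borel 'rV[R]_n),
      eq_in_distribution P X1 rho1 (birkhoff T v),
      eq_in_distribution P X2 rho2 (birkhoff T v) &
      {ae P, forall w, (Z w < +oo)%E}] /\
  [/\ (* weak polynomial moments *)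
      forall beta Cbeta : R, 1 < beta -> 0 < Cbeta ->
      (forall k, (0 < k)%N ->
        [/\ (kappa1 [set z | (k <= r1 z)%N] <= (Cbeta * k%:R `^ (- beta))%:E)%E,
            (kappa2 [set z | (k <= r2 z)%N] <= (Cbeta * k%:R `^ (- beta))%:E)%E &
            (mu (Y `&` [set y | (k <= tau y)%N])
               <= (Cbeta * k%:R `^ (- beta))%:E)%E]) ->
      forall x : R, 0 < x ->
        (P [set w | x%:E <= Z w] <=
          (Ca (lambda, K, R', beta, Cbeta, sup_norm v) * x `^ (- beta))%:E)%E,
      (* strong polynomial moments *)
      forall beta Cbeta : R, 1 < beta -> 0 < Cbeta ->
      (\int[kappa1]_z ((r1 z)%:R `^ beta)%:E <= Cbeta%:E)%E ->
      (\int[kappa2]_z ((r2 z)%:R `^ beta)%:E <= Cbeta%:E)%E ->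
      (\int[mu]_(y in Y) ((tau y)%:R `^ beta)%:E <= Cbeta%:E)%E ->
      (\int[P]_w (Z w `^ beta) <=
        (Cb (lambda, K, R', beta, Cbeta, sup_norm v))%:E)%E &
      (* exponential and stretched exponential moments *)
      forall al ga Cag : R, 0 < al -> 0 < ga <= 1 -> 0 < Cag ->
      (forall k, (0 < k)%N ->
        [/\ (kappa1 [set z | (k <= r1 z)%N]
               <= (Cag * expR (- al * k%:R `^ ga))%:E)%E,
            (kappa2 [set z | (k <= r2 z)%N]
               <= (Cag * expR (- al * k%:R `^ ga))%:E)%E &
            (mu (Y `&` [set y | (k <= tau y)%N])
               <= (Cag * expR (- al * k%:R `^ ga))%:E)%E]) ->
      forall x : R, 0 < x ->
        (P [set w | x%:E <= Z w] <=
          (Cc (lambda, K, R', al, ga, Cag, sup_norm v) *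
           expR (- Ac (lambda, K, R', al, ga, Cag, sup_norm v) * x `^ ga))%:E)%E].
Proof.
exists poly_bound, poly_bound, exp_bound, exp_bound_rate; split.
  split; [exact: continuous_poly_bound|exact: continuous_poly_bound|
    exact: continuous_exp_bound|exact: continuous_exp_bound_rate|].
  by move=> p; exact: exp_bound_gt0.
move=> M m T Y alpha tau lambda Khat H mu K H' R' KR' n v mv bv.
move=> rho1 rho2 d1 d2 E1 E2 kappa1 kappa2 rhoz1 rhoz2 r1 r2 fr1 fr2.
have [c1 [mc1 follows1 law1 [tail1 moment1 exp1]]] :=
  forward_regular_realization H H' KR' mv bv fr1.
have [c2 [mc2 follows2 law2 [tail2 moment2 exp2]]] :=
  forward_regular_realization H H' KR' mv bv fr2.
have mT := nue_T_measurable H.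
have l1 := nue_lambda_gt1 H.
have K0 : 0 < K.
  by have [a gm] := gibbs_markov_of_nue H H'; exact: gm_K gm.
have R0 := R'_gt0 l1 K0 KR'.
have xi01 : 0 < stop_rate lambda K R' < 1.
  by rewrite (stop_rate_gt0 l1 K0 KR') (stop_rate_lt1 l1 K0 KR').
have V0 : 0 <= sup_norm v.
  exact: le_trans (enorm_ge0 (v point)) (enorm_le_sup bv point).
have V1 : 0 < 2 * sup_norm v + 1 by lra.
have mX1 := measurable_path1 (n := n) mc1.
have mX2 := measurable_path2 (n := n) mc2.
have mN1 := measurable_time1 (n := n) mc1.
have mN2 := measurable_time2 (n := n) mc2.
have close := paths_close bv mc1 mc2 follows1 follows2 mT mv.
have mZ := measurable_sup_distance mX1 mX2.
have Z0 := sup_distance_ge0 (path1 (n := n) c1) (path2 (n := n) c2).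
exists _, (borel M * R * R)%type, (coupling_prob mu), (path1 c1), (path2 c2).
split.
  split => //.
  - exact: eq_in_distribution1.
  - exact: eq_in_distribution2.
  - by apply: filterS close => w; move=> /le_lt_trans; apply; exact: ltry.
split.
- move=> b C b1 C0 hyp x x0.
  have b0 : 0 < b by exact: lt_trans b1.
  have := dominated_tail mZ mN1 mN2 V1 close x0; move=> /le_trans; apply.
  rewrite (integral_time1 (n := n) mu mc1) ?(integral_time2 (n := n) mu mc2);
    try exact: step_from_ge0.
  have xV : 0 < x / (2 * sup_norm v + 1) by exact: divr_gt0.
  have h1 := tail1 b C b0 C0 (fun k k0 => let: And3 h _ _ := hyp k k0 in h)
    (fun k k0 => let: And3 _ _ h := hyp k k0 in h) _ xV.
  have h2 := tail2 b C b0 C0 (fun k k0 => let: And3 _ h _ := hyp k k0 in h)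
    (fun k k0 => let: And3 _ _ h := hyp k k0 in h) _ xV.
  apply: le_trans (leeD h1 h2) _.
  rewrite -EFinD lee_fin powRM ?(ltW x0) ?invr_ge0 ?(ltW V1)//.
  have -> : (2 * sup_norm v + 1)^-1 `^ (- b) = (2 * sup_norm v + 1) `^ b.
    by rewrite -[in LHS]powR_inv1 ?(ltW V1)// -powRrM mulN1r opprK.
  by rewrite /poly_bound/=; lra.
- move=> b C b1 C0 h1 h2 htau.
  have b0 : 0 < b by exact: lt_trans b1.
  have := dominated_moment mZ mN1 mN2 V1 Z0 close b0; move=> /le_trans; apply.
  have k0 (k : nat) : (0 <= (k%:R `^ b : R)%:E)%E by rewrite lee_fin powR_ge0.
  have g1 := moment1 b C b0 C0 h1 htau; have g2 := moment2 b C b0 C0 h2 htau.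
  rewrite -(integral_time1 (n := n) mu mc1 k0) in g1.
  rewrite -(integral_time2 (n := n) mu mc2 k0) in g2.
  apply: le_trans (lee_wpmul2l _ (leeD g1 g2)) _; first by rewrite lee_fin powR_ge0.
  by rewrite -EFinD -EFinM lee_fin /poly_bound/=; lra.
- move=> al g C al0 g01 C0 hyp x x0; have /andP[g0 g1] := g01.
  have A0 : 0 <= exp_rate (stop_rate lambda K R') R' al g C.
    have /andP[s0 _] := exp_slope_itv al g xi01 (ltW R0) (ltW C0).
    by rewrite /exp_rate mulr_ge0// ltW// divr_gt0.
  have k0 (k : nat) : (0 <=
    (expR (exp_rate (stop_rate lambda K R') R' al g C * k%:R `^ g))%:E)%E.
    by rewrite lee_fin expR_ge0.
  have h1 := exp1 al g C al0 g01 C0 (fun k k0 => let: And3 h _ _ := hyp k k0 in h)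
    (fun k k0 => let: And3 _ _ h := hyp k k0 in h).
  have h2 := exp2 al g C al0 g01 C0 (fun k k0 => let: And3 _ h _ := hyp k k0 in h)
    (fun k k0 => let: And3 _ _ h := hyp k k0 in h).
  rewrite -(integral_time1 (n := n) mu mc1 k0) in h1.
  rewrite -(integral_time2 (n := n) mu mc2 k0) in h2.
  have := dominated_exp_tail mZ mN1 mN2 V1 close A0 (ltW g0) x0 h1 h2.
  move=> /le_trans; apply; rewrite lee_fin /exp_bound /exp_bound_rate/=.
  apply: ler_wpM2r; first exact: expR_ge0.
  lra.
Qed.
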